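(* Let $\mathscr H$ be a complex Hilbert space, let $A_j,B_j\in\mathbb B(\mathscr H)$ $(1\le j\le n)$ be positive operators such that $\sum_{j=1}^nA_j\le I_{\mathscr H}$ and $\sum_{j=1}^nB_j\le I_{\mathscr H}$, let $\sigma_f$ be an operator mean with representing function $f$, and let $p\in[0,1]$. Then for all $t_1,\dots,t_n\in[0,1]$, $$\Big(I_{\mathscr H}-\sum_{j=1}^nA_j\Big)\sigma_{f^p}\Big(I_{\mathscr H}-\sum_{j=1}^nB_j\Big)\le\left(\Big(I_{\mathscr H}-\sum_{j=1}^nt_jA_j\Big)\sigma_f\Big(I_{\mathscr H}-\sum_{j=1}^nt_jB_j\Big)-\sum_{j=1}^n(1-t_j)(A_j\sigma_fB_j)\right)^p\le\left(I_{\mathscr H}-\sum_{j=1}^n(A_j\sigma_fB_j)\right)^p.$$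
   Context: $\mathbb B(\mathscr H)$ is the algebra of bounded linear operators on $\mathscr H$, with identity $I_{\mathscr H}$. $A$ is positive ($A\ge0$) if $\langle Ax,x\rangle\ge0$ for all $x$; $A\le B$ means $B-A\ge0$ for self-adjoint $A,B$. For a positive operator monotone function $g$ on $(0,\infty)$ ($A\le B$ implies $g(A)\le g(B)$), the (Kubo–Ando) connection with representing function $g$ is $A\sigma_gB=A^{1/2}g(A^{-1/2}BA^{-1/2})A^{1/2}$ for positive invertible $A,B$, and is extended to all positive operators by $A\sigma_gB=\lim_{\varepsilon\downarrow0}(A+\varepsilon I_{\mathscr H})\sigma_g(B+\varepsilon I_{\mathscr H})$ in the strong operator topology. It is an operator mean if $g(1)=1$. $\sigma_{f^p}$ is the connection with representing function $t\mapsto f(t)^p$. Powers of positive operators are defined by functional calculus, with $X^0=I_{\mathscr H}$. *)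

(* Defs.v *)
From HB Require Import structures.
From mathcomp Require Import all_boot all_order all_algebra.
From mathcomp Require Import complex.
From mathcomp Require Import all_classical all_reals all_analysis.

Set Implicit Arguments.
Unset Strict Implicit.
Unset Printing Implicit Defensive.

Import Order.TTheory GRing.Theory Num.Theory.
Import numFieldNormedType.Exports.

Local Open Scope classical_set_scope.
Local Open Scope ring_scope.
Local Open Scope complex_scope.

(* The inner product is linear in its first argument and conjugate-linear in
   the second; the norm takes (nonnegative real) values in R[i]. *)
HB.mixin Record isHilbert (R : realType) H of CompleteNormedModule R[i] H := {
  inner : {dot H for @Num.conj R[i]};
  sqr_norm_inner : forall x : H, `|x| ^+ 2 = inner x x
}.

#[short(type="hilbertType")]
HB.structure Definition Hilbert (R : realType) :=
  {H of isHilbert R H & CompleteNormedModule R[i] H}.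

Section operators.
Context {R : realType} {H : hilbertType R}.
Implicit Types (A B C : H -> H) (f g : R -> R).

Definition bounded_op A : Prop :=
  linear A /\ exists M : R, forall x, `|A x| <= M%:C * `|x|.

(* In R[i], 0 <= z means that z is real and nonnegative. *)
Definition positive_op A : Prop := forall x, 0 <= inner (A x) x.

Definition le_op A B : Prop := positive_op (B - A).

Definition id_op : H -> H := idfun.

Definition invertible_op A : Prop :=
  exists B, [/\ bounded_op B, A \o B = id_op & B \o A = id_op].

Definition spectrum A : set R[i] :=
  [set z | ~ invertible_op (A - z *: id_op)].

Definition poly_op (p : {poly R}) A : H -> H :=
  \sum_(i < size p) (p`_i)%:C *: iter i A.

(* B = f(A) in the continuous functional calculus of a self-adjoint A: f is a
   uniform limit, on the (real) spectrum of A, of polynomials p such that p(A)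
   tends to B in operator norm. *)
Definition is_fun_calc f A B : Prop :=
  bounded_op B /\
  forall e : R, 0 < e -> exists p : {poly R},
    (forall t : R, spectrum A t%:C -> `|p.[t] - f t| <= e) /\
    (forall x, `|poly_op p A x - B x| <= e%:C * `|x|).

Definition fun_calc f A : H -> H := xget 0 [set B | is_fun_calc f A B].

(* As 0 `^ 0 = 1, pow_op A 0 is the identity. *)
Definition pow_op A (r : R) : H -> H := fun_calc (fun t => t `^ r) A.

Definition connection_inv g A B : H -> H :=
  pow_op A 2^-1 \o
  fun_calc g (pow_op A (- 2^-1) \o B \o pow_op A (- 2^-1)) \o
  pow_op A 2^-1.

Definition is_connection g A B C : Prop :=
  bounded_op C /\
  forall x, connection_inv g (A + e%:C *: id_op) (B + e%:C *: id_op) x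
              @[e --> (0 : R)^'+] --> C x.

Definition connection g A B : H -> H :=
  xget 0 [set C | is_connection g A B C].

End operators.

(* The operators range over all Hilbert spaces: monotonicity on a single one,
   e.g. of dimension 1, would not be operator monotonicity. *)
Definition operator_monotone (R : realType) (g : R -> R) : Prop :=
  forall (K : hilbertType R) (A B : K -> K),
    bounded_op A -> bounded_op B ->
    positive_op A -> positive_op B -> invertible_op A -> invertible_op B ->
    le_op A B -> le_op (fun_calc g A) (fun_calc g B).

(* g represents a connection; only its values on ]0, +oo[ matter. *)
Definition representing (R : realType) (g : R -> R) : Prop :=
  (forall t, 0 < t -> 0 < g t) /\ operator_monotone g.

Definition mean_representing (R : realType) (f : R -> R) : Prop :=
  representing f /\ f 1 = 1.

(* Main.v *)
(* Superadditivity of a connection, together with its homogeneity, gives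
   (I - sum A_j) s_f (I - sum B_j) <= X <= Y: write I - sum t_j A_j as
   (I - sum A_j) + sum (1 - t_j) A_j, and I as (I - sum t_j A_j) + sum t_j A_j.
   The powers follow from the Loewner-Heinz inequality and from
   A s_(f^p) B <= (A s_f B)^p for A <= I, which is the monotonicity of s_(t^p) in
   its first argument applied to A s_(t^p) (A s_f B) = A s_(f^p) B.

   Superadditivity is a Jensen inequality V* f(T) V <= f(V* T V) for an isometry
   V : H -> H + H. It is obtained from operator monotonicity on H + H alone:
   T <= (1 + d) P T P + N (1 - P) with P = V V* and N large, and f of the right-hand
   side is computed blockwise. Applied to diagonal 2 x 2 matrices the same
   argument shows that f(t) is nondecreasing and f(t) / t nonincreasing, so that
   f is locally Lipschitz.

   The functional calculus rests on: a real polynomial nonnegative on the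
   spectrum of a self-adjoint A gives a positive p(A). *)
From HB Require Import structures.
Require Import Defs.
From mathcomp Require Import all_boot all_order all_algebra.
From mathcomp Require Import complex.
From mathcomp Require Import all_classical all_reals all_analysis.
From mathcomp Require Import ring lra.
Set Implicit Arguments.
Unset Strict Implicit.
Unset Printing Implicit Defensive.
Import Order.TTheory GRing.Theory Num.Theory.
Import numFieldNormedType.Exports.
Local Open Scope classical_set_scope.
Local Open Scope ring_scope.
Local Open Scope complex_scope.

(** * Hilbert spaces and their sums *)

(** Continuity of f is not among the hypotheses, while [fun_calc] takes the default value 0 when f
    is not a uniform limit of polynomials on the spectrum. Operator monotonicity therefore has to be
    tested first on operators whose spectrum has two points, where every f agrees with a polynomial.
    The inequalities obtained in this way make f Lipschitz on each [c, M] with c > 0, and only then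
    does f(A) exist for every strictly positive A. The point 0 is the other obstacle, as f is
    controlled on ]0, +oo[ only. Connections are studied first for operators bounded below by some c
    > 0 and reach positive operators through A + e, e decreasing to 0. The powers, which are Hölder
    at 0, are the only functions applied directly to X and Y; the limits there rest on the strong
    continuity of the functional calculus on bounded sets. Inequalities between operators are
    handled throughout as inequalities between the real quadratic forms [qf]. *)

Section complex_parts.
Context {R : realType}.
Implicit Types z w : R[i].

Lemma Re_conj z : complex.Re (Num.conj z) = complex.Re z.
Proof. by case: z. Qed.

Lemma ReD z w : complex.Re (z + w) = complex.Re z + complex.Re w.
Proof. by case: z; case: w. Qed.

Lemma ReZ (c : R) z : complex.Re (c%:C * z) = c * complex.Re z.
Proof. by case: z => a b /=; rewrite mul0r subr0. Qed.

Lemma Re_conji z : complex.Re (Num.conj 'i * z) = complex.Im z.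
Proof. by case: z => a b /=; ring. Qed.

Lemma Re_i_conji z : complex.Re ('i * (Num.conj 'i * z)) = complex.Re z.
Proof. by case: z => a b /=; ring. Qed.

End complex_parts.

Section real_norm.
Context {R : realType} {V : normedModType R[i]}.
Implicit Types x y z : V.

(* Norms take values in R[i]; nm is the real-valued norm, and ip below is the real
   part of the inner product. *)
Definition nm x : R := complex.Re `|x|.

Lemma real_normE x : `|x| = (nm x)%:C.
Proof. by rewrite /nm RRe_real// ger0_real. Qed.

Lemma nm_ge0 x : 0 <= nm x.
Proof. by have := normr_ge0 x; rewrite real_normE ler0c. Qed.

Lemma nm0 : nm (0 : V) = 0.
Proof. by rewrite /nm normr0. Qed.

Lemma nm_eq0 x : nm x = 0 -> x = 0.
Proof. by move=> x0; apply/normr0_eq0; rewrite real_normE x0. Qed.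

Lemma nm_gt0 x : x != 0 -> 0 < nm x.
Proof.
move=> x0; rewrite lt_neqAle nm_ge0 andbT eq_sym.
by apply: contra_neq x0; exact: nm_eq0.
Qed.

Lemma nmZc (c : R[i]) x : nm (c *: x) = complex.Re `|c| * nm x.
Proof.
have E : (complex.Re `|c|)%:C = `|c| by rewrite RRe_real// ger0_real.
apply: complexI; transitivity (`|c *: x|); first by rewrite real_normE.
by rewrite normrZ -E real_normE -rmorphM.
Qed.

Lemma Re_norm_real (c : R) : complex.Re `|c%:C| = `|c|.
Proof. by rewrite normc_def/= expr0n addr0 sqrtr_sqr. Qed.

Lemma nmZ (c : R) x : nm (c%:C *: x) = `|c| * nm x.
Proof. by rewrite nmZc Re_norm_real. Qed.

Lemma nmN x : nm (- x) = nm x.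
Proof. by rewrite /nm normrN. Qed.

Lemma nmD x y : nm (x + y) <= nm x + nm y.
Proof. by rewrite -lecR rmorphD/= -!real_normE ler_normD. Qed.

Lemma nmB x y : nm (x - y) <= nm x + nm y.
Proof. by rewrite -(nmN y) nmD. Qed.

Lemma nmBC x y : nm (x - y) = nm (y - x).
Proof. by rewrite -nmN opprB. Qed.

Lemma nmB3 y x z : nm (x - z) <= nm (x - y) + nm (y - z).
Proof. by rewrite -{1}(subrK y x) -addrA nmD. Qed.

Lemma cvg_nmP {T} {F : set_system T} {FF : Filter F} (u : T -> V) (l : V) :
  u @ F --> l <-> forall e : R, 0 < e -> \forall t \near F, nm (u t - l) <= e.
Proof.
split=> [/cvgrPdist_le ul e e0|ul].
  have /ul : 0 < e%:C by rewrite ltcR.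
  by apply: filterS => t; rewrite distrC real_normE lecR.
apply/cvgrPdist_le => e e0.
have E : e = (complex.Re e)%:C by rewrite RRe_real// gtr0_real.
have /ul : 0 < complex.Re e by rewrite -ltcR -E.
by apply: filterS => t h; rewrite distrC real_normE E lecR.
Qed.

Lemma nm_ball x (e : R) y : nm (y - x) < e -> ball x e%:C y.
Proof. by move=> h; rewrite -ball_normE /ball_/= distrC real_normE ltcR. Qed.

End real_norm.

Lemma cauchy_nm {R : realType} {V : completeNormedModType R[i]} {T}
    {F : set_system T} {FF : ProperFilter F} (u : T -> V) :
  (forall e : R, 0 < e -> exists y, \forall t \near F, nm (u t - y) <= e) ->
  exists l : V, u @ F --> l.
Proof.
move=> h; suff : cvg (u @ F) by move=> /cvg_ex.
apply: cauchy_cvg; apply: cauchy_exP => e e0.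
have E : e = (complex.Re e)%:C by rewrite RRe_real// gtr0_real.
have e20 : 0 < complex.Re e / 2 by rewrite divr_gt0// -ltcR -E.
have [y Fy] := h _ e20; exists y; near=> t.
rewrite E; apply: nm_ball; near: t; apply: filterS Fy => t /le_lt_trans; apply.
by rewrite ltr_pdivrMr// ltr_pMr ?ltr1n// -ltcR -E.
Unshelve. all: by end_near. Qed.

Section basics.
Context {R : realType} {H : hilbertType R}.
Implicit Types x y z : H.

Definition ip x y : R := complex.Re (inner x y).
Lemma nm_sq x : nm x ^+ 2 = ip x x.
Proof.
apply: complexI; rewrite /ip -sqr_norm_inner real_normE.
by rewrite -rmorphXn.
Qed.

Lemma ipC x y : ip x y = ip y x.
Proof. by rewrite /ip hermitian_subproof expr0 mul1r Re_conj. Qed.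

Lemma ipDl x y z : ip (x + y) z = ip x z + ip y z.
Proof. by rewrite /ip linearDl ReD. Qed.

Lemma ipDr x y z : ip x (y + z) = ip x y + ip x z.
Proof. by rewrite ipC ipDl !(ipC x). Qed.

Lemma ipZl (c : R) x y : ip (c%:C *: x) y = c * ip x y.
Proof. by rewrite /ip linearZl_LR ReZ. Qed.

Lemma ipZr (c : R) x y : ip x (c%:C *: y) = c * ip x y.
Proof. by rewrite ipC ipZl ipC. Qed.

Lemma ipNl x y : ip (- x) y = - ip x y.
Proof. by rewrite -scaleN1r -(rmorphN1 (real_complex R)) ipZl mulN1r. Qed.

Lemma ipNr x y : ip x (- y) = - ip x y.
Proof. by rewrite ipC ipNl ipC. Qed.

Lemma ip0l x : ip 0 x = 0.
Proof. by rewrite -(scale0r x) -(rmorph0 (real_complex R)) ipZl mul0r. Qed.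

Lemma ip0r x : ip x 0 = 0.
Proof. by rewrite ipC ip0l. Qed.

Definition ipE := (ipDl, ipDr, ipNl, ipNr, ipZl, ipZr, ip0l, ip0r).

Lemma ip_i x y : ip ('i *: x) ('i *: y) = ip x y.
Proof. by rewrite /ip linearZl_LR linearZr_LR Re_i_conji. Qed.

Lemma Im_inner x y : complex.Im (inner x y) = ip x ('i *: y).
Proof. by rewrite /ip linearZr_LR Re_conji. Qed.

End basics.

Section hsum.
Context {R : realType}.
Variable H : hilbertType R.

(* The product type itself carries the maximum norm. *)
Definition hsum : Type := (H * H)%type.

HB.instance Definition _ := GRing.Lmodule.on hsum.

Definition hsum_inner (x y : hsum) : R[i] := inner x.1 y.1 + inner x.2 y.2.

Definition hsum_norm (x : hsum) : R[i] :=
  (Num.sqrt (nm x.1 ^+ 2 + nm x.2 ^+ 2))%:C.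

Lemma hsum_normD x y : hsum_norm (x + y) <= hsum_norm x + hsum_norm y.
Proof.
rewrite /hsum_norm -rmorphD/= lecR.
set a1 := nm x.1; set a2 := nm x.2; set b1 := nm y.1; set b2 := nm y.2.
have a1p : 0 <= a1 := nm_ge0 _. have a2p : 0 <= a2 := nm_ge0 _.
have b1p : 0 <= b1 := nm_ge0 _. have b2p : 0 <= b2 := nm_ge0 _.
set s := Num.sqrt (a1 ^+ 2 + _); set t := Num.sqrt (b1 ^+ 2 + _).
have s0 : 0 <= s := sqrtr_ge0 _. have t0 : 0 <= t := sqrtr_ge0 _.
have ss : s ^+ 2 = a1 ^+ 2 + a2 ^+ 2 by rewrite sqr_sqrtr ?addr_ge0 ?sqr_ge0.
have tt : t ^+ 2 = b1 ^+ 2 + b2 ^+ 2 by rewrite sqr_sqrtr ?addr_ge0 ?sqr_ge0.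
have cs : a1 * b1 + a2 * b2 <= s * t.
  rewrite -ler_sqr ?nnegrE ?addr_ge0 ?mulr_ge0//.
  rewrite exprMn ss tt -subr_ge0.
  (* Lagrange's identity: the defect in the Cauchy-Schwarz inequality of the plane is a square. *)
  have -> : (a1 ^+ 2 + a2 ^+ 2) * (b1 ^+ 2 + b2 ^+ 2) - (a1 * b1 + a2 * b2) ^+ 2
     = (a1 * b2 - a2 * b1) ^+ 2 by ring.
  exact: sqr_ge0.
rewrite -[leRHS]ger0_norm ?addr_ge0// -sqrtr_sqr ler_sqrt ?sqr_ge0//.
apply: (@le_trans _ _ ((a1 + b1) ^+ 2 + (a2 + b2) ^+ 2)).
  by rewrite lerD// ler_sqr ?nnegrE ?nm_ge0 ?addr_ge0// nmD.
nra.
Qed.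

Lemma hsum_normZ (l : R[i]) x : hsum_norm (l *: x) = `|l| * hsum_norm x.
Proof.
have E : `|l| = (complex.Re `|l|)%:C by rewrite RRe_real// ger0_real.
rewrite /hsum_norm !nmZc E -rmorphM; congr (_%:C).
have : 0 <= complex.Re `|l| by rewrite -ler0c -E.
move: (complex.Re _) => c c0.
by rewrite !exprMn -mulrDr sqrtrM ?sqr_ge0// sqrtr_sqr ger0_norm.
Qed.

Lemma hsum_norm_eq0 x : hsum_norm x = 0 -> x = 0.
Proof.
case: x => a b /complexI /eqP /=.
rewrite sqrtr_eq0 => h.
have := sqr_ge0 (nm a); have := sqr_ge0 (nm b) => hb ha.
have /eqP : nm a ^+ 2 = 0 by lra.
have /eqP : nm b ^+ 2 = 0 by lra.
by rewrite !sqrf_eq0 => /eqP/nm_eq0 -> /eqP/nm_eq0 ->.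
Qed.

HB.instance Definition _ :=
  Lmodule_isNormed.Build R[i] hsum hsum_normD hsum_normZ hsum_norm_eq0.

Lemma nm_hsum (x : hsum) : nm x = Num.sqrt (nm x.1 ^+ 2 + nm x.2 ^+ 2).
Proof. by []. Qed.

Lemma nm_hsum1 (x : hsum) : nm x.1 <= nm x.
Proof.
rewrite nm_hsum -[leLHS]ger0_norm ?nm_ge0// -sqrtr_sqr.
by rewrite ler_wsqrtr// lerDl sqr_ge0.
Qed.

Lemma nm_hsum2 (x : hsum) : nm x.2 <= nm x.
Proof.
rewrite nm_hsum -[leLHS]ger0_norm ?nm_ge0// -sqrtr_sqr.
by rewrite ler_wsqrtr// lerDr sqr_ge0.
Qed.

Lemma nm_hsum_le (x : hsum) : nm x <= nm x.1 + nm x.2.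
Proof.
have h1 := nm_ge0 x.1; have h2 := nm_ge0 x.2.
rewrite nm_hsum -[leRHS]ger0_norm ?addr_ge0// -sqrtr_sqr ler_wsqrtr//.
by rewrite sqrrD lerD2r lerDl mulrn_wge0 ?mulr_ge0.
Qed.

Lemma hsum_complete (F : set_system hsum) :
  ProperFilter F -> cauchy F -> cvg F.
Proof.
move=> FF /cauchy_ballP cF; apply/cvg_ex.
have cF' (e : R) : 0 < e -> exists y : hsum, \forall t \near F, nm (t - y) <= e.
  move=> e0.
  have /cauchy_ballP/cauchyP/(_ e%:C) := cF.
  rewrite ltcR => /(_ e0) [y Fy]; exists y; apply: filterS Fy => t.
  rewrite -ball_normE /ball_/= distrC => /ltW.
  by rewrite real_normE lecR.
have [l1 hl1] : exists l : H, (fun x : hsum => x.1) @ F --> l.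
  apply: cauchy_nm => e e0; have [y Fy] := cF' e e0; exists y.1.
  by apply: filterS Fy => t; apply: le_trans; exact: (nm_hsum1 (t - y)).
have [l2 hl2] : exists l : H, (fun x : hsum => x.2) @ F --> l.
  apply: cauchy_nm => e e0; have [y Fy] := cF' e e0; exists y.2.
  by apply: filterS Fy => t; apply: le_trans; exact: (nm_hsum2 (t - y)).
exists ((l1, l2) : hsum); apply/(@cvg_nmP R hsum hsum F _ id) => e e0.
have e20 : 0 < e / 2 by rewrite divr_gt0.
near=> t; apply: (le_trans (nm_hsum_le _)).
rewrite [leRHS]splitr lerD//; near: t.
- by move/cvg_nmP : hl1; exact.
- by move/cvg_nmP : hl2; exact.
Unshelve. all: by end_near. Qed.

HB.instance Definition _ := Uniform_isComplete.Build hsum hsum_complete.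

Lemma hsum_inner_bilinear :
  bilinear_for (GRing.Scale.Law.clone _ _ *%R _)
    (GRing.Scale.Law.clone _ _ (Num.conj \; *%R) _) hsum_inner.
Proof.
split=> [u'|u] a x y; rewrite /hsum_inner /=.
- by rewrite !linearPl; ring.
- by rewrite !linearPr /=; ring.
Qed.

HB.instance Definition _ :=
  bilinear_isBilinear.Build R[i] hsum hsum R[i] _ _ hsum_inner
    hsum_inner_bilinear.

Lemma hsum_hermitian (x y : hsum) :
  hsum_inner x y = (-1) ^+ false * Num.conj (hsum_inner y x).
Proof.
rewrite expr0 mul1r /hsum_inner rmorphD.
by congr (_ + _); rewrite hermitian_subproof expr0 mul1r.
Qed.

HB.instance Definition _ :=
  isHermitianSesquilinear.Build R[i] hsum false Num.conj hsum_inner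
    hsum_hermitian.

Lemma sqr_norm_hsum_inner (x : hsum) : `|x| ^+ 2 = hsum_inner x x.
Proof.
rewrite /hsum_inner -!sqr_norm_inner !real_normE nm_hsum -!rmorphXn -rmorphD.
by rewrite sqr_sqrtr// addr_ge0 ?sqr_ge0.
Qed.

Lemma hsum_inner_gt0 (x : hsum) : x != 0 -> 0 < hsum_inner x x.
Proof. by move=> x0; rewrite -sqr_norm_hsum_inner exprn_gt0// normr_gt0. Qed.

HB.instance Definition _ :=
  isDotProduct.Build R[i] hsum hsum_inner hsum_inner_gt0.

HB.instance Definition _ :=
  isHilbert.Build R hsum sqr_norm_hsum_inner.

Lemma ip_hsum (x y : hsum) : ip x y = ip x.1 y.1 + ip x.2 y.2.
Proof. exact: ReD. Qed.

End hsum.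

(** * Bounded operators and quadratic forms *)

Section pointwise.
Context {R : realType} {H K : hilbertType R}.
Implicit Types A B : H -> K.

Lemma opDE A B x : (A + B) x = A x + B x. Proof. by []. Qed.
Lemma opNE A x : (- A) x = - A x. Proof. by []. Qed.
Lemma opZE (c : R[i]) A x : (c *: A) x = c *: A x. Proof. by []. Qed.
Lemma op0E x : (0 : H -> K) x = 0. Proof. by []. Qed.

End pointwise.
Definition opE := (@opDE, @opNE, @opZE, @op0E).

Section bounded_linear.
Context {R : realType}.
Implicit Types H K L : hilbertType R.

Definition blin {H K} (A : H -> K) : Prop :=
  linear A /\ exists M : R, forall x, nm (A x) <= M * nm x.

Lemma bounded_opP {H} (A : H -> H) : bounded_op A <-> blin A.
Proof.
split=> -[lA [M AM]]; split=> //; exists M => x.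
  by have := AM x; rewrite !real_normE -rmorphM lecR.
by rewrite !real_normE -rmorphM lecR.
Qed.

Section linearity.
Context {H K : hilbertType R} {A : H -> K} (bA : blin A).

Lemma blinD x y : A (x + y) = A x + A y.
Proof. by case: bA => lA _; have := lA 1 x y; rewrite !scale1r. Qed.

Lemma blin0 : A 0 = 0.
Proof. by apply: (addrI (A 0)); rewrite -blinD !addr0. Qed.

Lemma blinZ c x : A (c *: x) = c *: A x.
Proof. by case: bA => lA _; have := lA c x 0; rewrite blin0 !addr0. Qed.

Lemma blinN x : A (- x) = - A x.
Proof. by rewrite -scaleN1r blinZ scaleN1r. Qed.

Lemma blinB x y : A (x - y) = A x - A y.
Proof. by rewrite blinD blinN. Qed.

Lemma blin_bound : exists2 M : R, 0 < M & forall x, nm (A x) <= M * nm x.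
Proof.
case: bA => _ [M AM]; exists (`|M| + 1); first by rewrite ltr_wpDl.
move=> x; apply: (le_trans (AM x)); apply: ler_wpM2r; first exact: nm_ge0.
by rewrite (le_trans (ler_norm _))// lerDl.
Qed.

Lemma blin_cvg T (F : set_system T) {FF : Filter F} (u : T -> H) (l : H) :
  u @ F --> l -> A \o u @ F --> A l.
Proof.
move=> /cvg_nmP ul; apply/cvg_nmP => e e0.
have [M M0 AM] := blin_bound.
have /ul : 0 < e / M by rewrite divr_gt0.
apply: filterS => t; rewrite ler_pdivlMr// mulrC => h.
by rewrite /= -blinB; exact: le_trans h.
Qed.

End linearity.

Lemma blin_id {H} : blin (idfun : H -> H).
Proof. by split=> //; exists 1 => x; rewrite mul1r. Qed.

Lemma blin_cst0 {H K} : blin (0 : H -> K).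
Proof.
split; first by move=> c x y; rewrite !opE scaler0 addr0.
by exists 0 => x; rewrite mul0r nm0.
Qed.

Lemma blin_comp {H K L} (A : K -> L) (B : H -> K) :
  blin A -> blin B -> blin (A \o B).
Proof.
move=> bA bB; split.
  by move=> c x y /=; rewrite (blinD bB) (blinZ bB) (blinD bA) (blinZ bA).
have [M M0 AM] := blin_bound bA; have [N N0 BN] := blin_bound bB.
exists (M * N) => x /=; apply: (le_trans (AM _)).
by rewrite -mulrA ler_wpM2l// ltW.
Qed.

Lemma blin_add {H K} (A B : H -> K) : blin A -> blin B -> blin (A + B).
Proof.
move=> bA bB; split.
  move=> c x y; rewrite !opE (blinD bB) (blinZ bB) (blinD bA) (blinZ bA).
  by rewrite scalerDr addrACA.
have [M M0 AM] := blin_bound bA; have [N N0 BN] := blin_bound bB.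
exists (M + N) => x; rewrite !opE.
by apply: (le_trans (nmD _ _)); rewrite mulrDl lerD.
Qed.

Lemma blin_scale {H K} (c : R[i]) (A : H -> K) : blin A -> blin (c *: A).
Proof.
move=> bA; split.
  move=> d x y; rewrite !opE (blinD bA) (blinZ bA) scalerDr.
  by rewrite !scalerA mulrC.
have [M M0 AM] := blin_bound bA.
exists (complex.Re `|c| * M) => x; rewrite !opE nmZc -mulrA ler_wpM2l//.
by rewrite -ler0c RRe_real// ger0_real.
Qed.

Lemma blin_opp {H K} (A : H -> K) : blin A -> blin (- A).
Proof. by move=> bA; rewrite -scaleN1r; exact: blin_scale. Qed.

Lemma blin_sub {H K} (A B : H -> K) : blin A -> blin B -> blin (A - B).
Proof. by move=> bA bB; apply: blin_add => //; exact: blin_opp. Qed.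

Lemma blin_sum {H K} I (r : seq I) (P : pred I) (A : I -> H -> K) :
  (forall i, P i -> blin (A i)) -> blin (\sum_(i <- r | P i) A i).
Proof. by move=> bA; elim/big_ind : _ => //; [exact: blin_cst0|exact: blin_add]. Qed.

Lemma blin_iter {H} (A : H -> H) n : blin A -> blin (iter n A).
Proof.
by move=> bA; elim: n => [|n IH]; [exact: blin_id|exact: (blin_comp bA IH)].
Qed.

End bounded_linear.

Section forms.
Context {R : realType} {H : hilbertType R}.
Implicit Types (A B : H -> H).

Definition qf A x : R := ip (A x) x.
Definition symm A := forall x y, ip (A x) y = ip x (A y).

Lemma qfD A B x : qf (A + B) x = qf A x + qf B x.
Proof. by rewrite /qf !opE ipDl. Qed.

Lemma qfB A B x : qf (A - B) x = qf A x - qf B x.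
Proof. by rewrite /qf !opE ipDl ipNl. Qed.

Lemma qfZ (c : R) A x : qf (c%:C *: A) x = c * qf A x.
Proof. by rewrite /qf !opE ipZl. Qed.

Lemma qf_id x : qf id_op x = nm x ^+ 2.
Proof. by rewrite nm_sq. Qed.

Lemma qf_sum I (r : seq I) (P : pred I) (A : I -> H -> H) x :
  qf (\sum_(i <- r | P i) A i) x = \sum_(i <- r | P i) qf (A i) x.
Proof.
elim/big_rec2 : _ => [|i y B _ <-]; first by rewrite /qf opE ip0l.
exact: qfD.
Qed.

Lemma symm_id : symm id_op.
Proof. by []. Qed.

Lemma symmD A B : symm A -> symm B -> symm (A + B).
Proof. by move=> sA sB x y; rewrite !opE ipDl ipDr sA sB. Qed.

Lemma symmZ (c : R) A : symm A -> symm (c%:C *: A).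
Proof. by move=> sA x y; rewrite !opE ipZl ipZr sA. Qed.

Lemma symmB A B : symm A -> symm B -> symm (A - B).
Proof. by move=> sA sB x y; rewrite !opE !ipE sA sB. Qed.

(** On a complex space a real-valued form is symmetric, by polarization of [ip (A z) ('i *: z) = 0].
    This is what allows the rest of the proof to work with the real parts [ip] and [qf] alone. *)
Lemma positive_opP A : blin A ->
  positive_op A <-> symm A /\ forall x, 0 <= qf A x.
Proof.
move=> bA; split=> [pA|[sA qA] x].
  split=> [x y|x]; last first.
    by have := pA x; rewrite lecE => /andP[_].
  have im z : ip (A z) ('i *: z) = 0.
    by rewrite -Im_inner; exact: ger0_Im.
  have pol u v : ip (A u) ('i *: v) = - ip (A v) ('i *: u).
    have := im (u + v).
    by rewrite (blinD bA) scalerDr !ipE !im; lra.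
  have yE : y = 'i *: (- ('i *: y)).
    by rewrite scalerN scalerA -expr2 sqr_i scaleN1r opprK.
  rewrite {1}yE pol (blinN bA) ipNl opprK (blinZ bA).
  by rewrite ip_i ipC.
have im : ip (A x) ('i *: x) = 0.
  have h : ip (A x) ('i *: x) = ip x ('i *: A x) by rewrite sA (blinZ bA).
  have : ip x ('i *: A x) = - ip (A x) ('i *: x).
    rewrite -(ip_i x) scalerA -expr2 sqr_i scaleN1r ipNr.
    by rewrite ipC.
  by rewrite -h; lra.
by rewrite lecE /= Im_inner im eqxx; exact: qA.
Qed.

(** The polynomial t |-> [qf A (x + t y)] is nonnegative; it is evaluated at its minimum. *)
Lemma form_CS A x y : blin A -> symm A -> (forall z, 0 <= qf A z) ->
  ip (A x) y ^+ 2 <= qf A x * qf A y.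
Proof.
move=> bA sA pA.
have h (t : R) : 0 <= qf A x + 2 * t * ip (A x) y + t ^+ 2 * qf A y.
  have := pA (x + t%:C *: y); congr (_ <= _).
  rewrite /qf (blinD bA) (blinZ bA) !ipE (sA y x) (ipC y); ring.
have [y0|y0] := eqVneq (qf A y) 0.
  rewrite y0 mulr0.
  (* When [qf A y = 0] the polynomial is affine in t, and at this t it would be -1 if its slope were
     nonzero. *)
  have := h (- (qf A x + 1) / (2 * ip (A x) y)).
  rewrite y0 mulr0 addr0.
  have [->|b0] := eqVneq (ip (A x) y) 0; first by rewrite expr0n.
  rewrite (_ : 2 * _ * _ = - (qf A x + 1)); last by field.
  lra.
have yp : 0 < qf A y by rewrite lt_neqAle eq_sym y0 pA.
have := h (- ip (A x) y / qf A y).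
rewrite (_ : _ + _ + _ = (qf A x * qf A y - ip (A x) y ^+ 2) / qf A y); last by field.
by rewrite pmulr_lge0 ?invr_gt0// subr_ge0.
Qed.

Lemma ip_le (x y : H) : ip x y <= nm x * nm y.
Proof.
have := form_CS x y (@blin_id R H) symm_id.
rewrite !qf_id -exprMn.
have P z : 0 <= qf id_op z by rewrite qf_id sqr_ge0.
move=> /(_ P); rewrite /id_op /=.
have := ler_norm (ip x y); move=> h1 h2; apply: (le_trans h1).
rewrite -ler_sqr ?nnegrE ?mulr_ge0 ?nm_ge0//.
by rewrite real_normK// num_real.
Qed.

(** Cauchy-Schwarz for the form of A at the vectors x and A x, divided by |A x|^2. It converts
    bounds on forms into bounds on norms. *)
Lemma nm_pos_sq A (M : R) x : blin A -> symm A ->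
  (forall z, 0 <= qf A z) -> (forall z, qf A z <= M * nm z ^+ 2) ->
  nm (A x) ^+ 2 <= M * qf A x.
Proof.
move=> bA sA pA AM.
have [Ax0|Ax0] := eqVneq (nm (A x)) 0.
  by rewrite Ax0 expr0n /qf (nm_eq0 Ax0) ip0l mulr0.
have c := form_CS x (A x) bA sA pA.
have Ap : 0 < nm (A x) ^+ 2 by rewrite exprn_gt0// lt_neqAle eq_sym Ax0 nm_ge0.
rewrite -nm_sq in c.
have {c} := le_trans c (ler_wpM2l (pA x) (AM (A x))).
move: (nm (A x) ^+ 2) Ap => s s0.
by rewrite expr2 mulrA ler_pM2r// mulrC.
Qed.

End forms.

(** * Criteria of invertibility *)

Section invertibility.
Context {R : realType} {H : hilbertType R}.
Implicit Types A B T : H -> H.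

Lemma invertible_bounded_below T (c : R) : blin T -> 0 < c ->
  (forall x, c * nm x <= nm (T x)) -> (forall y, exists x, T x = y) ->
  invertible_op T.
Proof.
move=> bT c0 Tc /choice[D TD].
have Tinj x y : T x = T y -> x = y.
  move=> Txy; have := Tc (x - y); rewrite (blinB bT) Txy subrr nm0.
  rewrite pmulr_rle0// => h; apply/eqP; rewrite -subr_eq0; apply/eqP/nm_eq0.
  by apply: le_anti; rewrite h nm_ge0.
exists D; split; first 1 last.
- exact/funext.
- by apply/funext => x /=; apply: Tinj; rewrite TD.
apply/bounded_opP; split.
  by move=> a x y; apply: Tinj; rewrite (blinD bT) (blinZ bT) !TD.
exists c^-1 => x; rewrite mulrC ler_pdivlMr// mulrC.
by apply: (le_trans (Tc _)); rewrite TD.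
Qed.

Lemma invertible_below T : blin T -> invertible_op T ->
  exists2 c : R, 0 < c & forall x, c * nm x <= nm (T x).
Proof.
move=> bT [D [/bounded_opP bD TD DT]].
have [M M0 DM] := blin_bound bD.
exists M^-1; first by rewrite invr_gt0.
move=> x; rewrite mulrC ler_pdivrMr// mulrC; have E : D (T x) = x by rewrite -[LHS]/((D \o T) x) DT.
by rewrite -[X in nm X <= _]E.
Qed.

Lemma invertible_inverses T L U : blin T -> blin L -> blin U ->
  L \o T = id_op -> T \o U = id_op -> invertible_op T.
Proof.
move=> bT bL bU LT TU; exists U; split=> //; first exact/bounded_opP.
suff -> : U = L by [].
by rewrite -[U]/(id_op \o U) -LT -compA TU.
Qed.

Lemma invertible_comp A B : invertible_op A -> invertible_op B ->
  invertible_op (A \o B).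
Proof.
move=> [A' [/bounded_opP bA' AA' A'A]] [B' [/bounded_opP bB' BB' B'B]].
exists (B' \o A'); split; first exact/bounded_opP/blin_comp.
- by rewrite -compA (compA B B') BB'.
- by rewrite -compA (compA A' A) A'A.
Qed.

Lemma invertible_opp T : blin T -> invertible_op T -> invertible_op (- T).
Proof.
move=> bT [B [/bounded_opP bB TB BT]].
exists (- B); split; first exact/bounded_opP/blin_opp.
- by rewrite -TB; apply/funext => x /=; rewrite !opE (blinN bT) opprK.
- by rewrite -BT; apply/funext => x /=; rewrite !opE (blinN bB) opprK.
Qed.

Lemma neumann (K : H -> H) (k t : R) : blin K -> 0 <= k -> k < t ->
  (forall x, nm (K x) <= k * nm x) -> invertible_op (K - t%:C *: id_op).
Proof.
move=> bK k0 kt Kk; have t0 : 0 < t := le_lt_trans k0 kt.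
have bT : blin (K - t%:C *: id_op) by apply: blin_sub => //; apply/blin_scale/blin_id.
apply: (invertible_bounded_below (c := t - k)) => //; first by rewrite subr_gt0.
  move=> x; rewrite !opE /id_op/= mulrBl lerBlDr.
  have := nmB3 (K x) (t%:C *: x) 0; rewrite !subr0 nmZ gtr0_norm//.
  move=> h; apply: (le_trans h); rewrite nmBC lerD2l; exact: Kk.
(* A fixed point of the contraction [Phi], of ratio k / t, solves K x - t x = y. *)
move=> y; pose Phi x := (t^-1)%:C *: (K x - y).
have tV : t%:C * (t^-1)%:C = 1 by rewrite -rmorphM mulfV ?gt_eqF.
pose u n := iter n Phi 0; pose q := k / t.
have q0 : 0 <= q by rewrite divr_ge0// ltW.
have q1 : q < 1 by rewrite ltr_pdivrMr// mul1r.
have PhiB x z : nm (Phi x - Phi z) <= q * nm (x - z).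
  rewrite -scalerBr nmZ opprD addrACA subrr addr0 -(blinB bK).
  rewrite ger0_norm ?invr_ge0 ?(ltW t0)// /q -mulrA mulrCA.
  by rewrite ler_pM2l ?invr_gt0.
(* As D = q D + |Phi 0|, the ball of radius D is stable under [Phi] and contains all the iterates of
   0. *)
pose D := nm (Phi 0) / (1 - q).
have uD n : nm (u n) <= D.
  have D0 : 0 <= D by rewrite divr_ge0 ?nm_ge0// subr_ge0 ltW.
  elim: n => [|n IH]; first by rewrite nm0.
  have -> : D = q * D + nm (Phi 0) by rewrite /D; field; rewrite subr_eq0 gt_eqF.
  rewrite /u iterS -[X in nm X](subrK (Phi 0)); apply: (le_trans (nmD _ _)).
  by rewrite lerD2r; apply: (le_trans (PhiB _ _)); rewrite subr0 ler_wpM2l.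
have uB N n : nm (u (N + n)%N - u N) <= q ^+ N * D.
  elim: N => [|N IH]; first by rewrite expr0 mul1r subr0.
  rewrite addSn /u !iterS; apply: (le_trans (PhiB _ _)).
  by rewrite exprS -mulrA ler_wpM2l.
have [l ul] : exists l : H, u @ \oo --> l.
  apply: cauchy_nm => e e0.
  have : (fun n => q ^+ n * D) @ \oo --> (0 * D : R).
    by apply: cvgM; [apply: cvg_expr; rewrite ger0_norm|exact: cvg_cst].
  rewrite mul0r => /cvgrPdist_le/(_ _ e0) [N _ hN].
  exists (u N); exists N => // n /= Nn.
  rewrite -(subnKC Nn); apply: (le_trans (uB _ _)).
  have := hN N (leqnn N); rewrite /= sub0r normrN; apply: le_trans.
  exact: ler_norm.
exists l; rewrite !opE /id_op/=.
have h1 : Phi \o u @ \oo --> l.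
  by rewrite -(cvg_shiftS u) in ul.
have h2 : Phi \o u @ \oo --> Phi l.
  apply/cvg_nmP => e e0; move/cvg_nmP : ul => /(_ _ e0); apply: filterS => n h.
  apply: (le_trans (PhiB _ _)); apply: (le_trans _ h).
  by rewrite ler_piMl ?nm_ge0// ltW.
have -> : K l - t%:C *: l = K l - t%:C *: Phi l.
  by congr (_ - _ *: _); apply: (cvg_unique _ h1 h2).
by rewrite /Phi scalerA tV scale1r subKr.
Qed.

Definition between (m M : R) A := [/\ blin A, symm A &
  forall x, m * nm x ^+ 2 <= qf A x /\ qf A x <= M * nm x ^+ 2].

Lemma pos_norm A (M : R) : between 0 M A -> forall x, nm (A x) <= `|M| * nm x.
Proof.
move=> [bA sA AM] x.
have pA z : 0 <= qf A z by have [] := AM z; rewrite mul0r.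
have h := nm_pos_sq x bA sA pA (fun z => (AM z).2).
have M' : `|M| * qf A x <= `|M| * (`|M| * nm x ^+ 2).
  rewrite ler_wpM2l//; apply: (le_trans (AM x).2).
  by rewrite ler_wpM2r ?sqr_ge0// ler_norm.
rewrite -ler_sqr ?nnegrE ?mulr_ge0 ?nm_ge0//.
apply: (le_trans h); apply: (@le_trans _ _ (`|M| * qf A x)).
  by rewrite ler_wpM2r// ler_norm.
by apply: (le_trans M'); rewrite exprMn expr2 mulrA.
Qed.

Lemma symm_bound A : blin A -> symm A -> exists2 M, 0 < M & between (- M) M A.
Proof.
move=> bA sA; have [M M0 AM] := blin_bound bA; exists M => //; split=> // x.
have h z : ip (A z) x <= nm (A z) * nm x := ip_le _ _.
split; last first.
  by apply: (le_trans (h x)); rewrite expr2 mulrA ler_wpM2r ?nm_ge0.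
rewrite mulNr lerNl; have := ip_le (A x) (- x); rewrite ipNr nmN => /le_trans; apply.
by rewrite expr2 mulrA ler_wpM2r ?nm_ge0.
Qed.

Lemma strictly_positive_invertible A (c : R) : blin A -> symm A -> 0 < c ->
  (forall x, c * nm x ^+ 2 <= qf A x) -> invertible_op A.
Proof.
move=> bA sA c0 cA; have [M M0 [_ _ AM]] := symm_bound bA sA.
(* From c <= A <= M follows 0 <= K <= M, so K has norm at most M < t, and A = t - K falls under
   [neumann]. *)
pose t := M + c; pose K := t%:C *: id_op - A.
have bK : blin K by apply: blin_sub => //; apply/blin_scale/blin_id.
have KM : between 0 M K.
  split=> //; first by apply: symmB => //; exact/symmZ/symm_id.
  move=> x; rewrite qfB qfZ qf_id mul0r; have := AM x; have := cA x.
  have := sqr_ge0 (nm x); rewrite /t.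
  move: (nm x ^+ 2) => n; nra.
have E : A = - (K - t%:C *: id_op) by rewrite /K addrAC subrr add0r opprK.
rewrite E; apply: invertible_opp; first by rewrite -[_ - _]opprK -E; exact: blin_opp.
apply: (@neumann K M t) => //; first exact: ltW.
- by rewrite /t ltrDl.
- by move=> x; have := pos_norm KM x; rewrite gtr0_norm.
Qed.

End invertibility.

(** * Polynomials in a self-adjoint operator and its spectrum *)

Section polynomials.
Context {R : realType} {H : hilbertType R}.
Implicit Types (A B T : H -> H) (P Q : {poly R[i]}) (p q : {poly R}).

(** Complex coefficients, unlike in [poly_op], so that a polynomial splits into linear factors. *)
Definition opoly P A : H -> H := \sum_(i < size P) P`_i *: iter i A.

Lemma opolyE n P A : (size P <= n)%N ->
  opoly P A = \sum_(i < n) P`_i *: iter i A.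
Proof.
move=> Pn; rewrite /opoly (big_ord_widen _ (fun i => P`_i *: iter i A) Pn).
rewrite big_mkcond/=; apply: eq_bigr => i _; case: ltnP => // h.
by rewrite nth_default// scale0r.
Qed.

Lemma opolyD P Q A : opoly (P + Q) A = opoly P A + opoly Q A.
Proof.
pose n := maxn (size P) (size Q).
rewrite (@opolyE n) ?size_polyD// (@opolyE n P) ?leq_maxl//.
rewrite (@opolyE n Q) ?leq_maxr// -big_split/=; apply: eq_bigr => i _.
by rewrite coefD scalerDl.
Qed.

Lemma opolyC c A : opoly c%:P A = c *: id_op.
Proof.
by rewrite (@opolyE 1) ?size_polyC ?leq_b1// big_ord1 coefC eqxx.
Qed.

Lemma opolyMX P A x : opoly (P * 'X) A x = opoly P A (A x).
Proof.
rewrite (@opolyE (size P).+1) ?(leq_trans (size_polyMleq _ _)) ?size_polyX ?addn2//.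
rewrite big_ord_recl coefMX eqxx scale0r add0r /opoly !fct_sumE.
by apply: eq_bigr => i _; rewrite coefMX /= !opE -iterSr.
Qed.

Lemma opolyZ c P A : opoly (c *: P) A = c *: opoly P A.
Proof.
rewrite (@opolyE (size P)) ?size_scale_leq// /opoly scaler_sumr.
by apply: eq_bigr => i _; rewrite coefZ scalerA.
Qed.

Lemma blin_opoly P A : blin A -> blin (opoly P A).
Proof. by move=> bA; apply: blin_sum => i _; apply/blin_scale/blin_iter. Qed.

Lemma opoly_comm P A B x : blin B -> (forall y, A (B y) = B (A y)) ->
  opoly P A (B x) = B (opoly P A x).
Proof.
move=> bB AB; elim/poly_ind: P x => [|P c IH] x.
  by rewrite /opoly size_poly0 big_ord0 !opE (blin0 bB).
by rewrite opolyD opolyC !opE !opolyMX AB IH (blinD bB) (blinZ bB).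
Qed.

Lemma opolyM P Q A x : blin A -> opoly (P * Q) A x = opoly P A (opoly Q A x).
Proof.
move=> bA; elim/poly_ind: P x => [|P c IH] x.
  by rewrite mul0r /opoly size_poly0 big_ord0.
rewrite mulrDl mul_polyC opolyD opolyD opolyZ opolyC !opE opolyMX.
rewrite mulrAC opolyMX IH; congr (opoly P A _ + _).
by rewrite opoly_comm.
Qed.

Lemma opoly_prod_XsubC (rs : seq R[i]) A : blin A ->
  (forall z, z \in rs -> invertible_op (A - z *: id_op)) ->
  invertible_op (opoly (\prod_(z <- rs) ('X - z%:P)) A).
Proof.
move=> bA; elim: rs => [|z rs IH] h.
  rewrite big_nil opolyC scale1r; exists id_op; split => //.
  exact/bounded_opP/blin_id.
have -> : opoly (\prod_(w <- z :: rs) ('X - w%:P)) A =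
    (A - z *: id_op) \o opoly (\prod_(w <- rs) ('X - w%:P)) A.
  apply/funext => x; rewrite big_cons opolyM//= opolyD -polyCN opolyC.
  rewrite !opE scaleNr; congr (_ - _).
  by rewrite -['X]mul1r opolyMX opolyC scale1r.
apply: invertible_comp; first by apply: h; rewrite mem_head.
by apply: IH => w wrs; apply: h; rewrite inE wrs orbT.
Qed.

Lemma poly_opE p A : poly_op p A = opoly (map_poly (real_complex R) p) A.
Proof.
rewrite /poly_op /opoly size_map_poly; apply: eq_bigr => i _.
by rewrite coef_map.
Qed.

Lemma poly_opD p q A : poly_op (p + q) A = poly_op p A + poly_op q A.
Proof. by rewrite !poly_opE rmorphD/= opolyD. Qed.

Lemma poly_opC c A : poly_op c%:P A = c%:C *: id_op.
Proof. by rewrite !poly_opE map_polyC/= opolyC. Qed.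

Lemma poly_opZ c p A : poly_op (c *: p) A = c%:C *: poly_op p A.
Proof. by rewrite !poly_opE map_polyZ/= opolyZ. Qed.

Lemma poly_opN p A : poly_op (- p) A = - poly_op p A.
Proof. by rewrite -scaleN1r poly_opZ rmorphN1 scaleN1r. Qed.

Lemma poly_opB p q A : poly_op (p - q) A = poly_op p A - poly_op q A.
Proof. by rewrite poly_opD poly_opN. Qed.

Lemma poly_opM p q A x : blin A ->
  poly_op (p * q) A x = poly_op p A (poly_op q A x).
Proof. by move=> bA; rewrite !poly_opE rmorphM/= opolyM. Qed.

Lemma poly_opMX p A x : poly_op (p * 'X) A x = poly_op p A (A x).
Proof. by rewrite !poly_opE rmorphM/= map_polyX opolyMX. Qed.

Lemma poly_opX A : poly_op 'X A = A.
Proof. by apply/funext => x; rewrite -['X]mul1r poly_opMX poly_opC scale1r. Qed.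

Lemma blin_poly_op p A : blin A -> blin (poly_op p A).
Proof. by move=> bA; rewrite poly_opE; exact: blin_opoly. Qed.

Lemma symm_iter A n : symm A -> symm (iter n A).
Proof.
move=> sA; elim: n => [|n IH] x y //.
by rewrite [in RHS]iterSr /= sA IH.
Qed.

Lemma symm_poly_op p A : symm A -> symm (poly_op p A).
Proof.
move=> sA; rewrite /poly_op; elim/big_ind : _.
- by move=> x y; rewrite !opE !ipE.
- exact: symmD.
- by move=> i _; apply/symmZ/symm_iter.
Qed.

(** Let m be the best lower bound of the form and B = A - m. If B were invertible, c |x| <= |B x|
    together with |B x|^2 <= N <B x, x> would improve the bound by c^2 / N. The nonzero vector makes
    the set of lower bounds bounded above. *)
Lemma lowest_in_spectrum A : blin A -> symm A -> (exists x : H, x != 0) ->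
  exists2 m : R, spectrum A m%:C & forall x, m * nm x ^+ 2 <= qf A x.
Proof.
move=> bA sA [x0 x00]; have [M M0 [_ _ AM]] := symm_bound bA sA.
pose S : set R := [set m | forall x, m * nm x ^+ 2 <= qf A x].
have supS : has_sup S.
  split; first by exists (- M) => x; have [] := AM x.
  exists M => m /(_ x0) h; have := le_trans h (AM x0).2.
  by rewrite ler_pM2r// exprn_gt0// nm_gt0.
have Sm : S (sup S).
  move=> x; have [->|xn0] := eqVneq x 0.
    by rewrite nm0 expr0n mulr0 /qf (blin0 bA) ip0l.
  have nx : 0 < nm x ^+ 2 by rewrite exprn_gt0// nm_gt0.
  rewrite -ler_pdivlMr//; apply: ge_sup; first by case: supS.
  by move=> m Sm; rewrite ler_pdivlMr.
exists (sup S) => //; rewrite /spectrum/= => inv.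
set B := A - _ in inv.
have bB : blin B by apply: blin_sub => //; apply/blin_scale/blin_id.
have sB : symm B by apply: symmB => //; apply/symmZ/symm_id.
have qB x : qf B x = qf A x - sup S * nm x ^+ 2 by rewrite qfB qfZ qf_id.
have B0 z : 0 <= qf B z by rewrite qB subr_ge0.
have [N N0 [_ _ BN]] := symm_bound bB sB.
have [c c0 cB] := invertible_below bB inv.
have : sup S < sup S + c ^+ 2 / N by rewrite ltrDl divr_gt0// exprn_gt0.
rewrite ltNge => /negP; apply; apply: sup_upper_bound => // x.
have h := nm_pos_sq x bB sB B0 (fun z => (BN z).2).
rewrite mulrDl -lerBrDl -qB mulrAC ler_pdivrMr// [leRHS]mulrC.
apply: le_trans h; rewrite -exprMn ler_sqr ?nnegrE ?mulr_ge0 ?nm_ge0 ?(ltW c0)//.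
Qed.

(** For z = a + i b, the product of A - z and A - conj z is (A - a)^2 + b^2 >= b^2, which is
    invertible when b is nonzero. *)
Lemma spectrum_real A z : blin A -> symm A -> spectrum A z ->
  z = (complex.Re z)%:C.
Proof.
move=> bA sA; case: z => a b /= Sz.
have [->//|b0] := eqVneq b 0; exfalso; apply: Sz.
pose A1 := A - (a +i* b) *: id_op; pose A2 := A - (a -i* b) *: id_op.
have bA1 : blin A1 by apply: blin_sub => //; apply/blin_scale/blin_id.
have bA2 : blin A2 by apply: blin_sub => //; apply/blin_scale/blin_id.
pose p := ('X - a%:P) ^+ 2 + (b ^+ 2)%:P : {poly R}.
have E12 : A1 \o A2 = poly_op p A /\ A2 \o A1 = poly_op p A.
  have zz : (a +i* b) * (a -i* b) = (a ^+ 2 + b ^+ 2)%:C by rewrite /GRing.mul/=; congr (_ +i* _); ring.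
  have zD : (a +i* b) + (a -i* b) = (2 * a)%:C by rewrite /GRing.add/=; congr (_ +i* _); ring.
  have E : poly_op p A = A \o A - (2 * a)%:C *: A + (a ^+ 2 + b ^+ 2)%:C *: id_op.
    have -> : p = 'X * 'X - (2 * a) *: 'X + (a ^+ 2 + b ^+ 2)%:P.
      by rewrite /p -mul_polyC !polyCD !polyC_exp !polyCM polyC_natr; ring.
    apply/funext => x; rewrite !poly_opD poly_opN poly_opZ poly_opC poly_opX !opE.
    by rewrite poly_opMX poly_opX.
  have rearrange (u v w s : H) : u - v + (s - w) = u - (w + v) + s.
    by rewrite opprD !addrA [LHS]addrAC (addrAC u).
  split; apply/funext => x; rewrite E /= /A1 /A2 !opE /id_op/= (blinB bA) (blinZ bA).
    by rewrite scalerBr scalerA zz opprB -zD scalerDl rearrange.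
  by rewrite scalerBr scalerA mulrC zz opprB -zD (addrC (a +i* b)) scalerDl rearrange.
have [D [/bounded_opP bD pD Dp]] : invertible_op (poly_op p A).
  have b2 : 0 < b ^+ 2 by rewrite exprn_even_gt0.
  apply: (strictly_positive_invertible (c := b ^+ 2)) => //.
  - exact: blin_poly_op.
  - exact: symm_poly_op.
  - move=> x; rewrite /p poly_opD poly_opC qfD qfZ qf_id lerDr.
    rewrite expr2 /qf poly_opM// symm_poly_op// -nm_sq; exact: sqr_ge0.
apply: (@invertible_inverses _ _ A1 (D \o A2) (A2 \o D)) => //.
- exact: blin_comp.
- exact: blin_comp.
- by rewrite -compA E12.2.
- by rewrite compA E12.1.
Qed.

Lemma spectrum_itv A m M z : between m M A -> spectrum A z%:C -> m <= z <= M.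
Proof.
move=> [bA sA AmM] Sz; apply/andP; split; rewrite leNgt; apply/negP => h.
  apply: Sz; apply: (strictly_positive_invertible (c := m - z)).
  - by apply: blin_sub => //; apply/blin_scale/blin_id.
  - by apply: symmB => //; apply/symmZ/symm_id.
  - by rewrite subr_gt0.
  - by move=> x; rewrite qfB qfZ qf_id mulrBl lerD2r; have [] := AmM x.
have bT : blin (z%:C *: id_op - A).
  by apply: blin_sub => //; apply/blin_scale/blin_id.
apply: Sz; rewrite -[_ - _]opprB; apply: invertible_opp => //.
apply: (strictly_positive_invertible (c := z - M)) => //.
- by apply: symmB => //; apply/symmZ/symm_id.
- by rewrite subr_gt0.
- by move=> x; rewrite qfB qfZ qf_id mulrBl lerD2l lerN2; have [] := AmM x.
Qed.

(* Spectral mapping: the lowest value m of the quadratic form of p(A) makes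
   p(A) - m = c prod (A - z_i) singular, so some root z_i of p - m is in the
   spectrum of A; it is real, and 0 <= p(z_i) = m. *)
Lemma poly_op_ge0 p A : blin A -> symm A ->
  (forall t : R, spectrum A t%:C -> 0 <= p.[t]) ->
  forall x, 0 <= qf (poly_op p A) x.
Proof.
move=> bA sA pA x; have [->|x0] := eqVneq x 0.
  by rewrite /qf (blin0 (blin_poly_op p bA)) ip0l.
have ex0 : exists x : H, x != 0 by exists x.
have [m Sm mp] := lowest_in_spectrum (blin_poly_op p bA) (symm_poly_op p sA) ex0.
suff m0 : 0 <= m by apply: le_trans (mp x); rewrite mulr_ge0 ?sqr_ge0.
pose q := p - m%:P.
have qS : ~ invertible_op (poly_op q A) by rewrite poly_opB poly_opC.
suff [t St qt] : exists2 t : R, spectrum A t%:C & q.[t] = 0.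
  have := pA t St; move: qt; rewrite /q hornerD hornerN hornerC => /eqP.
  by rewrite subr_eq0 => /eqP ->.
(* If p is constant there are no roots to choose from, and any point of the spectrum will do. *)
have [q0|q0] := eqVneq q 0.
  have [t St _] := lowest_in_spectrum bA sA ex0.
  by exists t => //; rewrite q0 horner0.
pose Q := map_poly (real_complex R) q.
have Q0 : Q != 0 by rewrite map_poly_eq0.
have [rs Qrs] := closed_field_poly_normal Q.
apply: contrapT => nt; apply: qS; rewrite poly_opE -/Q Qrs opolyZ.
have [B [/bounded_opP bB h1 h2]] : invertible_op (opoly (\prod_(z <- rs) ('X - z%:P)) A).
  apply: opoly_prod_XsubC => // z zrs; apply: contrapT => Sz; apply: nt.
  have zE := spectrum_real bA sA Sz; exists (complex.Re z).
    by rewrite /spectrum/= -zE.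
  have Qz : Q.[(complex.Re z)%:C] = (q.[complex.Re z])%:C by exact: horner_map.
  apply: complexI; rewrite -Qz -zE Qrs hornerZ.
  have /eqP -> : root (\prod_(z <- rs) ('X - z%:P)) z by rewrite root_prod_XsubC.
  by rewrite mulr0.
have l0 : lead_coef Q != 0 by rewrite lead_coef_eq0.
have bP := blin_opoly (\prod_(z <- rs) ('X - z%:P)) bA.
exists ((lead_coef Q)^-1 *: B); split; first exact/bounded_opP/blin_scale.
- rewrite -h1; apply/funext => y /=; rewrite !opE (blinZ bP) scalerA mulfV//.
  by rewrite scale1r.
- rewrite -h2; apply/funext => y /=; rewrite !opE (blinZ bB) scalerA mulVf//.
  by rewrite scale1r.
Qed.

(** [poly_op_ge0] for the polynomial e^2 - p^2, since <p(A)^2 x, x> = |p(A) x|^2. *)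
Lemma poly_op_norm p A (e : R) : blin A -> symm A -> 0 <= e ->
  (forall t : R, spectrum A t%:C -> `|p.[t]| <= e) ->
  forall x, nm (poly_op p A x) <= e * nm x.
Proof.
move=> bA sA e0 pe x; rewrite -ler_sqr ?nnegrE ?mulr_ge0 ?nm_ge0//.
have := @poly_op_ge0 ((e ^+ 2)%:P - p * p) A bA sA _ x.
rewrite poly_opB poly_opC qfB qfZ qf_id subr_ge0 exprMn.
rewrite {1}/qf poly_opM// symm_poly_op// -nm_sq; apply.
move=> t /pe h; rewrite hornerD hornerN hornerC hornerM -expr2 subr_ge0.
by rewrite -[_ ^+ 2]real_normK ?num_real// ler_sqr ?nnegrE.
Qed.

End polynomials.

(** * Bernstein polynomials *)

Section bernstein.
Context {R : realType}.
Implicit Types (G g : nat -> R) (x : R) (p : {poly R}).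

(* The expectation of G for the binomial law of parameters n and x. *)
Definition binE n x G : R :=
  \sum_(k < n.+1) ('C(n, k)%:R * x ^+ k * (1 - x) ^+ (n - k)) * G k.

Lemma binE1 n x : binE n x (fun=> 1) = 1.
Proof.
have := exprDn (1 - x) x n; rewrite subrK expr1n => E; rewrite [RHS]E.
by apply: eq_bigr => k _; rewrite mulr1 -[RHS]mulr_natl; ring.
Qed.

Lemma binED n x G G' : binE n x (fun k => G k + G' k) = binE n x G + binE n x G'.
Proof. by rewrite -big_split/=; apply: eq_bigr => k _; rewrite mulrDr. Qed.

Lemma binEZ n x c G : binE n x (fun k => c * G k) = c * binE n x G.
Proof. by rewrite mulr_sumr; apply: eq_bigr => k _; rewrite mulrCA. Qed.

(** The absorption identity (k+1) C(n+1, k+1) = (n+1) C(n, k), which lowers the order of the moments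
    by one. *)
Lemma binE_shift n x G : binE n.+1 x (fun k => k%:R * G k) =
  n.+1%:R * x * binE n x (fun k => G k.+1).
Proof.
rewrite /binE big_ord_recl /= mul0r mulr0 add0r mulr_sumr.
apply: eq_bigr => k _; rewrite /bump /= add1n subSS exprS.
have -> : 'C(n.+1, k.+1)%:R * (x * x ^+ k) * (1 - x) ^+ (n - k) *
    (k.+1%:R * G k.+1) = (k.+1%:R * 'C(n.+1, k.+1)%:R) *
    (x * x ^+ k * (1 - x) ^+ (n - k) * G k.+1) by ring.
by rewrite -natrM -mul_bin_diag natrM; ring.
Qed.

Lemma binE_mean n x : binE n x (fun k => k%:R) = n%:R * x.
Proof.
case: n => [|n]; first by rewrite /binE big_ord1 mulr0 mul0r.
transitivity (binE n.+1 x (fun k => k%:R * 1)).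
  by apply: eq_bigr => k _; rewrite mulr1.
by rewrite binE_shift binE1 mulr1.
Qed.

Lemma binE_variance n x :
  binE n x (fun k => (k%:R - n%:R * x) ^+ 2) = n%:R * (x - x ^+ 2).
Proof.
have -> : binE n x (fun k => (k%:R - n%:R * x) ^+ 2) =
    binE n x (fun k => k%:R * k%:R) + (- 2 * n%:R * x) * binE n x (fun k => k%:R)
    + (n%:R * x) ^+ 2 * binE n x (fun=> 1).
  rewrite -!binEZ -!binED; apply: eq_bigr => k _; congr (_ * _); ring.
rewrite binE1 binE_mean; case: n => [|n].
  by rewrite /binE big_ord1 /=; ring.
rewrite binE_shift (_ : binE n x _ = n%:R * x + 1); last first.
  rewrite -binE_mean -[X in _ + X](binE1 n x) -binED; apply: eq_bigr => k _.
  by rewrite -natr1.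
by rewrite -natr1; ring.
Qed.

Lemma binE_le n x G G' : 0 <= x <= 1 -> (forall k, (k <= n)%N -> G k <= G' k) ->
  binE n x G <= binE n x G'.
Proof.
move=> /andP[x0 x1] h; apply: ler_sum => k _; apply: ler_wpM2l; last first.
  by apply: h; rewrite -ltnS.
by rewrite !mulr_ge0// exprn_ge0// subr_ge0.
Qed.

Definition papprox (m M : R) (f : R -> R) := forall e : R, 0 < e ->
  exists p : {poly R}, forall t, m <= t <= M -> `|p.[t] - f t| <= e.

(* A form of uniform continuity from which the variance of the binomial law
   bounds the error of the Bernstein polynomials directly. *)
Definition qmodulus (m M : R) (f : R -> R) := forall e : R, 0 < e ->
  exists K : R, forall s t, m <= s <= M -> m <= t <= M ->
    `|f s - f t| <= e + K * (s - t) ^+ 2.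

Definition bernstein n (f : R -> R) : {poly R} :=
  \sum_(k < n.+1) (f (k%:R / n%:R) * 'C(n, k)%:R) *: ('X ^+ k * (1 - 'X) ^+ (n - k)).

Lemma horner_bernstein n f x :
  (bernstein n f).[x] = binE n x (fun k => f (k%:R / n%:R)).
Proof.
rewrite /bernstein horner_sum; apply: eq_bigr => k _.
by rewrite hornerZ hornerM !horner_exp hornerD hornerN hornerX hornerC; ring.
Qed.

Lemma papprox01 f : qmodulus 0 1 f -> papprox 0 1 f.
Proof.
move=> qf e e0; have e2 : 0 < e / 2 by rewrite divr_gt0.
have [K Kf] := qf _ e2.
(* By the variance formula the expected error is at most e / 2 + (|K| / n) (x - x^2), so it suffices
   that |K| / n <= e / 2. *)
pose n := (Num.truncn (`|K| / (e / 2))).+1.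
have n0 : 0 < n%:R :> R by rewrite ltr0n.
have nK : `|K| / n%:R <= e / 2.
  rewrite ler_pdivrMr// mulrC -ler_pdivrMr//.
  by apply/ltW; rewrite -truncn_lt_nat// divr_ge0// ltW.
exists (bernstein n f) => x x01; rewrite horner_bernstein.
have -> : f x = binE n x (fun=> f x).
  by rewrite -[LHS]mulr1 -(binE1 n x) -binEZ; apply: eq_bigr => k _; rewrite mulr1.
have bnd : binE n x (fun k => e / 2 + (`|K| / n%:R ^+ 2) * (k%:R - n%:R * x) ^+ 2) <= e.
  rewrite binED.
  rewrite (_ : binE n x (fun=> e / 2) = e / 2); last first.
    rewrite -[RHS]mulr1 -(binE1 n x) -binEZ; apply: eq_bigr => k _.
    by rewrite mulr1.
  rewrite binEZ binE_variance [leRHS]splitr lerD2l; apply: le_trans nK.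
  have -> : `|K| / n%:R ^+ 2 * (n%:R * (x - x ^+ 2)) = `|K| / n%:R * (x - x ^+ 2).
    by field; rewrite gt_eqF.
  rewrite ler_piMr ?divr_ge0 ?(ltW n0)//; case/andP: x01 => x0 x1; nra.
have key k : (k <= n)%N -> `|f (k%:R / n%:R) - f x| <=
    e / 2 + (`|K| / n%:R ^+ 2) * (k%:R - n%:R * x) ^+ 2.
  move=> kn; have := Kf (k%:R / n%:R) x _ x01.
  rewrite divr_ge0//= ler_pdivrMr// mul1r ler_nat kn => /(_ isT) /le_trans; apply.
  rewrite lerD2l (_ : k%:R / n%:R - x = (k%:R - n%:R * x) / n%:R); last first.
    by field; rewrite gt_eqF.
  rewrite expr_div_n mulrA mulrAC ler_wpM2r ?sqr_ge0//.
  by rewrite ler_wpM2r ?invr_ge0 ?sqr_ge0// ler_norm.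
have D : binE n x (fun k => f (k%:R / n%:R)) - binE n x (fun=> f x) =
    binE n x (fun k => f (k%:R / n%:R) - f x).
  by rewrite -sumrB; apply: eq_bigr => k _; rewrite mulrBr.
rewrite D ler_norml; apply/andP; split.
  apply: (le_trans (y := - binE n x (fun k => e / 2 + (`|K| / n%:R ^+ 2) * (k%:R - n%:R * x) ^+ 2))).
    by rewrite lerN2.
  rewrite -mulN1r -binEZ; apply: binE_le => // k /key.
  by rewrite ler_norml => /andP[h _]; rewrite mulN1r.
apply: le_trans bnd; apply: binE_le => // k /key.
by rewrite ler_norml => /andP[_].
Qed.

Lemma weierstrass m M f : qmodulus m M f -> papprox m M f.
Proof.
move=> qf e e0; have [mM|Mm] := ltrP m M; last first.
  exists (f m)%:P => t /andP[mt tM]; have -> : t = m by apply: le_anti; rewrite mt (le_trans tM).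
  by rewrite hornerC subrr normr0 ltW.
have d0 : 0 < M - m by rewrite subr_gt0.
pose g u := f (m + (M - m) * u).
have itv u : 0 <= u <= 1 -> m <= m + (M - m) * u <= M.
  move=> /andP[u0 u1]; nra.
have qg : qmodulus 0 1 g.
  move=> d d1; have [K Kf] := qf _ d1; exists (K * (M - m) ^+ 2) => s t s01 t01.
  have := Kf _ _ (itv s s01) (itv t t01); congr (_ <= _ + _); ring.
have [p pg] := papprox01 qg e0.
exists (p \Po ((M - m)^-1 *: ('X - m%:P))) => t /andP[mt tM].
rewrite horner_comp hornerZ hornerD hornerX hornerN hornerC.
have u01 : 0 <= (M - m)^-1 * (t - m) <= 1.
  by rewrite mulr_ge0 ?invr_ge0 ?subr_ge0 ?(ltW mM)//= mulrC ler_pdivrMr// mul1r lerB.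
have := pg _ u01; rewrite /g mulrA mulfV ?gt_eqF// mul1r.
by rewrite (_ : m + (t - m) = t)// addrC subrK.
Qed.

End bernstein.

(** * Functional calculus *)

Section functional_calculus.
Context {R : realType} {H : hilbertType R}.
Implicit Types (A B C : H -> H) (f g : R -> R) (m M e : R) (p q : {poly R}).

Lemma ler_eps_mul (a K : R) : (forall e, 0 < e -> a <= e * K) -> a <= 0.
Proof.
move=> h; rewrite leNgt; apply/negP => a0.
have K0 : 0 < `|K| + 1 by rewrite ltr_wpDl.
have := h (a / (2 * (`|K| + 1))); rewrite divr_gt0 ?mulr_gt0// => /(_ isT).
rewrite mulrAC ler_pdivlMr ?mulr_gt0//.
have := ler_norm K; nra.
Qed.

(** Two polynomials close to f on the spectrum are close to each other there, and [poly_op_norm]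
    carries this over to the operators. Hence the choice made in [fun_calc] is unambiguous. *)
Lemma is_fun_calc_inj f A B C : blin A -> symm A ->
  is_fun_calc f A B -> is_fun_calc f A C -> B = C.
Proof.
move=> bA sA [_ fB] [_ fC]; apply/funext => x; apply/eqP; rewrite -subr_eq0.
apply/eqP/nm_eq0/le_anti; rewrite nm_ge0 andbT.
apply: (@ler_eps_mul _ (4 * nm x)) => e e0.
have [p [pf pB]] := fB e e0; have [q [qf qC]] := fC e e0.
have {}pB : nm (B x - poly_op p A x) <= e * nm x.
  by have := pB x; rewrite !real_normE -rmorphM lecR nmBC.
have {}qC : nm (poly_op q A x - C x) <= e * nm x.
  by have := qC x; rewrite !real_normE -rmorphM lecR.
have pq : nm (poly_op (p - q) A x) <= (2 * e) * nm x.
  apply: poly_op_norm => //; first by rewrite mulr_ge0// ltW.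
  move=> t St; rewrite hornerD hornerN.
  have := pf t St; have := qf t St; rewrite !ler_norml; lra.
rewrite poly_opB opDE opNE in pq.
have h1 := nmB3 (poly_op p A x) (B x) (C x).
have h2 := nmB3 (poly_op q A x) (poly_op p A x) (C x).
lra.
Qed.

(* B = f(A). Unlike in is_fun_calc, f is approximated on a whole interval [m, M],
   which contains the spectrum of A as soon as m <= A <= M. *)
Definition FC m M f A B := blin B /\ forall e, 0 < e ->
  exists p, (forall t, m <= t <= M -> `|p.[t] - f t| <= e) /\
            (forall x, nm (poly_op p A x - B x) <= e * nm x).

Lemma FC_fun_calc m M f A B : between m M A -> FC m M f A B -> fun_calc f A = B.
Proof.
move=> AmM [bB fB].
have fcB : is_fun_calc f A B.
  split; first exact/bounded_opP.
  move=> e e0; have [p [pf pB]] := fB e e0; exists p; split.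
    by move=> t St; apply: pf; exact: (spectrum_itv AmM).
  by move=> x; rewrite !real_normE -rmorphM lecR.
case: AmM => bA sA _; apply: (is_fun_calc_inj bA sA _ fcB).
by rewrite /fun_calc; apply: (@xgetPex _ _ [set B | is_fun_calc f A B]); exists B.
Qed.

Lemma FC_inj m M f A B C : between m M A -> FC m M f A B -> FC m M f A C -> B = C.
Proof. by move=> AmM /(FC_fun_calc AmM) <- /(FC_fun_calc AmM). Qed.

(** Errors may be collected up to a constant factor, and terms in e^2 are absorbed because e <=
    1. *)
Lemma FC_weak (K : R) m M f A B : blin B ->
  (forall e, 0 < e -> e <= 1 ->
    exists p, (forall t, m <= t <= M -> `|p.[t] - f t| <= K * e) /\
            (forall x, nm (poly_op p A x - B x) <= K * e * nm x)) -> FC m M f A B.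
Proof.
move=> bB h; split=> // e e0; have K0 : 0 < `|K| + 1 by rewrite ltr_wpDl.
pose d := Num.min 1 (e / (`|K| + 1)).
have d0 : 0 < d by rewrite lt_min ltr01 divr_gt0.
have d1 : d <= 1 by rewrite ge_min lexx.
have Kd : K * d <= e.
  have : d <= e / (`|K| + 1) by rewrite ge_min lexx orbT.
  rewrite ler_pdivlMr//; have := ler_norm K; nra.
have [p [pf pB]] := h d d0 d1; exists p; split.
  by move=> t /pf /le_trans; apply.
by move=> x; apply: (le_trans (pB x)); rewrite ler_wpM2r// nm_ge0.
Qed.

Lemma FC_ext m M f g A B : (forall t, m <= t <= M -> f t = g t) ->
  FC m M f A B -> FC m M g A B.
Proof.
move=> fg [bB h]; split=> // e /h [p [pf pB]]; exists p; split=> // t tmM.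
by rewrite -fg//; exact: pf.
Qed.

Lemma FC_sub m M m' M' f A B : m <= m' -> M' <= M ->
  FC m M f A B -> FC m' M' f A B.
Proof.
move=> mm MM [bB h]; split=> // e /h [p [pf pB]]; exists p; split=> // t.
by move=> /andP[a b]; apply: pf; rewrite (le_trans mm)//= (le_trans b).
Qed.

Lemma FC_poly m M p A : blin A -> FC m M (fun t => p.[t]) A (poly_op p A).
Proof.
move=> bA; split; first exact: blin_poly_op.
move=> e e0; exists p; split=> [t _|x]; first by rewrite subrr normr0 ltW.
by rewrite subrr nm0 mulr_ge0 ?nm_ge0// ltW.
Qed.

Lemma FC_cst m M c A : blin A -> FC m M (fun=> c) A (c%:C *: id_op).
Proof.
move=> bA; rewrite -(poly_opC c A); apply: FC_ext (FC_poly m M c%:P bA) => t _.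
by rewrite hornerC.
Qed.

Lemma FC_id m M A : blin A -> FC m M id A A.
Proof.
move=> bA; rewrite -{2}(poly_opX A); apply: FC_ext (FC_poly m M 'X bA) => t _.
by rewrite hornerX.
Qed.

Lemma FC_add m M f g A B C : FC m M f A B -> FC m M g A C ->
  FC m M (fun t => f t + g t) A (B + C).
Proof.
move=> [bB hB] [bC hC]; apply: (@FC_weak 2); first exact: blin_add.
move=> e e0 _; have [p [pf pB]] := hB e e0; have [q [qf qC]] := hC e e0.
exists (p + q); split=> [t tmM|x].
  rewrite hornerD opprD addrACA (le_trans (ler_normD _ _))//.
  by rewrite mulr_natl mulr2n lerD ?pf ?qf.
rewrite poly_opD !opE opprD addrACA (le_trans (nmD _ _))//.
by rewrite mulr_natl mulr2n mulrDl lerD.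
Qed.

Lemma poly_bounded m M p : exists2 K : R, 0 < K &
  forall t, m <= t <= M -> `|p.[t]| <= K.
Proof.
elim/poly_ind: p => [|p c [K K0 pK]].
  by exists 1 => // t _; rewrite horner0 normr0.
pose N := `|m| + `|M| + 1.
have N0 : 0 < N by rewrite /N ltr_wpDl ?addr_ge0.
exists (K * N + `|c|); first by rewrite ltr_wpDr// mulr_gt0.
move=> t tmM; rewrite hornerD hornerMX hornerC (le_trans (ler_normD _ _))//.
rewrite lerD2r normrM ler_pM ?pK// /N.
case/andP: tmM => mt tM; rewrite ler_norml.
have := ler_norm m; have := ler_norm M; have := ler_norm (- m).
have := normr_ge0 m; have := normr_ge0 M.
rewrite normrN; lra.
Qed.

Lemma FC_bounded m M f A B : FC m M f A B -> exists2 K : R, 0 < K &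
  forall t, m <= t <= M -> `|f t| <= K.
Proof.
move=> [_ /(_ 1 ltr01) [p [pf _]]]; have [K K0 pK] := poly_bounded m M p.
exists (K + 1) => [|t tmM]; first by rewrite addr_gt0.
have := pK t tmM; have := pf t tmM; rewrite !ler_norml; lra.
Qed.

Lemma FC_mul m M f g A B C : blin A -> FC m M f A B -> FC m M g A C ->
  FC m M (fun t => f t * g t) A (B \o C).
Proof.
move=> bA fB gC; have [F F0 fF] := FC_bounded fB; have [G G0 gG] := FC_bounded gC.
case: fB => bB hB; case: gC => bC hC.
have [b b0 Bb] := blin_bound bB; have [c c0 Cc] := blin_bound bC.
(* F and G bound the cross terms of the scalar estimate, b and c those of the operator estimate; the
   1 absorbs the product of the two errors. *)
apply: (@FC_weak (F + G + b + c + 1)); first exact: blin_comp.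
move=> e e0 e1; have [p [pf pB]] := hB e e0; have [q [qf qC]] := hC e e0.
exists (p * q); split=> [t tmM|x].
  rewrite hornerM.
  have -> : p.[t] * q.[t] - f t * g t = (p.[t] - f t) * (q.[t] - g t)
    + f t * (q.[t] - g t) + (p.[t] - f t) * g t by ring.
  have hp := pf t tmM; have hq := qf t tmM; have hF := fF t tmM.
  have hG := gG t tmM.
  apply: (le_trans (ler_normD _ _)).
  apply: (@le_trans _ _ (e * e + F * e + e * G)).
    apply: lerD; last by rewrite normrM ler_pM.
    apply: (le_trans (ler_normD _ _)).
    by apply: lerD; rewrite normrM ler_pM.
  nra.
have bP := blin_poly_op p bA.
rewrite poly_opM//=.
set u := poly_op q A x; set v := C x.
have huv : nm (u - v) <= e * nm x := qC x.
have E : poly_op p A u - B v = (poly_op p A (u - v) - B (u - v)) +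
   (B (u - v) + (poly_op p A v - B v)).
  rewrite (blinB bP) (blinB bB).
  move: (poly_op p A u) (poly_op p A v) (B u) (B v) => a1 a2 b1 b2.
  by rewrite addrA subrK addrA subrK.
rewrite E; apply: (le_trans (nmD _ _)).
have h1 := pB (u - v); have h2 := pB v; have h3 := Bb (u - v); have h4 := Cc x.
have h5 := nmD (B (u - v)) (poly_op p A v - B v).
have nx := nm_ge0 x.
have ex : e * nm (u - v) <= e * nm x.
  apply: ler_wpM2l; first exact: ltW.
  by apply: (le_trans huv); rewrite ler_piMl.
have h6 : b * nm (u - v) <= b * (e * nm x) by rewrite ler_wpM2l// ltW.
have h7 : e * nm v <= e * (c * nm x) by rewrite ler_wpM2l// ltW.
have h8 : 0 <= (F + G) * (e * nm x) by rewrite !mulr_ge0 ?addr_ge0// ltW.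
nra.
Qed.

Lemma FC_scale m M c f A B : blin A -> FC m M f A B ->
  FC m M (fun t => c * f t) A (c%:C *: B).
Proof.
move=> bA fB; have := FC_mul bA (FC_cst m M c bA) fB.
by congr FC; exact/funext.
Qed.

Lemma FC_lim m M f A B : blin B ->
  (forall e, 0 < e -> exists g C, [/\ FC m M g A C,
     forall t, m <= t <= M -> `|g t - f t| <= e &
     forall x, nm (C x - B x) <= e * nm x]) -> FC m M f A B.
Proof.
move=> bB h; apply: (@FC_weak 2) => // e e0 _.
have [g [C [[_ hC] gf CB]]] := h e e0; have [p [pg pC]] := hC e e0.
exists p; split=> [t tmM|x].
  by have := pg t tmM; have := gf t tmM; rewrite !ler_norml; lra.
have := pC x; have := CB x; have := nmB3 (C x) (poly_op p A x) (B x); lra.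
Qed.

Lemma FC_horner m M f A B p : blin A -> FC m M f A B ->
  FC m M (fun t => p.[f t]) A (poly_op p B).
Proof.
move=> bA fB; elim/poly_ind: p => [|p c IH].
  by have := FC_cst m M 0 bA; congr FC; [apply/funext => t; rewrite horner0|
    rewrite -polyC0 poly_opC].
have := FC_add (FC_mul bA IH fB) (FC_cst m M c bA).
congr FC; first by apply/funext => t; rewrite hornerD hornerMX hornerC.
by rewrite poly_opD poly_opC; congr (_ + _); apply/funext => x; rewrite poly_opMX.
Qed.

Lemma FC_comp m M m' M' f g A B C : blin A ->
  (forall t, m <= t <= M -> m' <= f t <= M') ->
  FC m M f A B -> FC m' M' g B C -> FC m M (fun t => g (f t)) A C.
Proof.
move=> bA ff fB [bC gC]; apply: FC_lim => // e /gC [p [pg pC]].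
exists (fun t => p.[f t]), (poly_op p B); split=> //; first exact: FC_horner.
by move=> t /ff; exact: pg.
Qed.

Lemma blin_FC m M f A B : FC m M f A B -> blin B.
Proof. by case. Qed.

Lemma FC_symm m M f A B : symm A -> FC m M f A B -> symm B.
Proof.
move=> sA [bB fB] x y; apply/eqP; rewrite -subr_eq0 -normr_le0.
apply: (@ler_eps_mul _ (2 * (nm x * nm y))) => e e0.
have [p [_ pB]] := fB e e0; have sp := symm_poly_op p sA.
have -> : ip (B x) y - ip x (B y) =
   ip x (poly_op p A y - B y) - ip (poly_op p A x - B x) y.
  by rewrite !ipE sp; ring.
have ipa (u v : H) : `|ip u v| <= nm u * nm v.
  by rewrite ler_norml lerNl -ipNl -{1}(nmN u) !ip_le.
have h1 := ipa x (poly_op p A y - B y).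
have h2 := ipa (poly_op p A x - B x) y.
have h3 := ler_wpM2l (nm_ge0 x) (pB y); have h4 := ler_wpM2r (nm_ge0 y) (pB x).
apply: (le_trans (ler_normB _ _)).
nra.
Qed.

Lemma FC_ge0 m M f A B : between m M A -> FC m M f A B ->
  (forall t, m <= t <= M -> 0 <= f t) -> forall x, 0 <= qf B x.
Proof.
move=> AmM [bB fB] f0 x; rewrite -oppr_le0.
apply: (@ler_eps_mul _ (2 * nm x ^+ 2)) => e e0.
have [p [pf pB]] := fB e e0; have [bA sA _] := AmM.
have : 0 <= qf (poly_op (p + e%:P) A) x.
  apply: poly_op_ge0 => // t /(spectrum_itv AmM) tmM.
  have := pf t tmM; have := f0 t tmM; rewrite hornerD hornerC ler_norml; lra.
rewrite poly_opD poly_opC qfD qfZ qf_id.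
have := ip_le (poly_op p A x - B x) x; have := ler_wpM2r (nm_ge0 x) (pB x).
rewrite ipDl ipNl -/(qf _ x) -/(qf B x); nra.
Qed.

Lemma FC_le m M f g A B C : between m M A -> FC m M f A B -> FC m M g A C ->
  (forall t, m <= t <= M -> f t <= g t) -> forall x, qf B x <= qf C x.
Proof.
move=> AmM fB gC fg x; have [bA _ _] := AmM.
have := FC_add gC (FC_scale (-1) bA fB).
rewrite rmorphN1 scaleN1r => /(FC_ge0 AmM) h.
rewrite -subr_ge0 -qfB; apply: h => t /fg.
by rewrite mulN1r subr_ge0.
Qed.

Lemma FC_between m M m' M' f A B : between m M A -> FC m M f A B ->
  (forall t, m <= t <= M -> m' <= f t <= M') -> between m' M' B.
Proof.
move=> AmM fB ff; have [bA sA _] := AmM; split; [exact: blin_FC fB|exact: FC_symm fB|].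
move=> x; split.
  have := FC_le AmM (FC_cst m M m' bA) fB (fun t tmM => proj1 (andP (ff t tmM))) x.
  by rewrite qfZ qf_id.
have := FC_le AmM fB (FC_cst m M M' bA) (fun t tmM => proj2 (andP (ff t tmM))) x.
by rewrite qfZ qf_id.
Qed.

Lemma FC_norm m M f A B e : between m M A -> FC m M f A B ->
  (forall t, m <= t <= M -> `|f t| <= e) -> 0 <= e ->
  forall x, nm (B x) <= e * nm x.
Proof.
move=> AmM [bB fB] fe e0 x; have [bA sA _] := AmM; rewrite -subr_le0.
apply: (@ler_eps_mul _ (2 * nm x)) => d d0.
have [p [pf pB]] := fB d d0.
have : nm (poly_op p A x) <= (e + d) * nm x.
  apply: poly_op_norm => //; first by rewrite addr_ge0// ltW.
  move=> t /(spectrum_itv AmM) tmM.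
  by have := pf t tmM; have := fe t tmM; rewrite !ler_norml; lra.
have := pB x; have := nmB3 (poly_op p A x) (B x) 0; rewrite !subr0 (nmBC (B x)).
lra.
Qed.

Lemma FC_dist m M f g A B C e : between m M A -> FC m M f A B -> FC m M g A C ->
  (forall t, m <= t <= M -> `|f t - g t| <= e) -> 0 <= e ->
  forall x, nm (B x - C x) <= e * nm x.
Proof.
move=> AmM fB gC fg e0; have [bA _ _] := AmM.
have := FC_add fB (FC_scale (-1) bA gC).
rewrite rmorphN1 scaleN1r => /(FC_norm AmM); apply => // t /fg.
by rewrite mulN1r.
Qed.

(** Polynomials within 1 / (n+1) of f give operators that form a Cauchy sequence in norm, by
    [FC_dist]. The limit is taken pointwise, and the norm estimate survives in it. *)
Lemma FC_exists m M f A : between m M A -> papprox m M f -> exists B, FC m M f A B.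
Proof.
move=> AmM fp; have [bA sA _] := AmM.
have pn (n : nat) : exists p : {poly R}, forall t, m <= t <= M -> `|p.[t] - f t| <= n.+1%:R^-1.
  by apply: fp; rewrite invr_gt0 ltr0n.
have [p pf] := choice pn.
have dist n k x : nm (poly_op (p n) A x - poly_op (p k) A x) <=
    (n.+1%:R^-1 + k.+1%:R^-1) * nm x.
  apply: (FC_dist AmM (FC_poly m M (p n) bA) (FC_poly m M (p k) bA)).
    move=> t tmM; have := pf n t tmM; have := pf k t tmM => /=; rewrite !ler_norml.
    by move: (n.+1%:R^-1) (k.+1%:R^-1) => a b; lra.
  by rewrite addr_ge0 ?invr_ge0.
have inv0 (e : R) : 0 < e -> \forall n \near \oo, n.+1%:R^-1 <= e.
  move=> e0; near=> n; rewrite invf_ple ?posrE ?ltr0n//.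
  by rewrite (le_trans (y := n%:R)) ?ler_nat//; near: n; exact: nbhs_infty_ger.
have lim x : exists l : H, (fun n => poly_op (p n) A x) @ \oo --> l.
  apply: cauchy_nm => e e0.
  have nx : 0 < nm x + 1 by rewrite ltr_wpDl ?nm_ge0.
  have d0 : 0 < e / (nm x + 1) / 2 by rewrite !divr_gt0.
  have [N _ hN] := inv0 _ d0.
  exists (poly_op (p N) A x); exists N => // n /= Nn.
  apply: (le_trans (dist _ _ _)).
  have hn := hN n Nn; have hNN := hN N (leqnn N); rewrite /= in hn hNN.
  apply: (@le_trans _ _ (e / (nm x + 1) * nm x)).
    by rewrite ler_wpM2r ?nm_ge0// [leRHS]splitr lerD.
  by rewrite mulrAC ler_pdivrMr// ler_pM2l// lerDl.
have [B hB] := choice lim.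
have distB n x : nm (poly_op (p n) A x - B x) <= n.+1%:R^-1 * nm x.
  apply/ler_addgt0Pr => e e0.
  have nx : 0 < nm x + 1 by rewrite ltr_wpDl ?nm_ge0.
  have d0 : 0 < e / (nm x + 1) / 2 by rewrite !divr_gt0.
  have e20 : 0 < e / 2 by rewrite divr_gt0.
  have h2 := inv0 _ d0; have /cvg_nmP/(_ _ e20) h1 := hB x.
  near \oo => k.
  apply: (le_trans (nmB3 (poly_op (p k) A x) _ _)).
  have a1 : nm (poly_op (p k) A x - B x) <= e / 2 by near: k; exact: h1.
  have a2 : k.+1%:R^-1 <= e / (nm x + 1) / 2 by near: k; exact: h2.
  have a3 := dist n k x.
  have a4 : k.+1%:R^-1 * nm x <= e / 2.
    apply: (le_trans (ler_wpM2r (nm_ge0 x) a2)).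
    rewrite mulrAC ler_pM2r ?invr_gt0// mulrAC ler_pdivrMr// ler_pM2l//.
    by rewrite lerDl.
  clear a2; move: (n.+1%:R^-1) (k.+1%:R^-1) a3 a4 => u v a3 a4; lra.
have bB : blin B.
  split=> [c x y|].
    have h : (fun n => poly_op (p n) A (c *: x + y)) @ \oo --> c *: B x + B y.
      rewrite (_ : (fun n => _) = 
          (fun n => c *: poly_op (p n) A x + poly_op (p n) A y)).
        apply: cvgD => //; exact: (blin_cvg (blin_scale c (@blin_id R H)) (hB x)).
      apply/funext => n; have bp := blin_poly_op (p n) bA.
      by rewrite (blinD bp) (blinZ bp).
    exact: (cvg_unique _ (hB _) h).
  have [K K0 pK] := blin_bound (blin_poly_op (p 0%N) bA).
  exists (K + 1) => x; have := distB 0%N x; rewrite invr1.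
  have := pK x; have := nmB3 (poly_op (p 0%N) A x) (B x) 0.
  rewrite !subr0 (nmBC (B x)); lra.
exists B; split=> // e e0; have h := inv0 _ e0; near \oo => n.
have ne : n.+1%:R^-1 <= e by near: n.
exists (p n); split=> [t /(pf n) /le_trans|x]; first exact.
by apply: (le_trans (distB _ _)); rewrite ler_wpM2r ?nm_ge0.
Unshelve. all: by end_near. Qed.

End functional_calculus.

(** * Operator monotone functions *)

Section approximable_functions.
Context {R : realType}.
Implicit Types (f : R -> R) (m M c e r : R).

Lemma lipschitz_papprox m M f (L : R) :
  (forall s t, m <= s <= M -> m <= t <= M -> s <= t -> `|f s - f t| <= L * (t - s)) ->
  papprox m M f.
Proof.
(* Expanding (2e - L d)^2 >= 0 gives L d <= e + (L^2 / 4e) d^2, which turns a Lipschitz bound into a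
   [qmodulus]. *)
move=> fL; apply: weierstrass => e e0; exists (L ^+ 2 / (4 * e)) => s t sm tm.
have key d : L * d <= e + L ^+ 2 / (4 * e) * d ^+ 2.
  rewrite -subr_ge0.
  have -> : e + L ^+ 2 / (4 * e) * d ^+ 2 - L * d = (2 * e - L * d) ^+ 2 / (4 * e).
    by field; rewrite gt_eqF.
  by rewrite divr_ge0 ?sqr_ge0// mulr_ge0// ltW.
have [st|/ltW ts] := lerP s t.
  by apply: (le_trans (fL _ _ sm tm st)); rewrite -[(s - t) ^+ 2]sqrrN opprB.
by rewrite distrC; exact: (le_trans (fL _ _ tm sm ts)).
Qed.

(** The quasi-concave functions of interpolation theory, with the quotients f(t) / t cleared of
    denominators. *)
Definition quasi f := forall a b, 0 < a -> a <= b -> f a <= f b /\ a * f b <= b * f a.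

(** From f(t) / t <= f(s) / s follows f(t) - f(s) <= (f(s) / s) (t - s), where f(s) <= f(M) and s >=
    c. *)
Lemma quasi_lipschitz f c M s t : quasi f -> 0 < c -> 0 <= f c ->
  c <= s <= M -> c <= t <= M -> s <= t -> `|f s - f t| <= f M / c * (t - s).
Proof.
move=> qf c0 fc /andP[cs sM] /andP[ct tM] st; have s0 := lt_le_trans c0 cs.
have [h1 h2] := qf s t s0 st; have [h3 _] := qf _ _ s0 sM.
have [h4 _] := qf _ _ c0 cs.
rewrite distrC ger0_norm ?subr_ge0//.
apply: (@le_trans _ _ (f s / s * (t - s))).
  by rewrite mulrAC ler_pdivlMr//; nra.
rewrite ler_wpM2r ?subr_ge0// ler_pM ?invr_ge0 ?(ltW s0) ?(le_trans fc)//.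
by rewrite lef_pV2.
Qed.

Lemma quasi_papprox f c M : quasi f -> 0 < c -> 0 <= f c -> papprox c M f.
Proof.
move=> qf c0 fc; apply: (@lipschitz_papprox _ _ _ (f M / c)) => s t.
exact: quasi_lipschitz.
Qed.

Lemma quasi_powR r : 0 <= r <= 1 -> quasi (fun t => t `^ r).
Proof.
move=> /andP[r0 r1] a b a0 ab; have b0 := lt_le_trans a0 ab; split.
  by apply: ge0_ler_powR => //; rewrite nnegrE ltW.
have E : b = (b / a) * a by rewrite divfK ?gt_eqF.
have ba : 1 <= b / a by rewrite ler_pdivlMr// mul1r.
rewrite [in b `^ r]E powRM ?(ltW a0) ?(le_trans ler01 ba)//.
rewrite mulrA ler_wpM2r ?powR_ge0//.
rewrite -[leRHS](divfK (lt0r_neq0 a0)) mulrC ler_pM2r//.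
by have := ler_powR ba r1; rewrite powRr1// (le_trans ler01).
Qed.

Lemma papprox_powR c M r : 0 < c -> -1 <= r <= 1 -> papprox c M (fun t => t `^ r).
Proof.
move=> c0 /andP[r1 r2]; have [r0|r0] := lerP 0 r.
  by apply: quasi_papprox; rewrite ?powR_ge0//; apply: quasi_powR; rewrite r0.
(* For r < 0 the power is the reciprocal of the Lipschitz function g(t) = t^(-r), which is at least
   g(c) > 0. *)
have q := @quasi_powR (- r) _; rewrite oppr_ge0 (ltW r0) lerNl r1 in q.
have {}q := q isT; pose g t := t `^ (- r).
have gc : 0 < g c by rewrite powR_gt0.
apply: (@lipschitz_papprox _ _ _ (g M / c / (g c * g c))) => s t sm tm st.
have /andP[cs sM] := sm; have /andP[ct tM] := tm.
have s0 := lt_le_trans c0 cs; have t0 := lt_le_trans c0 ct.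
have h := quasi_lipschitz q c0 (powR_ge0 _ _) sm tm st; rewrite -/(g s) -/(g t) -/(g M) in h.
have [gs _] := q _ _ c0 cs; have [gt _] := q _ _ c0 ct.
rewrite -/(g c) -/(g s) -/(g t) in gs gt.
have gs0 := lt_le_trans gc gs; have gt0 := lt_le_trans gc gt.
have E u : u `^ r = (g u)^-1 by rewrite /g powRN invrK.
rewrite !E.
have -> : (g s)^-1 - (g t)^-1 = (g t - g s) / (g s * g t).
  by field; rewrite !gt_eqF.
rewrite normrM distrC mulrAC normfV [`|g s * _|]gtr0_norm ?mulr_gt0//.
rewrite ler_pM ?invr_ge0 ?mulr_ge0 ?(ltW gs0) ?(ltW gt0)//.
by rewrite lef_pV2 ?posrE ?mulr_gt0// ler_pM// ltW.
Qed.

(** Subadditivity of t^r: add s t^r <= t s^r and (t - s) t^r <= t (t - s)^r, two instances of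
    [quasi], and divide by t. *)
Lemma powR_holder r s t : 0 <= r <= 1 -> 0 <= s -> s <= t ->
  t `^ r - s `^ r <= (t - s) `^ r.
Proof.
move=> r01 s0 st; rewrite lerBlDr.
have [->|s1] := eqVneq s 0.
  by rewrite subr0 lerDl powR_ge0.
have [->|d1] := eqVneq s t; first by rewrite lerDr powR_ge0.
have sp : 0 < s by rewrite lt_neqAle eq_sym s1.
have dp : 0 < t - s by rewrite subr_gt0 lt_neqAle d1.
have tp := lt_le_trans sp st.
have [_ h1] := quasi_powR r01 sp st.
have [_ h2] := quasi_powR r01 dp (ltac:(by rewrite gerBl) : t - s <= t).
by rewrite -(ler_pM2l tp); nra.
Qed.

Lemma papprox_powR0 M r : 0 <= r <= 1 -> papprox 0 M (fun t => t `^ r).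
Proof.
move=> r01; have [r0|r0] := eqVneq r 0.
  by move=> e e0; exists 1%:P => t _; rewrite r0 powRr0 hornerC subrr normr0 ltW.
have rp : 0 < r by case/andP: r01 => r1 _; rewrite lt_neqAle eq_sym r0.
(* For |s - t| <= d the Hölder bound is at most d^r = e; beyond d the quadratic term alone exceeds
   M^r. *)
apply: weierstrass => e e0; pose d := e `^ r^-1.
have d0 : 0 < d by rewrite powR_gt0.
exists (M `^ r / d ^+ 2).
have key s t : 0 <= s -> s <= t -> t <= M ->
    `|s `^ r - t `^ r| <= e + M `^ r / d ^+ 2 * (s - t) ^+ 2.
  move=> s0 st tM; rewrite distrC ger0_norm; last first.
    rewrite subr_ge0; apply: ge0_ler_powR; rewrite ?nnegrE ?(ltW rp)//.
    exact: le_trans st.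
  apply: (le_trans (powR_holder r01 s0 st)).
  have K0 : 0 <= M `^ r / d ^+ 2 by rewrite divr_ge0 ?powR_ge0 ?sqr_ge0.
  have [td|td] := lerP (t - s) d.
    apply: (@le_trans _ _ e); last by rewrite lerDl mulr_ge0 ?sqr_ge0.
    have -> : e = d `^ r by rewrite -powRrM mulVf// powRr1 ?ltW.
    by apply: ge0_ler_powR; rewrite ?nnegrE ?subr_ge0 ?(ltW rp) ?(ltW d0).
  apply: (@le_trans _ _ (M `^ r)).
    apply: ge0_ler_powR; rewrite ?nnegrE ?subr_ge0 ?(ltW rp)//.
      by apply: le_trans tM; apply: le_trans st.
    by apply: (le_trans _ tM); rewrite gerBl.
  apply: (@le_trans _ _ (M `^ r / d ^+ 2 * (s - t) ^+ 2)); last by rewrite lerDr ltW.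
  rewrite mulrAC -mulrA ler_peMr ?powR_ge0// ler_pdivlMr ?exprn_gt0// mul1r.
  by rewrite -[leRHS]sqrrN opprB ler_sqr ?nnegrE ?(ltW d0) ?(ltW td) ?subr_ge0.
move=> s t /andP[s0 sM] /andP[t0 tM]; have [st|/ltW ts] := lerP s t; first exact: key.
by rewrite distrC -[(s - t) ^+ 2]sqrrN opprB; exact: key.
Qed.

End approximable_functions.

Section operator_monotone_functions.
Context {R : realType}.
Implicit Types (H K : hilbertType R) (f : R -> R) (a b c m M e : R).

Lemma between_weaken {H} (A : H -> H) m M m' M' : m' <= m -> M <= M' ->
  between m M A -> between m' M' A.
Proof.
move=> mm MM [bA sA h]; split=> // x; have [h1 h2] := h x; split.
  by apply: le_trans h1; rewrite ler_wpM2r ?sqr_ge0.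
by apply: (le_trans h2); rewrite ler_wpM2r ?sqr_ge0.
Qed.

Lemma between_positive {H} (A : H -> H) m M : 0 <= m -> between m M A ->
  positive_op A.
Proof.
move=> m0 [bA sA h]; apply/positive_opP => //; split=> // x.
by apply: le_trans (h x).1; rewrite mulr_ge0 ?sqr_ge0.
Qed.

Lemma between_invertible {H} (A : H -> H) m M : 0 < m -> between m M A ->
  invertible_op A.
Proof.
move=> m0 [bA sA h]; apply: (strictly_positive_invertible (c := m)) => // x.
by have [] := h x.
Qed.

Lemma positive_between {H} (A : H -> H) : bounded_op A -> positive_op A ->
  exists2 M, 0 < M & between 0 M A.
Proof.
move=> /bounded_opP bA /(positive_opP bA)[sA pA].
have [M M0 [_ _ AM]] := symm_bound bA sA; exists M => //; split=> // x.
by rewrite mul0r; split=> //; have [] := AM x.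
Qed.

Lemma invertible_between {H} (A : H -> H) : bounded_op A -> positive_op A ->
  invertible_op A -> exists c M, [/\ 0 < c, c <= M & between c M A].
Proof.
move=> bA pA iA; have [M M0 AM] := positive_between bA pA.
move/bounded_opP : (bA) => lA.
have [c c0 cA] := invertible_below lA iA; have [sA qA] := (positive_opP lA).1 pA.
(* c^2 / M comes from c^2 |x|^2 <= |A x|^2 <= M <A x, x>; the minimum with M secures the order of
   the two bounds on the zero space as well. *)
exists (Num.min (c ^+ 2 / M) M), M; split.
- by rewrite lt_min M0 divr_gt0// exprn_gt0.
- by rewrite ge_min lexx orbT.
split=> // x; have [_ _ /(_ x)[_ h2]] := AM; split=> //.
apply: (@le_trans _ _ (c ^+ 2 / M * nm x ^+ 2)).
  by rewrite ler_wpM2r ?sqr_ge0// ge_min lexx.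
rewrite mulrAC ler_pdivrMr// -exprMn.
have AM2 z : qf A z <= M * nm z ^+ 2 by case: AM => _ _ /(_ z)[].
have := nm_pos_sq x lA sA qA AM2; rewrite [M * _]mulrC; apply: le_trans.
by rewrite ler_sqr ?nnegrE ?mulr_ge0 ?nm_ge0// ltW.
Qed.

Lemma le_opP {H} (A B : H -> H) : blin A -> blin B -> symm A -> symm B ->
  le_op A B <-> forall x, qf A x <= qf B x.
Proof.
move=> bA bB sA sB; rewrite /le_op; split.
  move=> /(positive_opP (blin_sub bB bA))[_ h] x.
  by have := h x; rewrite qfB subr_ge0.
move=> h; apply/(positive_opP (blin_sub bB bA)); split; first exact: symmB.
by move=> x; rewrite qfB subr_ge0.
Qed.

Lemma opmono_FC f {H} (A B FA FB : H -> H) c M : operator_monotone f -> 0 < c ->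
  between c M A -> between c M B -> FC c M f A FA -> FC c M f B FB ->
  (forall x, qf A x <= qf B x) -> forall x, qf FA x <= qf FB x.
Proof.
move=> fm c0 cA cB fA fB AB.
have [bA sA _] := cA; have [bB sB _] := cB.
have pA := between_positive (ltW c0) cA; have pB := between_positive (ltW c0) cB.
have iA := between_invertible c0 cA; have iB := between_invertible c0 cB.
have /bounded_opP lA := bA; have /bounded_opP lB := bB.
have := fm H A B lA lB pA pB iA iB ((le_opP bA bB sA sB).2 AB).
rewrite (FC_fun_calc cA fA) (FC_fun_calc cB fB) => h.
by apply/le_opP => //; [exact: blin_FC fA|exact: blin_FC fB|exact: FC_symm fA|exact: FC_symm fB].
Qed.

(** For a projection E, the operator equal to a on the range of E and to b on its kernel. *)
Definition proj_comb {H} (E : H -> H) a b : H -> H :=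
  a%:C *: E + b%:C *: (id_op - E).

Lemma blin_proj_comb {H} (E : H -> H) a b : blin E -> blin (proj_comb E a b).
Proof.
by move=> bE; apply: blin_add; apply: blin_scale => //; apply: blin_sub => //; exact: blin_id.
Qed.

Lemma symm_proj_comb {H} (E : H -> H) a b : symm E -> symm (proj_comb E a b).
Proof.
by move=> bE; apply: symmD; apply: symmZ => //; apply: symmB => //; exact: symm_id.
Qed.

Lemma qf_proj_comb {H} (E : H -> H) a b x :
  qf (proj_comb E a b) x = a * qf E x + b * (nm x ^+ 2 - qf E x).
Proof. by rewrite qfD !qfZ qfB qf_id. Qed.

Lemma proj_combM {H} (E : H -> H) a b a' b' : blin E -> (forall x, E (E x) = E x) ->
  proj_comb E a b \o proj_comb E a' b' = proj_comb E (a * a') (b * b').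
Proof.
move=> bE EE; apply/funext => x; rewrite /proj_comb /= !opE /id_op/=.
have h : E (a'%:C *: E x + b'%:C *: (x - E x)) = a'%:C *: E x.
  by rewrite (blinD bE) !(blinZ bE) (blinB bE) EE subrr scaler0 addr0.
by rewrite h addrAC subrr add0r !scalerA -!rmorphM.
Qed.

Lemma proj_comb1 {H} (E : H -> H) : proj_comb E 1 1 = id_op.
Proof. by rewrite /proj_comb !scale1r addrC subrK. Qed.

(** On a spectrum contained in {a, b} any f agrees with its linear interpolant. This makes f(T)
    available before f is known to be continuous. *)
Lemma proj_fun_calc {H} (E : H -> H) f a b : blin E -> symm E ->
  (forall x, E (E x) = E x) -> a != b ->
  fun_calc f (proj_comb E a b) = proj_comb E (f a) (f b).
Proof.
move=> bE sE EE ab; set T := proj_comb E a b.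
have bT : blin T := blin_proj_comb a b bE; have sT : symm T := symm_proj_comb a b sE.
have ab0 : b - a != 0 by rewrite subr_eq0 eq_sym.
have fcT : is_fun_calc f T (proj_comb E (f a) (f b)).
  split; first exact/bounded_opP/blin_proj_comb.
  move=> e e0; pose d := (f b - f a) / (b - a).
  exists (d *: 'X + (f a - d * a)%:P); split.
    have pa : (d *: 'X + (f a - d * a)%:P).[a] = f a.
      by rewrite hornerD hornerZ hornerX hornerC; ring.
    have pb : (d *: 'X + (f a - d * a)%:P).[b] = f b.
      by rewrite hornerD hornerZ hornerX hornerC /d; field.
    move=> t St.
    have [->|ta] := eqVneq t a; first by rewrite pa subrr normr0 ltW.
    have [->|tb] := eqVneq t b; first by rewrite pb subrr normr0 ltW.
    exfalso; apply: St.
    have -> : T - t%:C *: id_op = proj_comb E (a - t) (b - t).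
      rewrite /T /proj_comb !rmorphB; apply/funext => x; rewrite !opE /id_op/=.
      rewrite !scalerBl addrACA -opprD; congr (_ - _).
      by rewrite -scalerDr addrC subrK.
    exists (proj_comb E (a - t)^-1 (b - t)^-1); split.
    - exact/bounded_opP/blin_proj_comb.
    - by rewrite proj_combM// !mulfV ?proj_comb1// subr_eq0 eq_sym.
    - by rewrite proj_combM// !mulVf ?proj_comb1// subr_eq0 eq_sym.
  move=> x; rewrite poly_opD poly_opZ poly_opX poly_opC.
  rewrite (_ : _ - _ = 0) ?normr0 ?mulr_ge0// ?ler0c ?ltW//.
  apply/eqP; rewrite subr_eq0; apply/eqP.
  rewrite /T /proj_comb !opE /id_op/=.
  set k := f a - d * a; set u := E x; set v := x - u.
  have -> : k%:C *: x = k%:C *: (u + v) by rewrite /v addrC subrK.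
  move: u v => u v; rewrite !scalerDr !scalerA addrACA -!scalerDl -!rmorphM -!rmorphD.
  have -> : d * a + k = f a by rewrite /k; ring.
  by have -> : d * b + k = f b by rewrite /k /d; field.
by apply: (is_fun_calc_inj bT sT _ fcT); apply: (@xgetPex _ _ [set B | is_fun_calc f T B]); exists (proj_comb E (f a) (f b)).
Qed.

(** Positivity of the form at d u - v bounds the cross term: 2 <T u, v> <= d <T u, u> + d^-1 <T v,
    v>. *)
Lemma two_term {H} (T : H -> H) (d : R) u v : blin T -> symm T ->
  (forall x, 0 <= qf T x) -> 0 < d ->
  qf T (u + v) <= (1 + d) * qf T u + (1 + d^-1) * qf T v.
Proof.
move=> bT sT pT d0; have := pT (d%:C *: u - v).
rewrite /qf !(blinB bT) !(blinD bT) !(blinZ bT) !ipE (sT v u) (ipC v).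
rewrite -/(qf T u) -/(qf T v) => h.
have h2 : d * (2 * ip (T u) v) <= d * (d * qf T u + d^-1 * qf T v).
  by rewrite mulrDr mulVKf ?gt_eqF//; nra.
rewrite ler_pM2l// in h2; nra.
Qed.

Section isometry.
Context {H K : hilbertType R}.
Variables (V : H -> K) (W : K -> H).
Hypotheses (bV : blin V) (bW : blin W).
Hypothesis VW : forall x y, ip (V x) y = ip x (W y).
Hypothesis WV : forall x, W (V x) = x.

Lemma nm_isometry x : nm (V x) = nm x.
Proof.
by apply/eqP; rewrite -(@eqrXn2 _ 2) ?nm_ge0// !nm_sq VW WV.
Qed.

Lemma nm_coisometry y : nm (y - V (W y)) ^+ 2 = nm y ^+ 2 - nm (W y) ^+ 2.
Proof. by rewrite !nm_sq !ipE !VW WV (ipC _ (V _)) VW; ring. Qed.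

Lemma nm_coisometry_le y : nm (W y) ^+ 2 <= nm y ^+ 2.
Proof. by rewrite -subr_ge0 -nm_coisometry sqr_ge0. Qed.

(** Here W is the adjoint of the isometry V and C the compression of T by V. The vector y is split
    into V (W y) and its orthogonal remainder, and [two_term] is applied with weight d. *)
Lemma dilation_bound (T : K -> K) (C : H -> H) M d y : between 0 M T ->
  (forall x, qf C x = qf T (V x)) -> 0 < d ->
  qf T y <= (1 + d) * qf C (W y) + (1 + d^-1) * M * (nm y ^+ 2 - nm (W y) ^+ 2).
Proof.
move=> [bT sT hT] CT d0.
have pT x : 0 <= qf T x by have [] := hT x; rewrite mul0r.
rewrite -nm_coisometry CT -{1}(subrK (V (W y)) y) addrC.
apply: (le_trans (two_term _ _ bT sT pT d0)); rewrite lerD2l -mulrA ler_wpM2l//.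
  by rewrite addr_ge0// invr_ge0 ltW.
by have [] := hT (y - V (W y)).
Qed.

Lemma blin_isometry_conj (A : H -> H) : blin A -> blin (V \o A \o W).
Proof. by move=> bA; apply: blin_comp => //; exact: blin_comp. Qed.

Lemma range_proj_idem y : (V \o W) ((V \o W) y) = (V \o W) y.
Proof. by rewrite /= WV. Qed.

Lemma symm_range_proj : symm (V \o W).
Proof. by move=> x y; rewrite /= VW (ipC x) VW ipC. Qed.

End isometry.

End operator_monotone_functions.

Section operator_monotone_real.
Context {R : realType} (H : hilbertType R).
Implicit Types (f : R -> R) (a b c m M e : R).

Lemma proj_comb_between {K : hilbertType R} (E : K -> K) a b : blin E -> symm E ->
  (forall x, E (E x) = E x) -> between (Num.min a b) (Num.max a b) (proj_comb E a b).
Proof.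
move=> bE sE EE; split; [exact: blin_proj_comb|exact: symm_proj_comb|].
move=> x; have qE : qf E x = nm (E x) ^+ 2 by rewrite nm_sq sE EE ipC.
have : 0 <= nm (x - E x) ^+ 2 by rewrite sqr_ge0.
rewrite nm_sq !ipE (ipC x) -!nm_sq -qE -/(qf E x) => h1.
have h0 : 0 <= qf E x by rewrite qE sqr_ge0.
rewrite qf_proj_comb.
have [ab|ab] := lerP a b; split; nra.
Qed.

Lemma representing_quasi f : (exists x : H, x != 0) -> representing f -> quasi f.
Proof.
move=> [x0 x00] [f0 fm] a b a0 ab; have b0 := lt_le_trans a0 ab.
have n0 : 0 < nm x0 ^+ 2 by rewrite exprn_gt0// nm_gt0.
have key (K : hilbertType R) (E F : K -> K) (a1 a2 b1 b2 : R) :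
    blin E -> symm E -> (forall x, E (E x) = E x) ->
    blin F -> symm F -> (forall x, F (F x) = F x) ->
    0 < a1 -> 0 < a2 -> 0 < b1 -> 0 < b2 -> a1 != a2 -> b1 != b2 ->
    (forall x, qf (proj_comb E a1 a2) x <= qf (proj_comb F b1 b2) x) ->
    forall x, qf (proj_comb E (f a1) (f a2)) x <= qf (proj_comb F (f b1) (f b2)) x.
  move=> bE sE EE bF sF FF a10 a20 b10 b20 a12 b12 h.
  have tE := proj_comb_between a1 a2 bE sE EE.
  have tF := proj_comb_between b1 b2 bF sF FF.
  have mE : 0 < Num.min a1 a2 by rewrite lt_min a10.
  have mF : 0 < Num.min b1 b2 by rewrite lt_min b10.
  have lE := blin_proj_comb a1 a2 bE; have lF := blin_proj_comb b1 b2 bF.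
  have zE := symm_proj_comb a1 a2 sE; have zF := symm_proj_comb b1 b2 sF.
  have := fm _ _ _ ((bounded_opP _).2 lE) ((bounded_opP _).2 lF)
    (between_positive (ltW mE) tE) (between_positive (ltW mF) tF)
    (between_invertible mE tE) (between_invertible mF tF)
    ((le_opP lE lF zE zF).2 h).
  rewrite !proj_fun_calc//.
  exact: (le_opP (blin_proj_comb (f a1) (f a2) bE) (blin_proj_comb (f b1) (f b2) bF)
    (symm_proj_comb (f a1) (f a2) sE) (symm_proj_comb (f b1) (f b2) sF)).1.
have mono c d : 0 < c -> c <= d -> f c <= f d.
  move=> c0 cd; have d0 := lt_le_trans c0 cd.
  (* With E = F = 1 the second eigenvalue lives on the zero subspace; c + d + 1 only has to differ
     from c and from d. *)
  have h := @key H idfun idfun c (c + d + 1) d (c + d + 1) blin_id symm_id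
    (fun=> erefl) blin_id symm_id (fun=> erefl) c0 _ d0 _ _ _ _ x0.
  move: h; rewrite !qf_proj_comb qf_id subrr !mulr0 !addr0 ler_pM2r//; apply.
  - by rewrite !addr_gt0.
  - by rewrite !addr_gt0.
  - by rewrite lt_eqF// -addrA ltrDl addr_gt0.
  - by rewrite lt_eqF// addrAC ltrDr addr_gt0.
  - move=> x; rewrite !qf_proj_comb qf_id subrr !mulr0 !addr0.
    by rewrite ler_wpM2r ?sqr_ge0.
split; first exact: mono.
have [->//|abn] := eqVneq a b; have {}ab : a < b by rewrite lt_neqAle abn.
(* The strict inequality leaves room for a second eigenvalue eta > 0 and for the factor 1 + d of
   [dilation_bound]. *)
have slack mu : 0 < mu -> mu * b < a -> mu * f b <= f a.
  move=> mu0 mua.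
  have mu1 : mu < 1 by rewrite -(ltr_pM2r b0) mul1r (lt_trans mua).
  pose eta := (a - mu * b) / 2.
  have eta0 : 0 < eta by rewrite divr_gt0// subr_gt0.
  pose s := Num.sqrt mu; pose s' := Num.sqrt (1 - mu).
  have ss : s * s = mu by rewrite -expr2 sqr_sqrtr// ltW.
  have ss' : s' * s' = 1 - mu by rewrite -expr2 sqr_sqrtr// subr_ge0 ltW.
  (* V embeds H along the unit vector (s, s'), and diag(b, eta) is compressed to the scalar c0 = mu
     b + (1 - mu) eta < a. Applying f will give mu f(b) + (1 - mu) f(eta) <= f(a). *)
  pose V (x : H) : hsum H := (s%:C *: x, s'%:C *: x).
  pose W (y : hsum H) : H := s%:C *: y.1 + s'%:C *: y.2.
  pose E (y : hsum H) : hsum H := (y.1, 0).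
  have bV : blin V.
    split; first by move=> c x y; congr pair; rewrite /= scalerDr !scalerA (mulrC c).
    exists (`|s| + `|s'|) => x; apply: (le_trans (nm_hsum_le _)).
    by rewrite !nmZ mulrDl.
  have bW : blin W.
    split.
      move=> c x y; rewrite /W/= !scalerDr !scalerA addrACA !(mulrC c).
      by rewrite -!scalerA.
    exists (`|s| + `|s'|) => y; apply: (le_trans (nmD _ _)); rewrite !nmZ mulrDl.
    by apply: lerD; apply: ler_wpM2l => //; [exact: nm_hsum1|exact: nm_hsum2].
  have bE : blin E.
    split; first by move=> c x y; rewrite /E; congr pair; rewrite /= scaler0 addr0.
    exists 1 => y; rewrite mul1r; apply: (le_trans (nm_hsum_le _)).
    by rewrite /= nm0 addr0; exact: nm_hsum1.
  have VW x y : ip (V x) y = ip x (W y) by rewrite ip_hsum /= !ipE.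
  have WV x : W (V x) = x.
    rewrite /W /= !scalerA -!rmorphM -scalerDl -rmorphD ss ss'.
    by rewrite addrC subrK scale1r.
  have sE : symm E by move=> x y; rewrite !ip_hsum /= !ipE.
  have EE y : E (E y) = E y by [].
  pose T := proj_comb E b eta.
  have qT y : qf T y = b * nm y.1 ^+ 2 + eta * nm y.2 ^+ 2.
    rewrite qf_proj_comb nm_sq /qf !ip_hsum /= ip0l addr0 -!nm_sq.
    by rewrite addrAC subrr add0r.
  have eb : eta <= b by rewrite /eta; have := mulr_gt0 mu0 b0; lra.
  have bT : between 0 b T.
    split; [exact: blin_proj_comb|exact: symm_proj_comb|move=> y].
    rewrite qT mul0r (nm_sq y) ip_hsum -!nm_sq.
    have := sqr_ge0 (nm y.1); have := sqr_ge0 (nm y.2); split; nra.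
  pose c0 := mu * b + (1 - mu) * eta.
  have c00 : 0 < c0 by rewrite addr_gt0// mulr_gt0// subr_gt0.
  have c0a : c0 < a by rewrite /c0 /eta; have := mulr_gt0 mu0 eta0; rewrite /eta; nra.
  pose d := (a - c0) / c0.
  have d0 : 0 < d by rewrite divr_gt0// subr_gt0.
  have da : (1 + d) * c0 = a by rewrite /d; field; rewrite gt_eqF.
  pose N := (1 + d^-1) * b.
  have bN : b < N by rewrite /N mulrDl mul1r ltrDl mulr_gt0// invr_gt0.
  have N0 : 0 < N := lt_trans b0 bN.
  have CT x : qf (c0%:C *: id_op) x = qf T (V x).
    by rewrite qfZ qf_id qT /V/= !nmZ !exprMn !real_normK ?num_real// !expr2 ss ss' /c0; ring.
  have dom y : qf T y <= qf (proj_comb (V \o W) a N) y.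
    apply: (le_trans (dilation_bound VW WV y bT CT d0)).
    rewrite qfZ qf_id mulrA da qf_proj_comb /qf /= VW -nm_sq.
    by rewrite lexx.
  have bP := blin_comp bV bW; have sP := symm_range_proj VW.
  have PP := range_proj_idem WV.
  have := @key (hsum H) E (V \o W) b eta a N bE sE EE bP sP PP b0 eta0 a0 N0 _ _ dom (V x0).
  rewrite gt_eqF; last first.
    by rewrite /eta; have := mulr_gt0 mu0 b0; lra.
  rewrite lt_eqF; last exact: lt_trans bN.
  move=> /(_ isT isT).
  rewrite !qf_proj_comb /qf /= WV -!nm_sq subrr mulr0 addr0 (nm_isometry VW WV).
  have -> : ip (E (V x0)) (V x0) = mu * nm x0 ^+ 2.
    by rewrite ip_hsum /= ip0l addr0 !ipE mulrA ss nm_sq.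
  have fe := f0 _ eta0.
  have := mulr_gt0 n0 fe => h1 h2.
  rewrite -(ler_pM2r n0); nra.
have fb := f0 _ b0; have fa := f0 _ a0.
rewrite leNgt; apply/negP => lt.
(* If f(a) / f(b) < a / b, a value strictly between the two contradicts [slack]. *)
pose mu := (f a / f b + a / b) / 2.
have fab : f a / f b < a / b.
  by rewrite ltr_pdivrMr// mulrAC ltr_pdivlMr// mulrC.
have mu0 : 0 < mu by rewrite divr_gt0// addr_gt0// divr_gt0.
have mub : mu * b < a by rewrite -ltr_pdivlMr// /mu; lra.
have := slack mu mu0 mub; rewrite leNgt => /negP; apply.
by rewrite -ltr_pdivrMr// /mu; lra.
Qed.

End operator_monotone_real.

(** * Jensen's inequality for an isometry *)

Section jensen.
Context {R : realType} {H K : hilbertType R}.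
Variables (V : H -> K) (W : K -> H).
Hypotheses (bV : blin V) (bW : blin W).
Hypothesis VW : forall x y, ip (V x) y = ip x (W y).
Hypothesis WV : forall x, W (V x) = x.

(** Block diagonal along the range of V and its orthogonal complement: a copy of C on the first, the
    scalar N on the second. *)
Definition dilate (C : H -> H) (N : R) : K -> K :=
  (V \o C \o W) + N%:C *: (id_op - (V \o W)).

Lemma blin_dilate C N : blin C -> blin (dilate C N).
Proof.
move=> bC; apply: blin_add; first exact: blin_isometry_conj.
apply: blin_scale; apply: blin_sub; first exact: blin_id.
exact: blin_comp.
Qed.

Lemma symm_dilate C N : symm C -> symm (dilate C N).
Proof.
move=> sC; apply: symmD.
  by move=> x y; rewrite /= VW (ipC x) VW sC ipC.
by apply/symmZ/symmB; [exact: symm_id|exact: symm_range_proj].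
Qed.

Lemma qf_dilate C N y :
  qf (dilate C N) y = qf C (W y) + N * (nm y ^+ 2 - nm (W y) ^+ 2).
Proof. by rewrite qfD qfZ qfB qf_id /qf /= !VW -nm_sq. Qed.

Lemma between_dilate C c N : c <= N -> between c N C -> between c N (dilate C N).
Proof.
move=> cN [bC sC cC]; split; [exact: blin_dilate|exact: symm_dilate|move=> y].
have := nm_coisometry_le VW WV y; have [h1 h2] := cC (W y).
by rewrite qf_dilate; split; nra.
Qed.

Lemma poly_op_dilate C N (p : {poly R}) y : blin C ->
  poly_op p (dilate C N) y =
    V (poly_op p C (W y)) + p.[N]%:C *: (y - V (W y)).
Proof.
move=> bC; elim/poly_ind: p y => [|p c IH] y.
  rewrite -polyC0 !poly_opC hornerC !opE /id_op/= !scale0r (blin0 bV).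
  by rewrite addr0.
rewrite !poly_opD !poly_opC !opE !poly_opMX IH.
have -> : W (dilate C N y) = C (W y).
  rewrite /dilate !opE /= (blinD bW) (blinZ bW) (blinB bW) !WV subrr scaler0.
  by rewrite addr0.
have -> : dilate C N y - V (C (W y)) = N%:C *: (y - V (W y)).
  by rewrite /dilate !opE /= addrC addKr.
rewrite hornerD hornerMX hornerC (blinD bV) (blinZ bV) scalerA -rmorphM /id_op/=.
rewrite rmorphD scalerDl -!addrA; congr (_ + _).
rewrite [RHS]addrCA; congr (_ + _).
by rewrite -scalerDr addrC subrK.
Qed.

Lemma FC_dilate f C G c N : blin C -> c <= N -> FC c N f C G ->
  FC c N f (dilate C N) (dilate G (f N)).
Proof.
move=> bC cN [bG hG]; apply: (@FC_weak _ _ 2); first exact: blin_dilate.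
move=> e e0 _; have [p [pf pG]] := hG e e0; exists p; split.
  move=> t /pf /le_trans; apply; rewrite ler_peMl ?(ltW e0)//; lra.
move=> y; rewrite poly_op_dilate// /dilate !opE /= opprD addrACA -(blinB bV).
rewrite -scalerBl -rmorphB.
apply: (le_trans (nmD _ _)); rewrite (nm_isometry VW WV) nmZ -mulrA mulrDl mul1r.
have nW : nm (W y) <= nm y.
  by rewrite -ler_sqr ?nnegrE ?nm_ge0//; exact: nm_coisometry_le VW WV y.
have nP : nm (y - V (W y)) <= nm y.
  rewrite -ler_sqr ?nnegrE ?nm_ge0// (nm_coisometry VW WV) gerBl.
  exact: sqr_ge0.
have pN := pf N _; rewrite cN lexx in pN.
apply: lerD; last by rewrite ler_pM ?nm_ge0// pN.
by apply: (le_trans (pG _)); rewrite ler_wpM2l// ltW.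
Qed.

(* f is applied to T <= dilate ((1 + d) C) N with N of order M / d, and then d
   tends to 0. *)
Lemma jensen_isometry f (T FT : K -> K) (C FC' : H -> H) c M :
  operator_monotone f -> quasi f -> 0 < c -> 0 <= f c -> c <= M ->
  between c M T -> blin C -> symm C -> (forall x, qf C x = qf T (V x)) ->
  FC c M f T FT -> FC c M f C FC' ->
  forall x, qf FT (V x) <= qf FC' x.
Proof.
move=> fm fq c0 fc cM cT bC sC CT fT fC x.
have fpos t : c <= t -> 0 <= f t.
  by move=> ct; have [/(le_trans fc)] := fq _ _ c0 ct.
have cC : between c M C.
  split=> // z; rewrite CT -(nm_isometry VW WV); case: cT => _ _; exact.
rewrite -subr_le0; apply: (@ler_eps_mul _ _ (qf FC' x)) => d d0.
have dV : 0 < d^-1 by rewrite invr_gt0.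
have M0 : 0 < M := lt_le_trans c0 cM.
(* N must dominate both (1 + d^-1) M, the weight in [dilation_bound], and (1 + d) M, the upper bound
   of (1 + d) C. *)
pose N := (1 + d + d^-1) * M.
have MN : M <= N by rewrite /N ler_peMl ?(ltW M0)//; lra.
have cN := le_trans cM MN.
pose C' := (1 + d)%:C *: C.
have cC' : between c N C'.
  split; [exact: blin_scale|exact: symmZ|move=> z; rewrite qfZ].
  have := sqr_ge0 (nm z); have [h1 h2] := let: And3 _ _ h := cC in h z.
  move: (nm z ^+ 2) h1 h2 => n h1 h2 n0.
  have cn : 0 <= c * n by rewrite mulr_ge0// ltW.
  split; first by nra.
  rewrite /N; have : 0 <= d^-1 * (M * n) by rewrite !mulr_ge0// ltW.
  nra.
have bC' : blin C' by case: cC'.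
have cT' : between c N T := between_weaken (lexx _) MN cT.
have cN' : between c N C := between_weaken (lexx _) MN cC.
have ap : papprox c N f by exact: quasi_papprox.
have [G fG] := FC_exists cC' ap.
have [FT' fT'] := FC_exists cT' ap.
have -> : FT = FT' by apply: (FC_inj cT fT); exact: FC_sub fT'.
have dom y : qf T y <= qf (dilate C' N) y.
  have T0 : between 0 M T := between_weaken (ltW c0) (lexx _) cT.
  apply: (le_trans (dilation_bound VW WV y T0 CT d0)).
  rewrite qf_dilate qfZ lerD2l ler_wpM2r ?subr_ge0 ?(nm_coisometry_le VW WV)//.
  by rewrite /N ler_wpM2r ?(ltW M0)//; lra.
have := opmono_FC fm c0 cT' (between_dilate cN cC') fT' (FC_dilate bC' cN fG) dom (V x).
rewrite qf_dilate WV (nm_isometry VW WV) subrr mulr0 addr0 => /le_trans h.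
rewrite lerBlDl; apply: h; rewrite -[X in X + _]mul1r -mulrDl -qfZ.
have lin t : c <= t <= M -> c <= (1 + d) * t <= N.
  move=> /andP[ct tM]; have t0 := lt_le_trans c0 ct; rewrite /N.
  by apply/andP; split; nra.
have fG' : FC c M (fun t => f ((1 + d) * t)) C G.
  exact: (FC_comp bC lin (FC_scale (1 + d) bC (FC_id c M bC)) fG).
(* As f(t) / t is nonincreasing, f((1 + d) t) <= (1 + d) f(t). *)
apply: (FC_le cC fG' (FC_scale (1 + d) bC fC)) => t /andP[ct tM].
have t0 := lt_le_trans c0 ct.
have tt : t <= (1 + d) * t by nra.
have [_ h2] := fq _ _ t0 tt.
by rewrite -(ler_pM2l t0); apply: (le_trans h2); rewrite mulrA (mulrC t).
Qed.

End jensen.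

(** * Connections of strictly positive operators *)

Section strictly_positive_connections.
Context {R : realType} {H : hilbertType R}.
Implicit Types (A B Z P Q T F : H -> H) (f g h : R -> R) (c m M e s : R).

(** P and Q stand for A^(1/2) and A^(-1/2), described by the algebraic relations between them. *)
Definition sqrt_pair A P Q :=
  [/\ blin P /\ symm P, blin Q /\ symm Q, forall x, P (Q x) = x,
      forall x, Q (P x) = x & forall x, P (P x) = A x].

Lemma pow_opE A B r m M : between m M A -> FC m M (fun t => t `^ r) A B ->
  pow_op A r = B.
Proof. exact: FC_fun_calc. Qed.

Lemma FC_powRD A B C r r' c M : 0 < c -> between c M A ->
  FC c M (fun t => t `^ r) A B -> FC c M (fun t => t `^ r') A C ->
  FC c M (fun t => t `^ (r + r')) A (B \o C).
Proof.
move=> c0 cA fB fC; have [bA _ _] := cA.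
apply: FC_ext (FC_mul bA fB fC) => t /andP[ct _]; rewrite powRD//.
by apply/implyP => _; rewrite gt_eqF// (lt_le_trans c0).
Qed.

Lemma half_bounds : -1 <= (2^-1 : R) <= 1 /\ -1 <= (- 2^-1 : R) <= 1.
Proof. by split; lra. Qed.

Lemma sqrt_pairP A c M : 0 < c -> between c M A ->
  sqrt_pair A (pow_op A 2^-1) (pow_op A (- 2^-1)).
Proof.
move=> c0 cA; have [bA sA _] := cA; have [h1 h2] := half_bounds.
have [P fP] := FC_exists cA (papprox_powR M c0 h1).
have [Q fQ] := FC_exists cA (papprox_powR M c0 h2).
rewrite (pow_opE cA fP) (pow_opE cA fQ).
have one (B : H -> H) : FC c M (fun t => t `^ 0) A B -> B = id_op.
  move=> fB; apply: (FC_inj cA fB); rewrite -[id_op]scale1r.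
  by apply: FC_ext (FC_cst c M 1 bA) => t _; rewrite powRr0.
have PQ := FC_powRD c0 cA fP fQ; rewrite subrr in PQ.
have QP := FC_powRD c0 cA fQ fP; rewrite addNr in QP.
have PP := FC_powRD c0 cA fP fP.
rewrite (_ : 2^-1 + 2^-1 = 1 :> R) in PP; last lra.
have AE : P \o P = A.
  apply: (FC_inj cA PP); apply: FC_ext (FC_id c M bA) => t /andP[ct _].
  by rewrite powRr1// (le_trans (ltW c0)).
split; first by split; [exact: blin_FC fP|exact: FC_symm fP].
- by split; [exact: blin_FC fQ|exact: FC_symm fQ].
- by move=> x; have /(congr1 (@^~ x)) := one _ PQ.
- by move=> x; have /(congr1 (@^~ x)) := one _ QP.
- by move=> x; rewrite -[in RHS]AE.
Qed.

Lemma sqrt_pair_nm A P Q x : sqrt_pair A P Q -> nm (P x) ^+ 2 = qf A x.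
Proof. by move=> [[_ sP] _ _ _ PP]; rewrite nm_sq sP PP ipC. Qed.

Lemma sqrt_pair_qf A P Q x : sqrt_pair A P Q -> qf A (Q x) = nm x ^+ 2.
Proof. by move=> pq; rewrite -(sqrt_pair_nm _ pq); case: pq => _ _ ->. Qed.

Lemma symm_conj A P : symm A -> symm P -> symm (P \o A \o P).
Proof. by move=> sA sP x y /=; rewrite sP sA sP. Qed.

Lemma qf_conj A P x : symm P -> qf (P \o A \o P) x = qf A (P x).
Proof. by move=> sP; rewrite /qf /= sP. Qed.

(** Both <B Q x, Q x> and <A Q x, Q x> = |x|^2 lie between c |Q x|^2 and M |Q x|^2, so their ratio
    lies between c / M and M / c. *)
Lemma between_conj A B P Q c M : 0 < c -> c <= M -> sqrt_pair A P Q ->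
  between c M A -> between c M B -> between (c / M) (M / c) (Q \o B \o Q).
Proof.
move=> c0 cM pq [bA sA hA] [bB sB hB]; have [_ [bQ sQ] _ _ _] := pq.
have M0 := lt_le_trans c0 cM.
split; [by apply: blin_comp => //; apply: blin_comp|exact: symm_conj|move=> x].
rewrite qf_conj//; have [b1 b2] := hB (Q x); have [a1 a2] := hA (Q x).
rewrite (sqrt_pair_qf _ pq) in a1 a2.
split.
  apply: le_trans b1; rewrite -mulrA ler_pM2l// mulrC ler_pdivrMr//.
  by rewrite mulrC.
apply: (le_trans b2); rewrite -mulrA ler_pM2l// mulrC ler_pdivlMr//.
by rewrite mulrC.
Qed.

Lemma connection_invP f A B c M c' M' : 0 < c -> c <= M ->
  between c M A -> between c M B -> c' <= c / M -> M / c <= M' ->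
  papprox c' M' f ->
  exists P Q F, [/\ sqrt_pair A P Q, between c' M' (Q \o B \o Q),
    FC c' M' f (Q \o B \o Q) F, connection_inv f A B = P \o F \o P &
    P = pow_op A 2^-1 /\ Q = pow_op A (- 2^-1)].
Proof.
move=> c0 cM cA cB cc MM af; have pq := sqrt_pairP c0 cA.
have cT := between_weaken cc MM (between_conj c0 cM pq cA cB).
have [F fF] := FC_exists cT af.
exists (pow_op A 2^-1), (pow_op A (- 2^-1)), F; split=> //.
by rewrite /connection_inv (FC_fun_calc cT fF).
Qed.

Lemma connection_inv_between f A B c M : quasi f -> (forall t, 0 < t -> 0 < f t) ->
  0 < c -> c <= M -> between c M A -> between c M B ->
  exists l u, [/\ 0 < l, l <= u & between l u (connection_inv f A B)].
Proof.
move=> fq fp c0 cM cA cB; have M0 := lt_le_trans c0 cM.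
have c'0 : 0 < c / M by rewrite divr_gt0.
have cM' : c / M <= M / c.
  by rewrite ler_pdivrMr// mulrAC ler_pdivlMr// ler_pM// ltW.
have af : papprox (c / M) (M / c) f by apply: quasi_papprox => //; exact/ltW/fp.
have [P [Q [F [pq cT fF -> _]]]] := connection_invP c0 cM cA cB (lexx _) (lexx _) af.
have [bP sP] : blin P /\ symm P by case: pq.
have cF : between (f (c / M)) (f (M / c)) F.
  apply: (FC_between cT fF) => t /andP[t1 t2].
  have [-> _] := fq _ _ c'0 t1.
  by have [-> _] := fq _ _ (lt_le_trans c'0 t1) t2.
have f1 := fp _ c'0; have f2 := fp _ (lt_le_trans c'0 cM').
have [f12 _] := fq _ _ c'0 cM'.
have [bF sF hF] := cF; have [_ _ hA] := cA.
exists (f (c / M) * c), (f (M / c) * M); split; first by rewrite mulr_gt0.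
  by rewrite ler_pM// ltW.
split; [by apply: blin_comp => //; apply: blin_comp|exact: symm_conj|move=> x].
rewrite qf_conj//; have [h1 h2] := hF (P x); have [a1 a2] := hA x.
rewrite (sqrt_pair_nm _ pq) in h1 h2; rewrite -!mulrA; split.
  by apply: le_trans h1; rewrite ler_pM2l.
by apply: (le_trans h2); rewrite ler_pM2l.
Qed.

Definition diag_op A B (y : hsum H) : hsum H := (A y.1, B y.2).

Lemma blin_diag A B : blin A -> blin B -> blin (diag_op A B).
Proof.
move=> bA bB; split.
  by move=> a x y; congr pair; rewrite /= ?(blinD bA) ?(blinD bB) ?(blinZ bA) ?(blinZ bB).
have [M M0 AM] := blin_bound bA; have [N N0 BN] := blin_bound bB.
exists (M + N) => y; apply: (le_trans (nm_hsum_le _)); rewrite mulrDl /=.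
apply: lerD; [apply: (le_trans (AM _))|apply: (le_trans (BN _))].
  by apply: ler_wpM2l; [exact: ltW|exact: nm_hsum1].
by apply: ler_wpM2l; [exact: ltW|exact: nm_hsum2].
Qed.

Lemma qf_diag A B (y : hsum H) : qf (diag_op A B) y = qf A y.1 + qf B y.2.
Proof. by rewrite /qf ip_hsum. Qed.

Lemma between_diag A B m M : between m M A -> between m M B ->
  between m M (diag_op A B).
Proof.
move=> [bA sA hA] [bB sB hB]; split; first exact: blin_diag.
  by move=> x y; rewrite !ip_hsum /= sA sB.
move=> y; rewrite qf_diag (nm_sq y) ip_hsum -!nm_sq !mulrDr.
have [a1 a2] := hA y.1; have [b1 b2] := hB y.2.
by split; apply: lerD.
Qed.

Lemma poly_op_diag (p : {poly R}) A B (y : hsum H) :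
  poly_op p (diag_op A B) y = diag_op (poly_op p A) (poly_op p B) y.
Proof.
elim/poly_ind: p y => [|p c IH] y.
  by rewrite /diag_op -polyC0 !poly_opC.
by rewrite /diag_op !poly_opD !poly_opC !opE !poly_opMX IH.
Qed.

Lemma FC_diag f A B F G m M : between m M A -> between m M B ->
  FC m M f A F -> FC m M f B G -> FC m M f (diag_op A B) (diag_op F G).
Proof.
move=> mA mB [bF hF] fG; have [bB _ _] := mB.
apply: (@FC_weak _ _ 2); first exact: blin_diag (blin_FC fG).
(* The polynomial obtained for A has to serve B as well; its error there follows from the estimate
   on all of [m, M]. *)
move=> e e0 _; have [p [pf pF]] := hF e e0; exists p; split.
  by move=> t /pf /le_trans; apply; rewrite ler_peMl ?(ltW e0)//; lra.
move=> y; rewrite poly_op_diag; apply: (le_trans (nm_hsum_le _)) => /=.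
have h1 := pF y.1.
have h2 := FC_dist mB (FC_poly m M p bB) fG pf (ltW e0) y.2.
have n1 := ler_wpM2l (ltW e0) (nm_hsum1 y).
have n2 := ler_wpM2l (ltW e0) (nm_hsum2 y).
rewrite -mulrA mulr_natl mulr2n; apply: lerD; exact: le_trans n1 || exact: le_trans n2.
Qed.

Lemma between_add A B m M m' M' : between m M A -> between m' M' B ->
  between (m + m') (M + M') (A + B).
Proof.
move=> [bA sA hA] [bB sB hB]; split; [exact: blin_add|exact: symmD|move=> x].
have [a1 a2] := hA x; have [b1 b2] := hB x.
by rewrite qfD !mulrDl; split; apply: lerD.
Qed.

Lemma between_scale A m M s : 0 <= s -> between m M A ->
  between (s * m) (s * M) (s%:C *: A).
Proof.
move=> s0 [bA sA hA]; split; [exact: blin_scale|exact: symmZ|move=> x].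
by have [a1 a2] := hA x; rewrite qfZ -!mulrA; split; apply: ler_wpM2l.
Qed.

Lemma between_id s : between s s (s%:C *: (@id_op R H)).
Proof.
split; [exact/blin_scale/blin_id|exact/symmZ/symm_id|move=> x].
by rewrite qfZ qf_id.
Qed.

(* With A = A1 + A2, the map x |-> (A1^(1/2) A^(-1/2) x, A2^(1/2) A^(-1/2) x) is
   an isometry compressing diag(T1, T2), Ti = Ai^(-1/2) Bi Ai^(-1/2), to
   A^(-1/2) (B1 + B2) A^(-1/2). *)
Lemma connection_inv_superadd f A1 A2 B1 B2 c M x : operator_monotone f ->
  quasi f -> (forall t, 0 < t -> 0 < f t) -> 0 < c -> c <= M ->
  between c M A1 -> between c M A2 -> between c M B1 -> between c M B2 ->
  qf (connection_inv f A1 B1) x + qf (connection_inv f A2 B2) x <=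
  qf (connection_inv f (A1 + A2) (B1 + B2)) x.
Proof.
move=> fm fq fp c0 cM cA1 cA2 cB1 cB2; have M0 := lt_le_trans c0 cM.
have MD : M <= M + M by rewrite lerDr ltW.
have cc : c <= c + c by rewrite lerDr ltW.
have cMM := le_trans cM MD.
have cA := between_weaken cc (lexx _) (between_add cA1 cA2).
have cB := between_weaken cc (lexx _) (between_add cB1 cB2).
(* Common bounds c and M + M let a single interval serve the three functional calculi. *)
have {}cA1 := between_weaken (lexx _) MD cA1; have {}cA2 := between_weaken (lexx _) MD cA2.
have {}cB1 := between_weaken (lexx _) MD cB1; have {}cB2 := between_weaken (lexx _) MD cB2.
have {}MD : 0 < M + M by rewrite addr_gt0.
have c'0 : 0 < c / (M + M) by rewrite divr_gt0.
have cM' : c / (M + M) <= (M + M) / c.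
  by rewrite ler_pdivrMr// mulrAC ler_pdivlMr// ler_pM// ltW.
have af : papprox (c / (M + M)) ((M + M) / c) f.
  by apply: quasi_papprox => //; exact/ltW/fp.
have [P1 [Q1 [F1 [pq1 cT1 fF1 -> _]]]] := connection_invP c0 cMM cA1 cB1 (lexx _) (lexx _) af.
have [P2 [Q2 [F2 [pq2 cT2 fF2 -> _]]]] := connection_invP c0 cMM cA2 cB2 (lexx _) (lexx _) af.
have [P [Q [F [pq cT fF -> _]]]] := connection_invP c0 cMM cA cB (lexx _) (lexx _) af.
have [[bP1 sP1] [bQ1 sQ1] PQ1 QP1 PP1] := pq1.
have [[bP2 sP2] [bQ2 sQ2] PQ2 QP2 PP2] := pq2.
have [[bP sP] [bQ sQ] PQ QP PP] := pq.
pose V (z : H) : hsum H := (P1 (Q z), P2 (Q z)).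
pose W (y : hsum H) : H := Q (P1 y.1 + P2 y.2).
have bV : blin V.
  split.
    move=> a u v; congr pair; rewrite /= (blinD bQ) (blinZ bQ).
      by rewrite (blinD bP1) (blinZ bP1).
    by rewrite (blinD bP2) (blinZ bP2).
  have [K1 K10 h1] := blin_bound (blin_comp bP1 bQ).
  have [K2 K20 h2] := blin_bound (blin_comp bP2 bQ).
  exists (K1 + K2) => z; apply: (le_trans (nm_hsum_le _)); rewrite mulrDl.
  by apply: lerD; [exact: h1|exact: h2].
have bW : blin W.
  split.
    move=> a u v; rewrite /W /= (blinD bP1) (blinZ bP1) (blinD bP2) (blinZ bP2).
    by rewrite addrACA -scalerDr bQ.1.
  have [K1 K10 h1] := blin_bound (blin_comp bQ bP1).
  have [K2 K20 h2] := blin_bound (blin_comp bQ bP2).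
  exists (K1 + K2) => z; rewrite /W (blinD bQ); apply: (le_trans (nmD _ _)).
  rewrite mulrDl; apply: lerD; [apply: le_trans (h1 _) _|apply: le_trans (h2 _) _].
    by apply: ler_wpM2l; [exact: ltW|exact: nm_hsum1].
  by apply: ler_wpM2l; [exact: ltW|exact: nm_hsum2].
have VW u y : ip (V u) y = ip u (W y).
  by rewrite ip_hsum /W -sQ ipDr /= sP1 sP2.
have WV z : W (V z) = z.
  by rewrite /W /= PP1 PP2 -[A1 _ + _]/((A1 + A2) _) -PP PQ QP.
have CT z : qf (Q \o (B1 + B2) \o Q) z =
    qf (diag_op (Q1 \o B1 \o Q1) (Q2 \o B2 \o Q2)) (V z).
  by rewrite qf_diag !qf_conj//= QP1 QP2 qfD.
have [bT sT _] := cT.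
have := jensen_isometry bV bW VW WV fm fq c'0 (ltW (fp _ c'0)) cM'
  (between_diag cT1 cT2) bT sT CT (FC_diag cT1 cT2 fF1 fF2) fF (P x).
by rewrite qf_diag /= QP !qf_conj.
Qed.

Lemma pow_op_scale A c M s r : 0 < c -> 0 < s -> -1 <= r <= 1 -> between c M A ->
  pow_op (s%:C *: A) r = (s `^ r)%:C *: pow_op A r.
Proof.
move=> c0 s0 r1 cA; have [bA sA _] := cA.
have csA := between_scale (ltW s0) cA; have sc0 := mulr_gt0 s0 c0.
have [B fB] := FC_exists cA (papprox_powR M c0 r1).
have [C fC] := FC_exists csA (papprox_powR (s * M) sc0 r1).
rewrite (pow_opE cA fB) (pow_opE csA fC).
apply: (FC_inj cA _ (FC_scale (s `^ r) bA fB)).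
have lin t : c <= t <= M -> s * c <= s * t <= s * M by rewrite !ler_pM2l.
apply: FC_ext (FC_comp bA lin (FC_scale s bA (FC_id c M bA)) fC) => t /andP[ct _] /=.
by rewrite powRM ?(ltW s0)// (le_trans (ltW c0)).
Qed.

Lemma connection_inv_scale f A B c M s : quasi f -> (forall t, 0 < t -> 0 < f t) ->
  0 < c -> c <= M -> 0 < s -> between c M A -> between c M B ->
  connection_inv f (s%:C *: A) (s%:C *: B) = s%:C *: connection_inv f A B.
Proof.
move=> fq fp c0 cM s0 cA cB; have M0 := lt_le_trans c0 cM.
have c'0 : 0 < c / M by rewrite divr_gt0.
have af : papprox (c / M) (M / c) f by apply: quasi_papprox => //; exact/ltW/fp.
have [P [Q [F [pq cT fF E [PE QE]]]]] := connection_invP c0 cM cA cB (lexx _) (lexx _) af.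
have [h1 h2] := half_bounds.
have [[bP _] [bQ _] _ _ _] := pq; have bF := blin_FC fF.
have ss : s `^ 2^-1 * s `^ 2^-1 = s.
  by rewrite -powRD ?(gt_eqF s0) ?implybT// (_ : 2^-1 + 2^-1 = 1) ?powRr1 ?ltW//; lra.
have ss' : s `^ (- 2^-1) * (s * s `^ (- 2^-1)) = 1.
  rewrite -{2}ss powRN mulrA mulrA mulVf ?mul1r ?mulfV// gt_eqF// powR_gt0//.
rewrite E {1}/connection_inv (pow_op_scale c0 s0 h1 cA) (pow_op_scale c0 s0 h2 cA).
rewrite -PE -QE.
have -> : ((s `^ (- 2^-1))%:C *: Q) \o (s%:C *: B) \o ((s `^ (- 2^-1))%:C *: Q) =
    Q \o B \o Q.
  have [bB _ _] := cB.
  apply/funext => x /=; rewrite !opE (blinZ bB) scalerA (blinZ bQ) scalerA.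
  by rewrite -!rmorphM ss' scale1r.
rewrite (FC_fun_calc cT fF); apply/funext => x /=.
by rewrite !opE (blinZ bF) (blinZ bP) scalerA -rmorphM ss.
Qed.

Lemma fun_calc_scalar g s : fun_calc g (s%:C *: (@id_op R H)) = (g s)%:C *: id_op.
Proof.
have [b _ _] := between_id s.
apply: (FC_fun_calc (between_id s)); apply: FC_ext (FC_cst s s (g s) b) => t st.
by congr g; apply: le_anti.
Qed.

Lemma connection_inv_scalar h Z s c M : 0 < s -> 0 < c -> between c M Z ->
  papprox (s^-1 * c) (s^-1 * M) h ->
  connection_inv h (s%:C *: id_op) Z = s%:C *: fun_calc h ((s^-1)%:C *: Z).
Proof.
move=> s0 c0 cZ ah; have [bZ _ _] := cZ.
have sV : 0 <= s^-1 by rewrite invr_ge0 ltW.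
have csZ := between_scale sV cZ.
have [F fF] := FC_exists csZ ah; have bF := blin_FC fF.
rewrite /connection_inv /pow_op !fun_calc_scalar.
have ss : s `^ 2^-1 * s `^ 2^-1 = s.
  by rewrite -powRD ?(gt_eqF s0) ?implybT// (_ : 2^-1 + 2^-1 = 1) ?powRr1 ?ltW//; lra.
have -> : ((s `^ (- 2^-1))%:C *: id_op) \o Z \o ((s `^ (- 2^-1))%:C *: id_op) =
    (s^-1)%:C *: Z.
  apply/funext => x /=; rewrite !opE /id_op/= (blinZ bZ) scalerA -rmorphM.
  by rewrite powRN -invfM ss.
rewrite (FC_fun_calc csZ fF); apply/funext => x /=; rewrite !opE /id_op/=.
by rewrite (blinZ bF) scalerA -rmorphM ss.
Qed.

(** A^(-1/2) (A sigma_f B) A^(-1/2) is exactly f(T) for T = A^(-1/2) B A^(-1/2), so h is applied to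
    f(T). *)
Lemma connection_inv_comp h f A B c M : quasi f -> (forall t, 0 < t -> 0 < f t) ->
  quasi h -> (forall t, 0 < t -> 0 < h t) ->
  0 < c -> c <= M -> between c M A -> between c M B ->
  connection_inv h A (connection_inv f A B) = connection_inv (fun t => h (f t)) A B.
Proof.
move=> fq fp hq hp c0 cM cA cB; have M0 := lt_le_trans c0 cM.
have c'0 : 0 < c / M by rewrite divr_gt0.
have af : papprox (c / M) (M / c) f by apply: quasi_papprox => //; exact/ltW/fp.
have [P [Q [F [pq cT fF E [PE QE]]]]] := connection_invP c0 cM cA cB (lexx _) (lexx _) af.
have [_ _ PQ QP _] := pq; have [bT _ _] := cT.
have lin t : c / M <= t <= M / c -> f (c / M) <= f t <= f (M / c).
  move=> /andP[t1 t2]; have [-> _] := fq _ _ c'0 t1.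
  by have [-> _] := fq _ _ (lt_le_trans c'0 t1) t2.
have cF := FC_between cT fF lin; have fc0 := fp _ c'0.
have [G hG] := FC_exists cF (quasi_papprox (f (M / c)) hq fc0 (ltW (hp _ fc0))).
rewrite E /connection_inv -PE -QE.
have -> : Q \o (P \o F \o P) \o Q = F.
  by apply/funext => x /=; rewrite PQ QP.
by rewrite (FC_fun_calc cF hG) (FC_fun_calc cT (FC_comp bT lin fF hG)).
Qed.

End strictly_positive_connections.

(** * The Loewner-Heinz inequality *)

Section loewner_heinz.
Context {R : realType} {H : hilbertType R}.
Implicit Types (A B : H -> H) (c M p q r : R).

Lemma FC_pow_op A c M r : 0 < c -> between c M A -> -1 <= r <= 1 ->
  FC c M (fun t => t `^ r) A (pow_op A r).
Proof.
move=> c0 cA r1; have [B fB] := FC_exists cA (papprox_powR M c0 r1).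
by rewrite (pow_opE cA fB).
Qed.

Section powers.
Variables (A : H -> H) (c M : R).
Hypotheses (c0 : 0 < c) (cA : between c M A).

Lemma pow_opD r r' x : -1 <= r <= 1 -> -1 <= r' <= 1 -> -1 <= r + r' <= 1 ->
  pow_op A r (pow_op A r' x) = pow_op A (r + r') x.
Proof.
move=> r1 r1' rr1.
have := FC_powRD c0 cA (FC_pow_op c0 cA r1) (FC_pow_op c0 cA r1').
by move=> /(FC_inj cA (FC_pow_op c0 cA rr1)) ->.
Qed.

Lemma pow_op0 x : pow_op A 0 x = x.
Proof.
have [bA _ _] := cA; have -> : pow_op A 0 = 1%:C *: id_op.
  by apply: (pow_opE cA); apply: FC_ext (FC_cst c M 1 bA) => t _; rewrite powRr0.
by rewrite opE scale1r.
Qed.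

Lemma pow_op1 : pow_op A 1 = A.
Proof.
have [bA _ _] := cA; apply: (pow_opE cA); apply: FC_ext (FC_id c M bA) => t /andP[ct _].
by rewrite powRr1// (le_trans (ltW c0)).
Qed.

Lemma blin_pow_op r : -1 <= r <= 1 -> blin (pow_op A r).
Proof. by move=> r1; exact: blin_FC (FC_pow_op c0 cA r1). Qed.

Lemma symm_pow_op r : -1 <= r <= 1 -> symm (pow_op A r).
Proof. by move=> r1; case: cA => _ sA _; exact: FC_symm sA (FC_pow_op c0 cA r1). Qed.

Lemma pow_opNK r x : -1 <= r <= 1 -> pow_op A r (pow_op A (- r) x) = x.
Proof.
by move=> r1; rewrite pow_opD ?subrr ?pow_op0//; lra.
Qed.

Lemma nm_pow_op r x : -1 <= r <= 1 -> -1 <= r + r <= 1 ->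
  nm (pow_op A r x) ^+ 2 = qf (pow_op A (r + r)) x.
Proof. by move=> r1 rr1; rewrite nm_sq symm_pow_op// pow_opD// ipC. Qed.

End powers.

(** A^p <= B^p means |A^(p/2) y| <= |B^(p/2) y|; take y = B^(-p/2) x. *)
Lemma contraction_conj A B c M p x : 0 < c -> between c M A -> between c M B ->
  0 <= p <= 1 -> (forall z, qf (pow_op A p) z <= qf (pow_op B p) z) ->
  nm (pow_op A (p / 2) (pow_op B (- (p / 2)) x)) <= nm x.
Proof.
move=> c0 cA cB p01 AB.
have p1 : -1 <= p / 2 <= 1 by lra.
have pp : -1 <= p / 2 + p / 2 <= 1 by lra.
have pE : p / 2 + p / 2 = p by lra.
rewrite -ler_sqr ?nnegrE ?nm_ge0// (nm_pow_op c0 cA)// pE.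
by apply: (le_trans (AB _)); rewrite -{1}pE -(nm_pow_op c0 cB)// (pow_opNK c0 cB).
Qed.

(* Pedersen's argument: B^-((p+q)/4) A^((p+q)/2) B^-((p+q)/4) is similar to the
   contraction K = (B^(-p/2) A^(p/2)) (A^(q/2) B^(-q/2)), so its spectrum lies
   in ]-oo, 1]. *)
Lemma pow_op_midpoint A B c M p q : 0 < c -> between c M A -> between c M B ->
  0 <= p <= 1 -> 0 <= q <= 1 ->
  (forall x, qf (pow_op A p) x <= qf (pow_op B p) x) ->
  (forall x, qf (pow_op A q) x <= qf (pow_op B q) x) ->
  forall x, qf (pow_op A ((p + q) / 2)) x <= qf (pow_op B ((p + q) / 2)) x.
Proof.
move=> c0 cA cB p01 q01 ABp ABq.
(* Conjugation by B^d is the similarity: it turns the outer exponents -p/2 and -q/2 of K into -s on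
   both sides. *)
pose m := (p + q) / 2; pose s := (p + q) / 4; pose d := (p - q) / 4.
have p1 : -1 <= p / 2 <= 1 by lra.
have q1 : -1 <= q / 2 <= 1 by lra.
have p1' : -1 <= - (p / 2) <= 1 by lra.
have q1' : -1 <= - (q / 2) <= 1 by lra.
have m1 : -1 <= m <= 1 by rewrite /m; lra.
have s1 : -1 <= s <= 1 by rewrite /s; lra.
have s1' : -1 <= - s <= 1 by rewrite /s; lra.
have d1 : -1 <= d <= 1 by rewrite /d; lra.
have d1' : -1 <= - d <= 1 by rewrite /d; lra.
pose a r := pow_op A r; pose b r := pow_op B r.
have bb r : -1 <= r <= 1 -> blin (b r) := blin_pow_op c0 cB (r := r).
have ba r : -1 <= r <= 1 -> blin (a r) := blin_pow_op c0 cA (r := r).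
have sb r : -1 <= r <= 1 -> symm (b r) := symm_pow_op c0 cB (r := r).
have sa r : -1 <= r <= 1 -> symm (a r) := symm_pow_op c0 cA (r := r).
pose K x := b (- (p / 2)) (a (p / 2) (a (q / 2) (b (- (q / 2)) x))).
have bK : blin K.
  by apply: (blin_comp (bb _ p1')); apply: (blin_comp (ba _ p1));
    apply: (blin_comp (ba _ q1)); exact: bb.
have K1 x : nm (K x) <= 1 * nm x.
  rewrite mul1r; have [->|K0] := eqVneq (nm (K x)) 0; first exact: nm_ge0.
  have Kp : 0 < nm (K x) by rewrite lt_neqAle eq_sym K0 nm_ge0.
  (* Moving two factors across the inner product writes |K x|^2 as <A^(q/2) B^(-q/2) x, A^(p/2)
     B^(-p/2) K x>, with a contraction on each side. *)
  rewrite -(ler_pM2r Kp) -expr2 nm_sq {1}/K sb// sa//.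
  apply: (le_trans (ip_le _ _)); rewrite ler_pM ?nm_ge0//.
    exact: (contraction_conj _ c0 cA cB q01 ABq).
  exact: (contraction_conj _ c0 cA cB p01 ABp).
pose W x := b (- s) (a m (b (- s) x)).
have bW : blin W.
  by apply: (blin_comp (bb _ s1')); apply: (blin_comp (ba _ m1)); exact: bb.
have sW : symm W by move=> x y; rewrite /W sb// sa// sb.
have WK x : W x = b d (K (b (- d) x)).
  rewrite /K /W /b (pow_opD c0 cB)//; last by rewrite /d; lra.
  rewrite (pow_opD c0 cB)//; last by rewrite /d; lra.
  rewrite /a (pow_opD c0 cA)//; last by lra.
  have -> : d - p / 2 = - s by rewrite /d /s; field.
  have -> : - (q / 2) - d = - s by rewrite /d /s; field.
  by have -> : p / 2 + q / 2 = m by rewrite /m; field.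
have dK x : b d (b (- d) x) = x by exact: (pow_opNK c0 cB).
have Kd x : b (- d) (b d x) = x.
  by rewrite -[X in b X x]opprK; exact: (pow_opNK c0 cB).
have W1 t : spectrum W t%:C -> t <= 1.
  move=> St; rewrite leNgt; apply/negP => t1; apply: St.
  have -> : W - t%:C *: id_op = b d \o (K - t%:C *: id_op) \o b (- d).
    apply/funext => x; rewrite /= !opE /id_op/= (blinB (bb _ d1)) (blinZ (bb _ d1)) dK.
    by rewrite WK.
  apply: invertible_comp; last first.
    exists (b d); split; [exact/bounded_opP/bb|exact/funext|exact/funext].
  apply: invertible_comp; last exact: (neumann bK ler01 t1 K1).
  exists (b (- d)); split; [exact/bounded_opP/bb|exact/funext|exact/funext].
(* K need not be self-adjoint, but W is, so its form is controlled by its spectrum. *)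
have Wle x : qf W x <= nm x ^+ 2.
  have : 0 <= qf (poly_op (1 - 'X) W) x.
    by apply: poly_op_ge0 => // t /W1; rewrite hornerD hornerN hornerX hornerC subr_ge0.
  by rewrite poly_opB poly_opX -polyC1 poly_opC qfB qfZ qf_id mul1r subr_ge0.
move=> x; have := Wle (b s x); rewrite (nm_pow_op c0 cB)//; last by rewrite /s; lra.
have -> : s + s = m by rewrite /s /m; field.
apply: le_trans; rewrite /qf /W sb//.
by rewrite -[X in b X x]opprK /b (pow_opNK c0 cB) ?opprK//.
Qed.

(** k / 2^(n+1) is the midpoint of the dyadics of level n whose numerators are k / 2 rounded down
    and up. *)
Lemma pow_op_dyadic A B c M n k : 0 < c -> between c M A -> between c M B ->
  (forall x, qf A x <= qf B x) -> (k <= 2 ^ n)%N ->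
  forall x, qf (pow_op A (k%:R / 2 ^+ n)) x <= qf (pow_op B (k%:R / 2 ^+ n)) x.
Proof.
move=> c0 cA cB AB; elim: n k => [|n IH] k.
  rewrite expn0 expr0 divr1; case: k => [|[|//]] _ x.
    by rewrite /qf (pow_op0 cA) (pow_op0 cB).
  by rewrite (pow_op1 c0 cA) (pow_op1 c0 cB).
move=> kn.
have k1 : (k./2 <= 2 ^ n)%N by rewrite leq_half_double -mul2n -expnS (leq_trans kn).
have k2 : (uphalf k <= 2 ^ n)%N by rewrite leq_uphalf_double -mul2n -expnS.
have P0 : 0 < 2 ^+ n :> R by rewrite exprn_gt0.
have b01 j : (j <= 2 ^ n)%N -> 0 <= (j%:R : R) / 2 ^+ n <= 1.
  move=> jn; rewrite divr_ge0 ?(ltW P0)//= ler_pdivrMr// mul1r -natrX ler_nat//.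
have E : (k%:R : R) / 2 ^+ n.+1 = ((k./2)%:R / 2 ^+ n + (uphalf k)%:R / 2 ^+ n) / 2.
  rewrite -mulrDl -natrD uphalf_half addnCA addnn -{1}(odd_double_half k).
  by rewrite exprS; field; rewrite gt_eqF.
rewrite E; apply: (pow_op_midpoint c0 cA cB (b01 _ k1) (b01 _ k2)).
- exact: IH.
- exact: IH.
Qed.

(** Write t^p = exp(p ln t) and use exp(u) - exp(v) <= exp(u) (u - v), with |ln t| bounded on
    [c, M]. The uniformity in t is what extends Loewner-Heinz from dyadic exponents to all of
    [0, 1]. *)
Lemma powR_exponent_lipschitz c M t p q : 0 < c -> c <= t <= M ->
  0 <= p <= 1 -> 0 <= q <= 1 ->
  `|t `^ p - t `^ q| <= `|p - q| * (expR (`|ln c| + `|ln M|) * (`|ln c| + `|ln M|)).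
Proof.
move=> c0 /andP[ct tM] p01 q01; have t0 := lt_le_trans c0 ct.
set l := `|ln c| + _.
have lt : `|ln t| <= l.
  have h1 : ln c <= ln t by rewrite ler_ln ?posrE.
  have h2 : ln t <= ln M by rewrite ler_ln ?posrE ?(lt_le_trans t0).
  have := ler_norm (- ln c); have := ler_norm (ln M); rewrite normrN.
  have := normr_ge0 (ln c); have := normr_ge0 (ln M).
  rewrite ler_norml /l; lra.
have l0 : 0 <= l by rewrite (le_trans _ lt).
have pE r : t `^ r = expR (r * ln t) by rewrite /powR gt_eqF.
have key r r' : 0 <= r <= 1 -> 0 <= r' <= 1 ->
    t `^ r - t `^ r' <= `|r - r'| * (expR l * l).
  move=> r1 r1'; rewrite !pE; set u := r * _; set v := r' * _.
  have e0 := expR_gt0 u.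
  have : 1 + (v - u) <= expR (v - u) by exact: expR_ge1Dx.
  rewrite expRD -(ler_pM2l e0) mulrCA -expRD subrr expR0 mulr1 => h.
  apply: (@le_trans _ _ (expR u * (u - v))); first nra.
  have uv : u - v <= `|r - r'| * l.
    rewrite -mulrBl; apply: (le_trans (ler_norm _)); rewrite normrM.
    by rewrite ler_wpM2l.
  have ul : expR u <= expR l.
    rewrite ler_expR /u; apply: (le_trans (ler_norm _)); rewrite normrM.
    apply: (@le_trans _ _ (1 * `|ln t|)); last by rewrite mul1r.
    by rewrite ler_wpM2r// ger0_norm; case/andP: r1.
  apply: (@le_trans _ _ (expR u * (`|r - r'| * l))); first by rewrite ler_wpM2l// ltW.
  rewrite [leRHS]mulrCA ler_wpM2r// mulr_ge0//.
rewrite ler_norml lerNl opprB key//= distrC key//.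
Qed.

Lemma loewner_heinz_FC A B c M p : 0 < c -> between c M A -> between c M B ->
  0 <= p <= 1 -> (forall x, qf A x <= qf B x) ->
  forall x, qf (pow_op A p) x <= qf (pow_op B p) x.
Proof.
move=> c0 cA cB p01 AB x; rewrite -subr_le0.
(* The added 1 keeps L positive when c = M = 1. *)
pose l := `|ln c| + `|ln M|; pose L := expR l * l + 1.
have L0 : 0 < L by rewrite /L ltr_wpDl// mulr_ge0 ?expR_ge0// addr_ge0.
apply: (@ler_eps_mul _ _ (2 * nm x ^+ 2)) => e e0.
have eL : 0 < e / L by rewrite divr_gt0.
have [n _ hn] : \forall n \near \oo, (2 : R)^-1 ^+ n < e / L.
  have : (fun n => (2 : R)^-1 ^+ n) @ \oo --> (0 : R).
    by apply: cvg_expr; rewrite ger0_norm ?invr_ge0// invf_lt1// ltr1n.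
  move=> /cvgrPdist_lt/(_ _ eL); apply: filterS => n.
  by rewrite sub0r normrN ger0_norm ?exprn_ge0 ?invr_ge0.
have {hn} := hn n (leqnn n); rewrite /= exprVn => hn.
have P0 : 0 < 2 ^+ n :> R by rewrite exprn_gt0.
pose k := Num.truncn (p * 2 ^+ n).
have pn0 : 0 <= p * 2 ^+ n by rewrite mulr_ge0 ?(ltW P0)//; case/andP: p01.
have /andP[k1 k2] := truncn_itv pn0; rewrite -/k in k1 k2.
have kn : (k <= 2 ^ n)%N.
  rewrite -(ler_nat R) natrX (le_trans k1)// ler_piMl ?(ltW P0)//.
  by case/andP: p01.
pose q : R := k%:R / 2 ^+ n.
have q0 : 0 <= q by rewrite divr_ge0// ltW.
have qp : q <= p by rewrite ler_pdivrMr.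
have q01 : 0 <= q <= 1 by rewrite q0 (le_trans qp)//; case/andP: p01.
have pq : `|p - q| <= e / L.
  rewrite ger0_norm ?subr_ge0//; apply: le_trans (ltW hn).
  rewrite lerBlDl /q -[X in _ + X]mul1r -mulrDl ler_pdivlMr// ltW//.
  by rewrite natr1.
have dist t : c <= t <= M -> `|t `^ p - t `^ q| <= e.
  move=> ct; apply: (le_trans (powR_exponent_lipschitz c0 ct p01 q01)).
  rewrite -/l; apply: (@le_trans _ _ (e / L * L)); last by rewrite divfK ?gt_eqF.
  by rewrite ler_pM ?mulr_ge0 ?expR_ge0 ?addr_ge0// lerDl.
have p1 : -1 <= p <= 1 by lra.
have q1 : -1 <= q <= 1 by lra.
have dA := FC_dist cA (FC_pow_op c0 cA p1) (FC_pow_op c0 cA q1) dist (ltW e0) x.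
have dist' t : c <= t <= M -> `|t `^ q - t `^ p| <= e by rewrite distrC; exact: dist.
have dB := FC_dist cB (FC_pow_op c0 cB q1) (FC_pow_op c0 cB p1) dist' (ltW e0) x.
have := pow_op_dyadic c0 cA cB AB kn x; rewrite -/q.
have := ip_le (pow_op A p x - pow_op A q x) x.
have := ip_le (pow_op B q x - pow_op B p x) x.
rewrite !ipE -!/(qf _ _) expr2.
have := ler_wpM2r (nm_ge0 x) dA; have := ler_wpM2r (nm_ge0 x) dB.
move: (qf _ x) (qf _ x) (qf _ x) (qf _ x) (nm _) (nm _) => a1 a2 a3 a4 n1 n2.
lra.
Qed.

End loewner_heinz.

(** * Powers and compositions as representing functions *)

Section compositions.
Context {R : realType}.
Implicit Types (f h : R -> R) (p : R).

Lemma common_bounds {H : hilbertType R} (A B : H -> H) :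
  bounded_op A -> bounded_op B -> positive_op A -> positive_op B ->
  invertible_op A -> invertible_op B ->
  exists c M, [/\ 0 < c, c <= M, between c M A & between c M B].
Proof.
move=> bA bB pA pB iA iB.
have [c [M [c0 cM cA]]] := invertible_between bA pA iA.
have [d [N [d0 dN dB]]] := invertible_between bB pB iB.
exists (Num.min c d), (Num.max M N); split.
- by rewrite lt_min c0.
- by rewrite ge_min le_max cM.
- by apply: between_weaken cA; rewrite ?ge_min ?le_max lexx.
- by apply: between_weaken dB; rewrite ?ge_min ?le_max lexx orbT.
Qed.

Lemma powR_operator_monotone p : 0 <= p <= 1 -> operator_monotone (fun t : R => t `^ p).
Proof.
move=> p01 K A B bA bB pA pB iA iB AB.
have [c [M [c0 cM cA cB]]] := common_bounds bA bB pA pB iA iB.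
have p1 : -1 <= p <= 1 by lra.
have [lA sA _] := cA; have [lB sB _] := cB.
apply/le_opP.
- exact: (blin_pow_op c0 cA p1).
- exact: (blin_pow_op c0 cB p1).
- exact: (symm_pow_op c0 cA p1).
- exact: (symm_pow_op c0 cB p1).
by apply: (loewner_heinz_FC c0 cA cB p01); apply/le_opP.
Qed.

Lemma powR_representing p : 0 <= p <= 1 -> representing (fun t : R => t `^ p).
Proof.
by move=> p01; split; [move=> t t0; rewrite powR_gt0|exact: powR_operator_monotone].
Qed.

Lemma representing_comp h f : quasi f -> quasi h -> representing f ->
  representing h -> representing (fun t => h (f t)).
Proof.
move=> fq hq [f0 fm] [h0 hm]; split; first by move=> t /f0/h0.
move=> K A B bA bB pA pB iA iB AB.
have [c [M [c0 cM cA cB]]] := common_bounds bA bB pA pB iA iB.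
have [lA sA _] := cA; have [lB sB _] := cB.
have fc := f0 _ c0; have af := quasi_papprox M fq c0 (ltW fc).
have ah := quasi_papprox (f M) hq fc (ltW (h0 _ fc)).
have lin t : c <= t <= M -> f c <= f t <= f M.
  move=> /andP[t1 t2]; have [-> _] := fq _ _ c0 t1.
  by have [-> _] := fq _ _ (lt_le_trans c0 t1) t2.
have [FA fA] := FC_exists cA af; have [FB fB] := FC_exists cB af.
have cFA := FC_between cA fA lin; have cFB := FC_between cB fB lin.
have [GA hA] := FC_exists cFA ah; have [GB hB] := FC_exists cFB ah.
rewrite (FC_fun_calc cA (FC_comp lA lin fA hA)) (FC_fun_calc cB (FC_comp lB lin fB hB)).
have [_ sFA _] := cFA; have [_ sFB _] := cFB.
apply/le_opP; [exact: blin_FC hA|exact: blin_FC hB|exact: FC_symm hA|exact: FC_symm hB|].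
apply: (opmono_FC hm fc cFA cFB hA hB); apply: (opmono_FC fm c0 cA cB fA fB).
exact/le_opP.
Qed.

End compositions.

(** * Connections of positive operators *)

Section connections.
Context {R : realType} {H : hilbertType R}.
Implicit Types (A B C Z : H -> H) (f h : R -> R) (c m M e p s : R).

Definition shift_op A e : H -> H := A + e%:C *: id_op.

Lemma between_shift A m M e : between m M A -> between (m + e) (M + e) (shift_op A e).
Proof. by move=> mA; apply: between_add => //; exact: between_id. Qed.

Lemma shift_op_split A e e' :
  shift_op A e = shift_op A e' + (e - e')%:C *: id_op.
Proof. by rewrite /shift_op -addrA -scalerDl -rmorphD (addrC e') subrK. Qed.

Lemma qf_lim T (F : set_system T) {FF : ProperFilter F} (Z : T -> H -> H) C x (a : R) :
  Z ^~ x @ F --> C x -> (\forall t \near F, a <= qf (Z t) x) -> a <= qf C x.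
Proof.
move=> /cvg_nmP Zx aZ; rewrite -subr_le0; apply: (@ler_eps_mul _ _ (nm x)) => e e0.
near F => t.
have h1 : a <= qf (Z t) x by near: t.
have h2 : nm (Z t x - C x) <= e by near: t; exact: Zx.
have := ip_le (Z t x - C x) x; rewrite !ipE -!/(qf _ _).
have := ler_wpM2r (nm_ge0 x) h2; lra.
Unshelve. all: by end_near. Qed.

Lemma qf_lim_le T (F : set_system T) {FF : ProperFilter F} (Z : T -> H -> H) C x (a : R) :
  Z ^~ x @ F --> C x -> (\forall t \near F, qf (Z t) x <= a) -> qf C x <= a.
Proof.
move=> /cvg_nmP Zx aZ; rewrite -subr_le0; apply: (@ler_eps_mul _ _ (nm x)) => e e0.
near F => t.
have h1 : qf (Z t) x <= a by near: t.
have h2 : nm (Z t x - C x) <= e by near: t; exact: Zx.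
have := ip_le (C x - Z t x) x; rewrite nmBC !ipE -!/(qf _ _).
have := ler_wpM2r (nm_ge0 x) h2; lra.
Unshelve. all: by end_near. Qed.

Lemma symm_lim T (F : set_system T) {FF : ProperFilter F} (Z : T -> H -> H) C :
  (forall x, Z ^~ x @ F --> C x) -> (\forall t \near F, symm (Z t)) -> symm C.
Proof.
move=> ZC sZ x y; apply/eqP; rewrite -subr_eq0 -normr_le0.
apply: (@ler_eps_mul _ _ (nm x + nm y)) => e e0.
have /cvg_nmP/(_ _ e0) Zx := ZC x; have /cvg_nmP/(_ _ e0) Zy := ZC y.
near F => t.
have sZt : symm (Z t) by near: t.
have h1 : nm (Z t x - C x) <= e by near: t.
have h2 : nm (Z t y - C y) <= e by near: t.
have -> : ip (C x) y - ip x (C y) = ip x (Z t y - C y) - ip (Z t x - C x) y.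
  by rewrite !ipE sZt; ring.
have ipa (u v : H) : `|ip u v| <= nm u * nm v.
  by rewrite ler_norml lerNl -ipNl -{1}(nmN u) !ip_le.
have k1 := ipa x (Z t y - C y); have k2 := ipa (Z t x - C x) y.
have := ler_wpM2l (nm_ge0 x) h2; have := ler_wpM2r (nm_ge0 y) h1.
have := ler_normB (ip x (Z t y - C y)) (ip (Z t x - C x) y); lra.
Unshelve. all: by end_near. Qed.

Lemma blin_lim T (F : set_system T) {FF : ProperFilter F} (Z : T -> H -> H) C (K : R) :
  (forall x, Z ^~ x @ F --> C x) -> (\forall t \near F, linear (Z t)) ->
  (\forall t \near F, forall x, nm (Z t x) <= K * nm x) -> blin C.
Proof.
move=> ZC lZ ZK; split=> [a x y|].
  have h : Z ^~ (a *: x + y) @ F --> a *: C x + C y.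
    have hh : (fun t => a *: Z t x + Z t y) @ F --> a *: C x + C y.
      by apply: cvgD => //; exact: (blin_cvg (blin_scale a (@blin_id R H)) (ZC x)).
    apply: cvg_trans hh; apply: near_eq_cvg; near=> t.
    have lt : linear (Z t) by near: t.
    by rewrite lt.
  exact: (cvg_unique _ (ZC _) h).
exists K => x; rewrite -subr_le0; apply: (@ler_eps_mul _ _ 1) => e e0.
have /cvg_nmP/(_ _ e0) Zx := ZC x.
near F => t.
have h1 : nm (Z t x) <= K * nm x.
  have h : forall x, nm (Z t x) <= K * nm x by near: t.
  exact: h.
have h2 : nm (Z t x - C x) <= e by near: t.
have := nmB3 (Z t x) (C x) 0; rewrite !subr0 (nmBC (C x)); lra.
Unshelve. all: by end_near. Qed.

Section limit.
Variables (f : R -> R) (A B : H -> H).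
Hypotheses (fm : operator_monotone f) (fq : quasi f) (fp : forall t, 0 < t -> 0 < f t).
Variables (M : R).
Hypotheses (M0 : 0 < M) (cA : between 0 M A) (cB : between 0 M B).

Let Z e := connection_inv f (shift_op A e) (shift_op B e).

Lemma connection_inv_shift_between e : 0 < e ->
  exists l u, [/\ 0 < l, l <= u & between l u (Z e)].
Proof.
move=> e0; have := between_shift e cA; have := between_shift e cB; rewrite add0r.
move=> hB hA; apply: (connection_inv_between fq fp e0 _ hA hB).
by rewrite lerDr ltW.
Qed.

(** A + e is the sum of A + e' and (e - e') I, and likewise for B; superadditivity applies, and the
    connection of the two scalar operators is positive. *)
Lemma connection_inv_shift_mono e e' x : 0 < e' -> e' <= e -> qf (Z e') x <= qf (Z e) x.
Proof.
move=> e'0; rewrite le_eqVlt => /predU1P[->//|e'e].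
have d0 : 0 < e - e' by rewrite subr_gt0.
pose c := Num.min e' (e - e'); pose N := M + e.
have c0 : 0 < c by rewrite lt_min e'0.
have ce' : c <= e' by rewrite ge_min lexx.
have cd : c <= e - e' by rewrite ge_min lexx orbT.
have e0 := lt_trans e'0 e'e.
have N1 : M + e' <= N by rewrite lerD2l ltW.
have N2 : e - e' <= N by rewrite /N [leRHS]addrC lerD2l (le_trans (y := 0)) ?oppr_le0 ?ltW.
have cN : c <= N by exact: le_trans cd N2.
have hS := between_weaken cd N2 (@between_id R H (e - e')).
have := between_shift e' cA; have := between_shift e' cB; rewrite add0r.
move=> /(between_weaken ce' N1) hB /(between_weaken ce' N1) hA.
have := connection_inv_superadd x fm fq fp c0 cN hA hS hB hS.
rewrite -!shift_op_split; apply: le_trans; rewrite lerDl.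
have [l [u [l0 _ [_ _ h]]]] := connection_inv_between fq fp c0 cN hS hS.
by apply: le_trans (h x).1; rewrite mulr_ge0 ?sqr_ge0// ltW.
Qed.

(* Vigier: a decreasing family of positive operators converges strongly, since
   |(Z e - Z e') x|^2 <= |Z 1| <(Z e - Z e') x, x>. *)
Lemma connection_exists : exists C, is_connection f A B C.
Proof.
have [l [u [l0 lu cZ1]]] := connection_inv_shift_between ltr01.
have u0 : 0 < u := lt_le_trans l0 lu.
have q0 e x : 0 < e -> 0 <= qf (Z e) x.
  move=> /connection_inv_shift_between [m [v [m0 _ [_ _ h]]]].
  by apply: le_trans (h x).1; rewrite mulr_ge0 ?sqr_ge0// ltW.
have bZ e : 0 < e -> blin (Z e) /\ symm (Z e).
  by move=> /connection_inv_shift_between [m [v [_ _ []]]].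
have lim x : exists y : H, Z^~ x @ 0^'+ --> y.
  apply: cauchy_nm => d d0.
  pose S : set R := [set qf (Z e) x | e in [set e | 0 < e <= 1]].
  have S1 : has_inf S.
    split; first by exists (qf (Z 1) x), 1 => //=; rewrite ltr01 lexx.
    by exists 0 => _ [e /andP[e0 _] <-]; exact: q0.
  (* A gap of d^2 / u between the forms corresponds to a distance d between the vectors, by
     [nm_pos_sq]. *)
  have dd : 0 < d ^+ 2 / u by rewrite divr_gt0// exprn_gt0.
  have [_ [e /andP[e0 e1] <-] he] := inf_adherent dd S1.
  exists (Z e x); near=> t.
  have t0 : 0 < t by near: t; exact: nbhs_right_gt.
  have te : t <= e by near: t; exact: nbhs_right_le.
  have qt : inf S <= qf (Z t) x.
    by apply: ge_inf; [case: S1|exists t => //=; rewrite t0 (le_trans te)].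
  have [bt st] := bZ _ t0; have [be se] := bZ _ e0.
  have D0 z : 0 <= qf (Z e - Z t) z by rewrite qfB subr_ge0; exact: connection_inv_shift_mono.
  have Du z : qf (Z e - Z t) z <= u * nm z ^+ 2.
    rewrite qfB; apply: (@le_trans _ _ (qf (Z 1) z)).
      by rewrite lerBlDr ler_wpDr ?q0// connection_inv_shift_mono.
    by case: cZ1 => _ _ /(_ z)[].
  have := nm_pos_sq x (blin_sub be bt) (symmB se st) D0 Du.
  rewrite qfB !opE nmBC => h.
  rewrite -ler_sqr ?nnegrE ?nm_ge0 ?(ltW d0)//; apply: (le_trans h).
  rewrite mulrC -ler_pdivlMr// lerBlDr; apply: (le_trans (ltW he)).
  by rewrite addrC lerD2l.
have [C hC] := choice lim.
exists C; split; last exact: hC.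
apply/bounded_opP; apply: (blin_lim (K := `|u|) hC).
  near=> t; have t0 : 0 < t by near: t; exact: nbhs_right_gt.
  by have [[]] := bZ t t0.
near=> t.
have t0 : 0 < t by near: t; exact: nbhs_right_gt.
have t1 : t <= 1 by near: t; apply: nbhs_right_le.
have [bt st] := bZ _ t0; apply: pos_norm; split=> // z; rewrite mul0r; split; first exact: q0.
apply: (@le_trans _ _ (qf (Z 1) z)); first exact: connection_inv_shift_mono.
by case: cZ1 => _ _ /(_ z)[].
Unshelve. all: by end_near. Qed.

Lemma connection_cvg : bounded_op (connection f A B) /\
  forall x, Z^~ x @ 0^'+ --> connection f A B x.
Proof.
have [C hC] := connection_exists.
by apply: (@xgetPex _ _ [set C | is_connection f A B C]); exists C.
Qed.

Lemma connection_le e x : 0 < e -> qf (connection f A B) x <= qf (Z e) x.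
Proof.
move=> e0; apply: (qf_lim_le (connection_cvg.2 x)); near=> t.
apply: connection_inv_shift_mono; first by near: t; exact: nbhs_right_gt.
by near: t; exact: nbhs_right_le.
Unshelve. all: by end_near. Qed.

Lemma connection_ge a x : (forall e, 0 < e -> a <= qf (Z e) x) ->
  a <= qf (connection f A B) x.
Proof.
move=> h; apply: (qf_lim (connection_cvg.2 x)); near=> t.
by apply: h; near: t; exact: nbhs_right_gt.
Unshelve. all: by end_near. Qed.

Lemma connection_symm : symm (connection f A B).
Proof.
apply: (symm_lim connection_cvg.2); near=> t.
have t0 : 0 < t by near: t; exact: nbhs_right_gt.
by have [m [v [_ _ []]]] := connection_inv_shift_between t0.
Unshelve. all: by end_near. Qed.

Lemma connection_ge0 x : 0 <= qf (connection f A B) x.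
Proof.
apply: connection_ge => e /connection_inv_shift_between [m [v [m0 _ [_ _ h]]]].
by apply: le_trans (h x).1; rewrite mulr_ge0 ?sqr_ge0// ltW.
Qed.

Lemma connection_between : exists2 N, 0 < N & between 0 N (connection f A B).
Proof.
apply: positive_between; first exact: connection_cvg.1.
apply/positive_opP; first exact/bounded_opP/connection_cvg.1.
by split; [exact: connection_symm|exact: connection_ge0].
Qed.

End limit.
End connections.

(** * Superadditivity and powers for positive operators *)

Section positive_connections.
Context {R : realType} {H : hilbertType R}.
Implicit Types (A B C Z : H -> H) (f h : R -> R) (c m M e p s : R).

Definition pos A := exists2 M, 0 < M & between 0 M A.

Lemma posP A : bounded_op A -> positive_op A -> pos A.
Proof. exact: positive_between. Qed.

Lemma pos_qf A : pos A <-> [/\ blin A, symm A & forall x, 0 <= qf A x].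
Proof.
split=> [[M M0 [bA sA hA]]|[bA sA pA]].
  by split=> // x; have [] := hA x; rewrite mul0r.
by apply: posP; [exact/bounded_opP|exact/positive_opP].
Qed.

Lemma pos_common A B : pos A -> pos B ->
  exists M, [/\ 0 < M, between 0 M A & between 0 M B].
Proof.
move=> [M M0 hA] [N N0 hB]; exists (M + N); split; first exact: addr_gt0.
- by apply: between_weaken hA; rewrite // lerDl ltW.
- by apply: between_weaken hB; rewrite // lerDr ltW.
Qed.

Lemma pos_add A B : pos A -> pos B -> pos (A + B).
Proof.
move=> /pos_qf[bA sA hA] /pos_qf[bB sB hB]; apply/pos_qf; split.
- exact: blin_add.
- exact: symmD.
- by move=> x; rewrite qfD addr_ge0.
Qed.

Lemma pos_scale A s : 0 <= s -> pos A -> pos (s%:C *: A).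
Proof.
move=> s0 /pos_qf[bA sA hA]; apply/pos_qf; split.
- exact: blin_scale.
- exact: symmZ.
- by move=> x; rewrite qfZ mulr_ge0.
Qed.

Lemma pos0 : pos (0 : H -> H).
Proof.
by rewrite -(scale0r id_op) -(rmorph0 (real_complex R)); exists 1 => //;
  apply: between_weaken (between_id 0).
Qed.

Lemma pos_sum I (r : seq I) (A : I -> H -> H) :
  (forall i, pos (A i)) -> pos (\sum_(i <- r) A i).
Proof. by move=> pA; elim/big_ind : _ => //; [exact: pos0|exact: pos_add]. Qed.

Section superadditivity.
Variable f : R -> R.
Hypotheses (fm : operator_monotone f) (fq : quasi f) (fp : forall t, 0 < t -> 0 < f t).

Lemma pos_connection A B : pos A -> pos B -> pos (connection f A B).
Proof.
by move=> pA pB; have [M [M0 hA hB]] := pos_common pA pB; exact: connection_between hA hB.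
Qed.

Lemma connection_scale_ge A B s x : 0 < s -> pos A -> pos B ->
  s * qf (connection f A B) x <= qf (connection f (s%:C *: A) (s%:C *: B)) x.
Proof.
move=> s0 pA pB; have [M [M0 hA hB]] := pos_common pA pB.
have := between_scale (ltW s0) hA; have := between_scale (ltW s0) hB.
rewrite mulr0 => hsB hsA.
apply: (connection_ge fm fq fp (mulr_gt0 s0 M0) hsA hsB) => e e0.
have es : 0 < e / s by rewrite divr_gt0.
have shiftE C : shift_op (s%:C *: C) e = s%:C *: shift_op C (e / s).
  rewrite /shift_op scalerDr scalerA -rmorphM mulrC divfK// gt_eqF//.
have := between_shift (e / s) hA; have := between_shift (e / s) hB; rewrite add0r.
move=> hB' hA'; rewrite !shiftE (connection_inv_scale fq fp es _ s0 hA' hB'); last first.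
  by rewrite lerDr ltW.
rewrite qfZ ler_pM2l//; exact: (connection_le fm fq fp M0 hA hB).
Qed.

Lemma connection_superadd A B A' B' x : pos A -> pos B -> pos A' -> pos B' ->
  qf (connection f A B) x + qf (connection f A' B') x <=
  qf (connection f (A + A') (B + B')) x.
Proof.
move=> pA pB pA' pB'.
have [M [M0 hA hB]] := pos_common pA pB.
have [M' [M'0 hA' hB']] := pos_common pA' pB'.
have := between_add hA hA'; have := between_add hB hB'; rewrite addr0 => hBB hAA.
apply: (connection_ge fm fq fp (addr_gt0 M0 M'0) hAA hBB) => e e0.
have e2 : 0 < e / 2 by rewrite divr_gt0.
have shiftE C D : shift_op (C + D) e = shift_op C (e / 2) + shift_op D (e / 2).
  by rewrite /shift_op addrACA -scalerDl -rmorphD -splitr.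
pose N := M + M' + e / 2.
have MN : M + e / 2 <= N by rewrite lerD2r lerDl ltW.
have MN' : M' + e / 2 <= N by rewrite lerD2r lerDr ltW.
have eN : e / 2 <= N by rewrite lerDr addr_ge0 ?ltW.
have sA := between_shift (e / 2) hA; have sB := between_shift (e / 2) hB.
have sA' := between_shift (e / 2) hA'; have sB' := between_shift (e / 2) hB'.
rewrite add0r in sA sB sA' sB'.
rewrite !shiftE; apply: le_trans (connection_inv_superadd x fm fq fp e2 eN
  (between_weaken (lexx _) MN sA) (between_weaken (lexx _) MN' sA')
  (between_weaken (lexx _) MN sB) (between_weaken (lexx _) MN' sB')).
apply: lerD.
  exact: (connection_le fm fq fp M0 hA hB).
exact: (connection_le fm fq fp M'0 hA' hB').
Qed.

Lemma connection_sum_ge I (r : seq I) (A B : I -> H -> H) (s : I -> R) A0 B0 x :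
  pos A0 -> pos B0 -> (forall i, pos (A i)) -> (forall i, pos (B i)) ->
  (forall i, 0 <= s i) ->
  qf (connection f A0 B0) x + \sum_(i <- r) s i * qf (connection f (A i) (B i)) x <=
  qf (connection f (A0 + \sum_(i <- r) (s i)%:C *: A i)
                   (B0 + \sum_(i <- r) (s i)%:C *: B i)) x.
Proof.
move=> pA0 pB0 pA pB s0; elim: r => [|i r IH]; first by rewrite !big_nil !addr0.
rewrite !big_cons.
have psum (C : I -> H -> H) C0 : pos C0 -> (forall i, pos (C i)) ->
    pos (C0 + \sum_(i <- r) (s i)%:C *: C i).
  by move=> pC0 pC; apply: pos_add => //; apply: pos_sum => j; exact: pos_scale.
rewrite (addrCA A0) (addrCA B0) (addrCA (qf _ _)).
(* [connection_scale_ge] is available for positive weights; a term of weight zero drops out on both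
   sides. *)
have [->|si0] := eqVneq (s i) 0.
  by rewrite mul0r add0r rmorph0 !scale0r !add0r.
have sp : 0 < s i by rewrite lt_neqAle eq_sym si0 s0.
apply: le_trans (connection_superadd x (pos_scale (s0 i) (pA i))
  (pos_scale (s0 i) (pB i)) (psum A A0 pA0 pA) (psum B B0 pB0 pB)).
exact: (lerD (connection_scale_ge x sp (pA i) (pB i)) IH).
Qed.

(** The connection of (1 + e) I with itself is (1 + e) f(1) I; this is where the normalisation of a
    mean enters. *)
Lemma connection_id (x : H) : f 1 = 1 -> qf (connection f id_op id_op) x <= nm x ^+ 2.
Proof.
move=> f1; rewrite -subr_le0; apply: (@ler_eps_mul _ _ (nm x ^+ 2)) => e e0.
have h1 : between 0 1 (id_op : H -> H).
  by rewrite -[id_op]scale1r; exact: between_weaken (between_id 1).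
have := connection_le fm fq fp ltr01 h1 h1 x e0.
have s0 : 0 < 1 + e by rewrite addr_gt0.
have -> : shift_op id_op e = (1 + e)%:C *: id_op :> (H -> H).
  by rewrite /shift_op rmorphD scalerDl scale1r.
have ss : (1 + e)^-1 * (1 + e) = 1 by rewrite mulVf ?gt_eqF.
rewrite (connection_inv_scalar s0 s0 (between_id _)); last first.
  by rewrite ss; apply: quasi_papprox => //; rewrite f1.
by rewrite scalerA -rmorphM ss fun_calc_scalar f1 !qfZ qf_id mul1r mulrDl mul1r lerBlDl.
Qed.

End superadditivity.

(** Products are strongly continuous on norm-bounded sets: Y_t u_t - Y u = Y_t (u_t - u) + (Y_t - Y)
    u, with Y_t bounded uniformly in t. *)
Lemma poly_op_cvg T (F : set_system T) {FF : Filter F} (Y : T -> H -> H) Yl N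
    (q : {poly R}) x :
  (\forall t \near F, between 0 N (Y t)) -> between 0 N Yl ->
  (forall z, Y ^~ z @ F --> Yl z) ->
  (fun t => poly_op q (Y t) x) @ F --> poly_op q Yl x.
Proof.
move=> hY [bl sl _] YYl; elim/poly_ind: q => [|q a IH].
  have E A : poly_op 0 A x = 0 by rewrite -polyC0 poly_opC opE scale0r.
  by rewrite E (_ : (fun _ => _) = cst 0); [exact: cvg_cst|exact/funext].
have E A : blin A -> poly_op (q * 'X + a%:P) A x = A (poly_op q A x) + a%:C *: x.
  by move=> bA; rewrite poly_opD poly_opC opE commr_polyX poly_opM// poly_opX.
apply/cvg_nmP => e e0.
have N0 : 0 < `|N| + 1 by rewrite ltr_wpDl.
have e1 : 0 < e / 2 / (`|N| + 1) by rewrite !divr_gt0.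
have e2 : 0 < e / 2 by rewrite divr_gt0.
have /cvg_nmP/(_ _ e1) h1 := IH.
have /cvg_nmP/(_ _ e2) h2 := YYl (poly_op q Yl x).
near=> t.
have hYt : between 0 N (Y t) by near: t.
have k1 : nm (poly_op q (Y t) x - poly_op q Yl x) <= e / 2 / (`|N| + 1) by near: t.
have k2 : nm (Y t (poly_op q Yl x) - Yl (poly_op q Yl x)) <= e / 2 by near: t.
have [bt _ _] := hYt.
rewrite !E// opprD addrACA subrr addr0.
apply: (le_trans (nmB3 (Y t (poly_op q Yl x)) _ _)); rewrite [leRHS]splitr lerD//.
rewrite -(blinB bt); apply: (le_trans (pos_norm hYt _)).
move: k1; rewrite ler_pdivlMr// => k1; have := nm_ge0 (poly_op q (Y t) x - poly_op q Yl x).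
nra.
Unshelve. all: by end_near. Qed.

(** A three-epsilon argument: one polynomial approximates h for all the operators at once, because
    they share the interval [0, N]. *)
Lemma fun_calc_cvg T (F : set_system T) {FF : Filter F} (Y : T -> H -> H) Yl N h x :
  papprox 0 N h -> (\forall t \near F, between 0 N (Y t)) -> between 0 N Yl ->
  (forall z, Y ^~ z @ F --> Yl z) ->
  (fun t => fun_calc h (Y t) x) @ F --> fun_calc h Yl x.
Proof.
move=> ah hY hYl YYl; apply/cvg_nmP => e e0.
have nx : 0 < nm x + 1 by rewrite ltr_wpDl ?nm_ge0.
pose d := e / 3 / (nm x + 1).
have d0 : 0 < d by rewrite !divr_gt0.
have e3 : 0 < e / 3 by rewrite divr_gt0.
have [q qh] := ah _ d0.
have dx : d * nm x <= e / 3.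
  by rewrite /d mulrAC ler_pdivrMr// ler_pM2l// lerDl.
have approx A : between 0 N A -> nm (poly_op q A x - fun_calc h A x) <= e / 3.
  move=> hA; have [B hB] := FC_exists hA ah; rewrite (FC_fun_calc hA hB).
  have [bA _ _] := hA; apply: le_trans dx.
  exact: (FC_dist hA (FC_poly 0 N q bA) hB qh (ltW d0)).
have h0 := @poly_op_cvg T F FF Y Yl N q x hY hYl YYl.
have h1 := (cvg_nmP _ _).1 h0 _ e3.
near=> t.
have hYt : between 0 N (Y t) by near: t.
have k1 : nm (poly_op q (Y t) x - poly_op q Yl x) <= e / 3 by near: t; exact: h1.
have k2 := approx _ hYt; have k3 := approx _ hYl; rewrite nmBC in k2.
have := nmB3 (poly_op q (Y t) x) (fun_calc h (Y t) x) (fun_calc h Yl x).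
have := nmB3 (poly_op q Yl x) (poly_op q (Y t) x) (fun_calc h Yl x).
lra.
Unshelve. all: by end_near. Qed.

Lemma pos_pow_op A p : 0 <= p <= 1 -> pos A -> pos (pow_op A p).
Proof.
move=> p01 [M M0 hA]; have [B hB] := FC_exists hA (papprox_powR0 M p01).
have [_ sA _] := hA; rewrite (pow_opE hA hB); apply/pos_qf; split.
- exact: blin_FC hB.
- exact: FC_symm hB.
- by apply: (FC_ge0 hA hB) => t _; exact: powR_ge0.
Qed.

(** The strictly positive case is applied to A + e and B + e, and e tends to 0 by [fun_calc_cvg]. *)
Lemma loewner_heinz A B p x : 0 <= p <= 1 -> pos A -> pos B ->
  (forall z, qf A z <= qf B z) -> qf (pow_op A p) x <= qf (pow_op B p) x.
Proof.
move=> p01 pA pB AB; have [M [M0 hA hB]] := pos_common pA pB.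
have lim C : between 0 M C ->
    (fun e => pow_op (shift_op C e) p x) @ 0^'+ --> pow_op C p x.
  move=> hC; apply: (@fun_calc_cvg _ _ _ _ _ (M + 1)).
  - exact: papprox_powR0.
  - near=> e; have e0 : 0 < e by near: e; exact: nbhs_right_gt.
    have e1 : e <= 1 by near: e; exact: nbhs_right_le.
    apply: between_weaken (between_shift e hC); first by rewrite add0r ltW.
    by rewrite lerD2l.
  - by apply: between_weaken hC; rewrite // lerDl.
  move=> z; apply/cvg_nmP => d d0.
  have dz : 0 < d / (nm z + 1) by rewrite divr_gt0// ltr_wpDl ?nm_ge0.
  near=> e; have e0 : 0 < e by near: e; exact: nbhs_right_gt.
  rewrite /shift_op !opE addrAC subrr add0r nmZ gtr0_norm//.
  have nz : 0 < nm z + 1 by rewrite ltr_wpDl ?nm_ge0.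
  have : e <= d / (nm z + 1) by near: e; exact: nbhs_right_le.
  by rewrite ler_pdivlMr// /id_op/=; nra.
rewrite -subr_ge0 -qfB.
pose Z e := pow_op (shift_op B e) p - pow_op (shift_op A e) p.
have cvg : Z ^~ x @ 0^'+ --> (pow_op B p - pow_op A p) x.
  exact: (cvgB (lim B hB) (lim A hA)).
apply: (qf_lim (Z := Z) cvg).
near=> e; have e0 : 0 < e by near: e; exact: nbhs_right_gt.
have := between_shift e hA; have := between_shift e hB; rewrite add0r => sB sA.
rewrite qfB subr_ge0; apply: (loewner_heinz_FC e0 sA sB p01) => z.
by rewrite !qfD lerD2r.
Unshelve. all: by end_near. Qed.

(* With s = 1 + 2e, Z = A_e sigma_f B_e and h(t) = t^p, superadditivity of sigma_h
   and A <= 1 give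
   A_e sigma_(h o f) B_e = A_e sigma_h Z <= s sigma_h (Z + e) = s h((Z + e) / s). *)
Lemma connection_pow_le f A B p x : operator_monotone f -> quasi f ->
  (forall t, 0 < t -> 0 < f t) -> 0 <= p <= 1 ->
  representing (fun t => f t `^ p) -> quasi (fun t => f t `^ p) ->
  pos A -> pos B -> (forall z, qf A z <= nm z ^+ 2) ->
  qf (connection (fun t => f t `^ p) A B) x <= qf (pow_op (connection f A B) p) x.
Proof.
move=> fm fq fp p01 [gp gm] gq pA pB A1.
have [M [M0 hA hB]] := pos_common pA pB.
have hm := @powR_operator_monotone R p p01.
have hq := quasi_powR p01.
have hp t : 0 < t -> 0 < t `^ p :> R by move=> t0; rewrite powR_gt0.
set g := fun t => f t `^ p.
pose Z e := connection_inv f (shift_op A e) (shift_op B e).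
pose s e : R := 1 + 2 * e.
pose Y e : H -> H := ((s e)^-1)%:C *: shift_op (Z e) e.
have [bC Zcvg] := connection_cvg fm fq fp M0 hA hB.
have [l1 [u [l10 lu1 cZ1]]] := connection_inv_shift_between fq fp M0 hA hB ltr01.
have u0 : 0 < u := lt_le_trans l10 lu1.
have step e : 0 < e -> qf (connection g A B) x <= s e * qf (pow_op (Y e) p) x.
  move=> e0; apply: (le_trans (connection_le gm gq gp M0 hA hB x e0)).
  have s0 : 0 < s e by rewrite /s; lra.
  have [l [v [l0 lv hZ]]] := connection_inv_shift_between fq fp M0 hA hB e0.
  have := between_shift e hA; have := between_shift e hB; rewrite add0r => sB sA.
  have eM : e <= M + e by rewrite lerDr ltW.
  rewrite -(connection_inv_comp fq fp hq hp e0 eM sA sB) -/(Z e).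
  (* D completes A + e to the scalar s = 1 + 2e, and D >= e because A <= 1. It is paired with e I in
     the second argument. *)
  pose D : H -> H := (1 + e)%:C *: id_op - A.
  have hD : between e (1 + e) D.
    have [bA sA' qA] := hA; split.
    - by apply: blin_sub => //; exact/blin_scale/blin_id.
    - by apply: symmB => //; exact/symmZ/symm_id.
    move=> z; rewrite qfB qfZ qf_id; have := A1 z; have := (qA z).1.
    by rewrite mul0r; split; lra.
  have hE := @between_id R H e.
  pose c := Num.min e l; pose N := M + e + 1 + v.
  have v0 := lt_le_trans l0 lv.
  have c0 : 0 < c by rewrite lt_min e0.
  have ce : c <= e by rewrite ge_min lexx.
  have cl : c <= l by rewrite ge_min lexx orbT.
  have N1 : M + e <= N by rewrite /N; lra.
  have N2 : v <= N by rewrite /N; lra.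
  have N3 : 1 + e <= N by rewrite /N; lra.
  have N4 : e <= N by rewrite /N; lra.
  have cN := le_trans ce N4.
  have SD : shift_op A e + D = (s e)%:C *: id_op.
    rewrite /shift_op /D addrC addrA subrK -scalerDl -rmorphD /s.
    by have -> : 1 + e + e = 1 + 2 * e by ring.
  have := connection_inv_superadd x hm hq hp c0 cN (between_weaken ce N1 sA)
    (between_weaken ce N3 hD) (between_weaken cl N2 hZ) (between_weaken ce N4 hE).
  rewrite SD.
  have hZe := between_shift e hZ.
  have le0 : 0 < l + e by rewrite addr_gt0.
  have ah : papprox ((s e)^-1 * (l + e)) ((s e)^-1 * (v + e)) (fun t => t `^ p).
    by apply: papprox_powR; [rewrite mulr_gt0// invr_gt0|lra].
  rewrite -/(shift_op (Z e) e) (connection_inv_scalar s0 le0 hZe ah) qfZ.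
  apply: le_trans; rewrite lerDl.
  have [m [w [m0 _ [_ _ q0]]]] := connection_inv_between hq hp c0 cN
    (between_weaken ce N3 hD) (between_weaken ce N4 hE).
  by apply: le_trans (q0 x).1; rewrite mulr_ge0 ?sqr_ge0// ltW.
have [U [U0 hC]] : exists U, [/\ 0 < U & between 0 U (connection f A B)].
  by have [U U0 hU] := connection_between fm fq fp M0 hA hB; exists U.
(* For e <= 1, Y e is at most Z 1 + 1 <= u + 1, while the limit is at most U. *)
pose N := u + U + 1.
have Ycvg : (fun e => pow_op (Y e) p x) @ 0^'+ --> pow_op (connection f A B) p x.
  apply: (@fun_calc_cvg _ _ _ _ _ N).
  - exact: papprox_powR0.
  - near=> e; have e0 : 0 < e by near: e; exact: nbhs_right_gt.
    have e1 : e <= 1 by near: e; exact: nbhs_right_le.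
    have [l [v [l0 _ hZ]]] := connection_inv_shift_between fq fp M0 hA hB e0.
    have s1 : 1 <= s e by rewrite /s; lra.
    have si : 0 <= (s e)^-1 by rewrite invr_ge0 (le_trans ler01).
    have si1 : (s e)^-1 <= 1 by rewrite invf_le1// (lt_le_trans ltr01).
    have [bY sY hY] := between_scale si (between_shift e hZ).
    split=> // z; rewrite mul0r; split.
      apply: le_trans (hY z).1; apply: mulr_ge0; last exact: sqr_ge0.
      by apply: mulr_ge0 => //; apply/ltW/addr_gt0.
    rewrite qfZ qfD qfZ qf_id.
    have q1 : qf (Z e) z <= u * nm z ^+ 2.
      apply: (@le_trans _ _ (qf (Z 1) z)).
        exact: (connection_inv_shift_mono fm fq fp M0 hA hB).
      by case: cZ1 => _ _ /(_ z)[].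
    have [_ _ /(_ z)[qZ0 _]] := hZ; have n0 := sqr_ge0 (nm z).
    have {qZ0}qZ0 : 0 <= qf (Z e) z by apply: le_trans qZ0; rewrite mulr_ge0// ltW.
    apply: (@le_trans _ _ (1 * (qf (Z e) z + e * nm z ^+ 2))).
      by rewrite ler_wpM2r// addr_ge0// mulr_ge0// ltW.
    rewrite mul1r /N; have := mulr_ge0 (ltW U0) n0; nra.
  - by apply: between_weaken hC; rewrite // /N; lra.
  move=> z; apply/cvg_nmP => d d0.
  set C := connection f A B.
  have d2 : 0 < d / 2 by rewrite divr_gt0.
  have nz : 0 < nm z + 2 * nm (C z) + 1 by rewrite ltr_wpDl// addr_ge0 ?mulr_ge0 ?nm_ge0.
  have dz : 0 < d / 2 / (nm z + 2 * nm (C z) + 1) by rewrite divr_gt0.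
  have Zd : \forall e \near 0^'+, nm (Z e z - C z) <= d / 2 by have /cvg_nmP := Zcvg z; exact.
  near=> e; have e0 : 0 < e by near: e; exact: nbhs_right_gt.
  have s1 : 1 <= s e by rewrite /s; lra.
  have sp : 0 < s e := lt_le_trans ltr01 s1.
  have k1 : nm (Z e z - C z) <= d / 2 by near: e; exact: Zd.
  have k2 : e <= d / 2 / (nm z + 2 * nm (C z) + 1) by near: e; exact: nbhs_right_le.
  have -> : Y e z - C z =
      ((s e)^-1)%:C *: ((Z e z - C z) + e%:C *: (z - (2%:R)%:C *: C z)).
    have <- : shift_op (Z e) e z - (s e)%:C *: C z =
        (Z e z - C z) + e%:C *: (z - (2%:R)%:C *: C z).
      rewrite scalerBr scalerA -rmorphM (mulrC e) /shift_op !opE /id_op/= /s.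
      by rewrite rmorphD scalerDl scale1r opprD addrACA.
    by rewrite scalerBr scalerA -rmorphM mulVf ?gt_eqF// scale1r.
  rewrite nmZ gtr0_norm ?invr_gt0//.
  apply: (@le_trans _ _ (1 * nm (Z e z - C z + e%:C *: (z - (2%:R)%:C *: C z)))).
    by rewrite ler_wpM2r ?nm_ge0// invf_le1.
  rewrite mul1r; apply: (le_trans (nmD _ _)); rewrite [leRHS]splitr lerD//.
  rewrite nmZ gtr0_norm//.
  have := nmB z ((2%:R)%:C *: C z); rewrite nmZ ger0_norm// => k3.
  move: k2; rewrite ler_pdivlMr// => k2.
  apply: le_trans k2; rewrite ler_wpM2l ?(ltW e0)//; lra.
set a := qf (connection g A B) x in step *; set b := qf _ x.
have a0 : 0 <= a.
  by have /pos_qf[_ _] := pos_connection gm gq gp pA pB; exact.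
(* Since 0 <= a, the factor s e can be replaced by s d for all e <= d, so that the power of Y e
   alone varies in the limit. The 2 comes from s d = 1 + 2d. *)
rewrite -subr_le0; apply: (@ler_eps_mul _ _ (2 * b)) => d d0.
have sd : 0 < s d by rewrite /s; lra.
suff : a / s d <= b by rewrite ler_pdivrMr// /s; lra.
apply: (qf_lim (Z := fun e => pow_op (Y e) p) Ycvg); near=> e.
have e0 : 0 < e by near: e; exact: nbhs_right_gt.
have ed : e <= d by near: e; exact: nbhs_right_le.
have se : 0 < s e by rewrite /s; lra.
have := step e e0; rewrite mulrC -ler_pdivrMr//; apply: le_trans.
rewrite ler_wpM2l// lef_pV2 ?posrE// /s; lra.
Unshelve. all: by end_near. Qed.

End positive_connections.

Theorem theorem3p4 (R : realType) (H : hilbertType R) (n : nat)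
    (A B : 'I_n -> H -> H) (f : R -> R) (p : R)
    (bA : forall j, bounded_op (A j)) (bB : forall j, bounded_op (B j))
    (pA : forall j, positive_op (A j)) (pB : forall j, positive_op (B j))
    (sA : le_op (\sum_(j < n) A j) id_op)
    (sB : le_op (\sum_(j < n) B j) id_op)
    (hf : mean_representing f) (hp : 0 <= p <= 1)
    (t : 'I_n -> R) (ht : forall j, 0 <= t j <= 1) :
  let X := connection f (id_op - \sum_(j < n) (t j)%:C *: A j)
                        (id_op - \sum_(j < n) (t j)%:C *: B j)
           - \sum_(j < n) (1 - t j)%:C *: connection f (A j) (B j) in
  let Y := id_op - \sum_(j < n) connection f (A j) (B j) in
  [/\ positive_op X, positive_op Y,
      le_op (connection (fun s => f s `^ p) (id_op - \sum_(j < n) A j)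
                                            (id_op - \sum_(j < n) B j))
            (pow_op X p)
    & le_op (pow_op X p) (pow_op Y p)].
Proof.
move=> X Y.
(* [representing_quasi] needs a nonzero vector to test f on; on the zero space every operator is
   positive. *)
have [ex|triv] := pselect (exists x : H, x != 0); last first.
  have z (C : H -> H) : positive_op C.
    move=> x; have -> : x = 0 by apply: contrapT => /eqP x0; apply: triv; exists x.
    by rewrite linear0r.
  by split; exact: z.
case: hf => fr f1; have [fp fm] := fr.
have fq := representing_quasi ex fr.
have gr := representing_comp fq (quasi_powR hp) fr (powR_representing hp).
have gq := representing_quasi ex gr; have [gp gm] := gr.
have {}pA j : pos (A j) by exact: posP.
have {}pB j : pos (B j) by exact: posP.
have posR (C : 'I_n -> H -> H) : (forall j, pos (C j)) ->
    le_op (\sum_(j < n) C j) id_op -> pos (id_op - \sum_(j < n) C j).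
  move=> pC sC; apply: posP => //; apply/bounded_opP/blin_sub; first exact: blin_id.
  by apply: blin_sum => j _; have /pos_qf[] := pC j.
set A0 := id_op - \sum_(j < n) A j; set B0 := id_op - \sum_(j < n) B j.
have pA0 : pos A0 by exact: posR.
have pB0 : pos B0 by exact: posR.
have t0 j : 0 <= t j by case/andP: (ht j).
have t1 j : 0 <= 1 - t j by rewrite subr_ge0; case/andP: (ht j).
have split1 (C : 'I_n -> H -> H) : id_op - \sum_(j < n) (t j)%:C *: C j =
    id_op - \sum_(j < n) C j + \sum_(j < n) (1 - t j)%:C *: C j.
  rewrite -addrA; congr (_ + _); rewrite -!sumrN -big_split/=.
  apply: eq_bigr => j _.
  by rewrite rmorphB rmorph1 scalerBl scale1r addrA addNr add0r.
have posT (C : 'I_n -> H -> H) : (forall j, pos (C j)) ->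
    pos (id_op - \sum_(j < n) C j) -> pos (id_op - \sum_(j < n) (t j)%:C *: C j).
  move=> pC pC0; rewrite split1; apply: pos_add => //; apply: pos_sum => j.
  exact: pos_scale.
set At := id_op - \sum_(j < n) (t j)%:C *: A j in X *.
set Bt := id_op - \sum_(j < n) (t j)%:C *: B j in X *.
have pAt : pos At by exact: posT.
have pBt : pos Bt by exact: posT.
pose S j := connection f (A j) (B j).
have pS j : pos (S j) by exact: pos_connection.
have qX x : qf X x = qf (connection f At Bt) x - \sum_(j < n) (1 - t j) * qf (S j) x.
  by rewrite qfB qf_sum; congr (_ - _); apply: eq_bigr => j _; rewrite qfZ.
have qY x : qf Y x = nm x ^+ 2 - \sum_(j < n) qf (S j) x.
  by rewrite qfB qf_sum qf_id.
have lower x : qf (connection f A0 B0) x <= qf X x.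
  rewrite qX lerBrDr /At /Bt !split1.
  exact: (connection_sum_ge fm fq fp (index_enum 'I_n) x pA0 pB0 pA pB t1).
have upper x : qf X x <= qf Y x.
  rewrite qX qY.
  have := connection_sum_ge fm fq fp (index_enum 'I_n) x pAt pBt pA pB t0.
  rewrite /At /Bt !subrK => /le_trans /(_ (connection_id fm fq fp x f1)) h.
  have E : \sum_(j < n) qf (S j) x = \sum_(j < n) t j * qf (S j) x +
      \sum_(j < n) (1 - t j) * qf (S j) x.
    by rewrite -big_split/=; apply: eq_bigr => j _; ring.
  rewrite E opprD addrA lerD2r lerBrDr; exact: h.
have pC0 := pos_connection fm fq fp pA0 pB0.
have pC := pos_connection fm fq fp pAt pBt.
have pX : pos X.
  apply/pos_qf; split.
  - by apply: blin_sub; [case/pos_qf: pC|apply: blin_sum => j _; apply: blin_scale; case/pos_qf: (pS j)].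
  - apply: symmB; first by case/pos_qf: pC.
    suff /pos_qf[] : pos (\sum_(j < n) (1 - t j)%:C *: S j) by [].
    by apply: pos_sum => j; exact: (pos_scale (t1 j) (pS j)).
  - by move=> x; apply: le_trans (lower x); case/pos_qf: pC0.
have pY : pos Y.
  have /pos_qf[bS sS _] : pos (\sum_(j < n) S j) by exact: pos_sum.
  apply/pos_qf; split; [apply: blin_sub => //; exact: blin_id|exact: symmB|].
  by move=> x; apply: le_trans (upper x); case/pos_qf: pX.
have pos_positive (C : H -> H) : pos C -> positive_op C.
  by move=> /pos_qf[bC sC qC]; apply/positive_opP.
have pos_le (C D : H -> H) : pos C -> pos D -> (forall x, qf C x <= qf D x) -> le_op C D.
  by move=> /pos_qf[bC sC _] /pos_qf[bD sD _] h; apply/le_opP.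
have pXp := pos_pow_op hp pX; have pYp := pos_pow_op hp pY.
split; [exact: pos_positive|exact: pos_positive| |].
- apply: (pos_le _ _ (pos_connection gm gq gp pA0 pB0) pXp) => x.
  apply: (@le_trans _ _ (qf (pow_op (connection f A0 B0) p) x)).
    apply: connection_pow_le => // z.
    (* The hypothesis A <= 1 of [connection_pow_le] holds for A0 because the A j are positive. *)
    have /pos_qf[_ _] : pos (\sum_(j < n) A j) by exact: pos_sum.
    by move=> /(_ z); rewrite qfB qf_id gerBl.
  exact: loewner_heinz.
- by apply: pos_le => // x; exact: loewner_heinz.
Qed.
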